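(* There exist constants $0<c,C<\infty$ such that for all $n\ge1$ and all $v=(v_1,v_2)\in[0,n]^2\cap\mathbb{Z}^2$ with $|v|_1\le n$: (i) if $v\neq 0$, then $\displaystyle \mathbb{P}\big(v\in\pi(0,n\mathbf{e}_+)\big)\le C\exp\Big(-c\frac{|v_2-v_1|^3}{|v|_1^2}\Big)$; (ii) if $|v|_1\ge 2$, then $\displaystyle \mathbb{P}\big(v\in\pi(0,n\mathbf{e}_+)\big)\le C\Big(\frac{\log|v|_1}{|v|_1}\Big)^{2/3}$.
   Context: Fix $p\in(0,1)$ and let $(\omega_x)_{x\in\mathbb{Z}^2}$ be i.i.d. with $\mathbb{P}(\omega_x=k)=p(1-p)^k$, $k\in\{0,1,2,\dots\}$. For $u\le v$ (coordinatewise), a directed path from $u$ to $v$ is a sequence $u=x_0,\dots,x_m=v$ with increments in $\{(1,0),(0,1)\}$; $T(u,v)$ is the maximum of $\sum_{x\in\gamma}\omega_x$ over directed paths $\gamma$ from $u$ to $v$, and a geodesic is a maximizing path. $\pi(u,v)$ is the set of vertices lying on at least one geodesic from $u$ to $v$. $\mathbf{e}_+=(1,1)$, $|v|_1=|v_1|+|v_2|$. The constants may depend on $p$. *)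

(* Defs.v *)
From HB Require Import structures.
From mathcomp Require Import all_boot all_order all_algebra.
From mathcomp Require Import all_classical all_reals all_analysis.
Set Implicit Arguments. Unset Strict Implicit. Unset Printing Implicit Defensive.
Import Order.TTheory GRing.Theory Num.Theory.
Local Open Scope classical_set_scope.
Local Open Scope ring_scope.

(* Vertices of the quadrant Z_{>=0}^2 as pairs of naturals (every directed
   path from 0 to n e_+ stays in [0,n]^2). *)
Definition pt := (nat * nat)%type.

Definition dstep (x y : pt) : bool :=
  (y == (x.1.+1, x.2)) || (y == (x.1, x.2.+1)).

Definition dpath (u v : pt) (s : seq pt) : bool :=
  path dstep u s && (last u s == v).

Definition pweight (om : pt -> nat) (u : pt) (s : seq pt) : nat :=
  \sum_(x <- u :: s) om x.

Definition geodesic (om : pt -> nat) (u v : pt) (s : seq pt) : Prop :=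
  dpath u v s /\
  forall s' : seq pt, dpath u v s' -> (pweight om u s' <= pweight om u s)%N.

Definition in_geod (om : pt -> nat) (u v x : pt) : Prop :=
  exists s : seq pt, geodesic om u v s /\ x \in u :: s.

Definition config (n : nat) := {ffun 'I_n.+1 * 'I_n.+1 -> nat}.

(* Environment on pt induced by a box configuration (only its values on
   [0,n]^2 matter for paths from 0 to (n,n)). *)
Definition env (n : nat) (w : config n) : pt -> nat :=
  fun x => w (inord x.1, inord x.2).

(* Law of i.i.d. Geometric(p) weights, P(omega_x = k) = p (1-p)^k, restricted
   to the box: probability of an event E on box configurations. *)
Definition geom_prob {R : realType} (p : R) (n : nat) (E : config n -> Prop)
  : \bar R :=
  \esum_(w in [set w | E w])
     ((\prod_(x : 'I_n.+1 * 'I_n.+1) (p * (1 - p) ^+ (w x)))%:E).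

(* Main.v *)
(* Put q = 1 - p and s = sqrt q. If a geodesic from 0 to (n, n) goes up from (c, r), then column c
   maximises, over the edges between rows r and r + 1, the sum of the passage time from 0 and of
   the passage time to (n, n). These two are independent, so the partial sums of the horizontal
   increments of one of them stay below those of the other, on both sides of c. Passage times with
   geometric boundary weights of ratios x and q / x are stationary: by Burke's property their
   horizontal increments are i.i.d. of ratio x. Comparing with such models costs the probability
   that the stationary geodesic exits through the wrong axis, which is controlled by exponential
   moments. Burke's involution also conserves passage times, so the increments of the exit model on
   the left of c are independent of the stationary increments on the right of c, and the two
   one-sided events are nearly independent.

   With relative drift k between the two increments, a walk of k^-2 steps stays nonnegative with
   probability O(k), and the exit errors are exp(- c k^3 N) where N = c + r. Both sides together
   give k^2, and k^3 of order log N / N gives (ii). When (c, r) is off the diagonal, taking k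
   proportional to |r - c| / N lets the characteristic direction of the models have the drift
   against the event for k N steps; this gives exp(- c k^3 N), which is (i). *)

(* Only edges going up are estimated: a geodesic leaves every vertex other than (n, n) by an edge,
   and reflection in the diagonal turns a right edge into an up edge. Optimality of the edge enters
   through weak inequalities only, so ties between geodesics are harmless.

   The ratio s is the one whose characteristic direction is the diagonal; the models used have axis
   ratios s (1 + k)^j and s (1 + k)^-j with j = 2 or 4. The cube in k^3 N is a product: the exponent
   of an exit is a second-order factor k^2 times the difference, of order k N, between the variances
   summed along the two axes. In (ii) the exit errors must not exceed k^2, and this is where the
   logarithm enters. The two-sided argument reaches vertices within order k N of the diagonal;
   beyond, |r - c|^3 / N^2 is at least of order k^3 N and (i) applies.

   The obstacle in (ii) is that the increments on both sides of c read the same weights. An exchange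
   of rows rewrites the bound for the left ones in dual weights, which do not see the stationary
   increments on the right. *)
Require Import Defs.
From HB Require Import structures.
From mathcomp Require Import all_boot all_order all_algebra.
From mathcomp Require Import all_classical all_reals all_analysis.
From mathcomp Require Import zify ring lra.
Import Order.TTheory GRing.Theory Num.Theory.
Set Implicit Arguments. Unset Strict Implicit. Unset Printing Implicit Defensive.
Local Open Scope classical_set_scope.
Local Open Scope ring_scope.

(* [lpp om j i] is the last passage time from the origin to column [i] of row [j]; the weight
   at the origin is left out. *)
Fixpoint rowmax (w : nat -> nat) (b : nat) (f : nat -> nat) (i : nat) : nat :=
  if i is i'.+1 then (w i + maxn (rowmax w b f i') (f i))%N else b.

Fixpoint lpp (om : pt -> nat) (j : nat) : nat -> nat :=
  if j is j'.+1 then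
    rowmax (fun i => om (i, j)) (om (0%N, j) + lpp om j' 0%N)%N (lpp om j')
  else rowmax (fun i => om (i, 0%N)) 0%N (fun _ => 0%N).

Arguments lpp : simpl never.

Definition dincr (f : nat -> nat) (i : nat) : nat := (f i.+1 - f i)%N.

Lemma lppSS om j i : lpp om j.+1 i.+1 =
  (om (i.+1, j.+1) + maxn (lpp om j.+1 i) (lpp om j i.+1))%N.
Proof. by []. Qed.

Lemma lpp0S om i : lpp om 0 i.+1 = (om (i.+1, 0%N) + lpp om 0 i)%N.
Proof. by rewrite /lpp /= maxn0. Qed.

Lemma lppS0 om j : lpp om j.+1 0 = (om (0%N, j.+1) + lpp om j 0)%N.
Proof. by []. Qed.

Lemma lpp_leh om j i : (lpp om j i <= lpp om j i.+1)%N.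
Proof. by case: j => [|j]; rewrite ?lpp0S ?lppSS; lia. Qed.

Lemma lpp_lev om j i : (lpp om j i <= lpp om j.+1 i)%N.
Proof. by case: i => [|i]; rewrite ?lppS0 ?lppSS; lia. Qed.

Lemma rowmax_ext w w' b f f' i :
  (forall k, (0 < k <= i)%N -> w k = w' k) ->
  (forall k, (0 < k <= i)%N -> f k = f' k) -> rowmax w b f i = rowmax w' b f' i.
Proof.
elim: i => //= i IH hw hf.
rewrite hw ?leqnn // hf ?leqnn // IH // => k hk; [apply: hw|apply: hf]; lia.
Qed.

(** * Monotonicity of increments in the boundary weights *)

Definition bulk_eq (a b : pt -> nat) := forall i j, a (i.+1, j.+1) = b (i.+1, j.+1).

(** The two halves need a joint induction: on a unit square with increments I, J and weight w, the
    opposite increments w + (I - J)^+ and w + (J - I)^+ are monotone in opposite senses in I and J.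
    Sums replace differences because subtraction on [nat] truncates. *)
Lemma lpp_compare a b : bulk_eq a b ->
  (forall i, a (i.+1, 0%N) <= b (i.+1, 0%N))%N ->
  (forall j, b (0%N, j.+1) <= a (0%N, j.+1))%N ->
  forall i j, (lpp a j i.+1 + lpp b j i <= lpp b j i.+1 + lpp a j i)%N /\
              (lpp b j.+1 i + lpp a j i <= lpp a j.+1 i + lpp b j i)%N.
Proof.
move=> hab hx hy i j.
elim: j i => [|j IHj] i.
  have H0 : forall k, (lpp a 0 k.+1 + lpp b 0 k <= lpp b 0 k.+1 + lpp a 0 k)%N.
    by move=> k; rewrite !lpp0S; have := hx k; lia.
  split; first exact: H0.
  elim: i => [|i IHi]; first by rewrite !lppS0; have := hy 0%N; lia.
  by rewrite !lppSS hab; have := H0 i; lia.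
have H1 : forall k, (lpp b j.+1 k + lpp a j k <= lpp a j.+1 k + lpp b j k)%N.
  by move=> k; case: (IHj k).
have H0 : forall k, (lpp a j.+1 k.+1 + lpp b j.+1 k <= lpp b j.+1 k.+1 + lpp a j.+1 k)%N.
  move=> k; rewrite !lppSS hab; have [h1 h2] := IHj k; lia.
split; first exact: H0.
elim: i => [|i IHi]; first by rewrite [lpp b j.+2 _]lppS0 [lpp a j.+2 _]lppS0; have := hy j.+1; lia.
by rewrite (lppSS b j.+1) (lppSS a j.+1) hab; have := H0 i; lia.
Qed.

(* By [lpp_max], only paths leaving along the y-axis matter for [zerox om], and only those
   leaving along the x-axis for [zeroy om]. *)
Definition zerox (om : pt -> nat) : pt -> nat := fun x => if x.2 == 0%N then 0%N else om x.
Definition zeroy (om : pt -> nat) : pt -> nat := fun x => if x.1 == 0%N then 0%N else om x.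

Lemma lpp_max om j i : lpp om j i = maxn (lpp (zerox om) j i) (lpp (zeroy om) j i).
Proof.
elim: j i => [|j IHj] i.
  have eV k : lpp (zerox om) 0 k = 0%N by elim: k => // k IH; rewrite lpp0S IH.
  rewrite eV max0n; elim: i => // i IHi; by rewrite !lpp0S IHi.
have hV k : lpp (zeroy om) k 0 = 0%N by elim: k => // k IH; rewrite lppS0 IH.
elim: i => [|i IHi]; first by rewrite !lppS0 IHj !hV /zerox /zeroy /=; lia.
by rewrite !lppSS IHi IHj /zerox /zeroy /=; lia.
Qed.

(** In the names below, [V], [T] and [H] stand for the passage times that keep the vertical axis
    only, no axis, and the horizontal axis only. Their horizontal increments are ordered in this
    way. *)
Lemma incr_V_T om j i :
  (lpp (zerox om) j i.+1 + lpp (zerox (zeroy om)) j i <=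
   lpp (zerox (zeroy om)) j i.+1 + lpp (zerox om) j i)%N.
Proof. by apply: (fun h1 h2 h3 => (lpp_compare h1 h2 h3 i j).1). Qed.

Lemma incr_T_H om j i :
  (lpp (zerox (zeroy om)) j i.+1 + lpp (zeroy om) j i <=
   lpp (zeroy om) j i.+1 + lpp (zerox (zeroy om)) j i)%N.
Proof. by apply: (fun h1 h2 h3 => (lpp_compare h1 h2 h3 i j).1). Qed.

Lemma incr_V_H om j i :
  (lpp (zerox om) j i.+1 + lpp (zeroy om) j i <=
   lpp (zeroy om) j i.+1 + lpp (zerox om) j i)%N.
Proof. by apply: (fun h1 h2 h3 => (lpp_compare h1 h2 h3 i j).1). Qed.

Lemma VH_mono om j i i' : (i <= i')%N ->
  (lpp (zerox om) j i' + lpp (zeroy om) j i <= lpp (zeroy om) j i' + lpp (zerox om) j i)%N.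
Proof.
elim: i' => [|i' IH]; first by rewrite leqn0 => /eqP ->; lia.
rewrite leq_eqVlt => /orP[/eqP <-|]; first by lia.
by move=> /IH; have := incr_V_H om j i'; lia.
Qed.

(* If the geodesic to the rightmost point exits through the vertical axis,
   so does the one to every point to its left. *)
Lemma dincr_stat_le_T om j m i : (i < m)%N ->
  (lpp (zeroy om) j m <= lpp (zerox om) j m)%N ->
  (dincr (lpp om j) i <= dincr (lpp (zerox (zeroy om)) j) i)%N.
Proof.
move=> im hm; rewrite /dincr !(lpp_max om).
have := VH_mono om j im; have := VH_mono om j (ltnW im).
by have := incr_V_T om j i; lia.
Qed.

(** By [VH_mono] a horizontal exit at column [m] persists to its right, and there the full passage
    time is the one that ignores the y-axis. *)
Lemma dincr_H_stat om j m i : (m <= i)%N ->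
  (lpp (zerox om) j m <= lpp (zeroy om) j m)%N ->
  dincr (lpp (zeroy om) j) i = dincr (lpp om j) i.
Proof.
move=> im hm; rewrite /dincr !(lpp_max om).
have := VH_mono om j im; have := VH_mono om j (leqW im).
by lia.
Qed.

Lemma dincr_T_le_H om j i :
  (dincr (lpp (zerox (zeroy om)) j) i <= dincr (lpp (zeroy om) j) i)%N.
Proof. by rewrite /dincr; have := incr_T_H om j i; lia. Qed.

(* The Burke map on a unit square: the increments at [x] and [y] and the bulk weight at [z]
   become the opposite increments and the dual weight; see [gsum_burke]. *)
Definition flip {K : eqType} (x y z : K) (om : K -> nat) : K -> nat := fun u =>
  if u == x then (om z + (om x - om y))%N
  else if u == y then (om z + (om y - om x))%N
  else if u == z then minn (om x) (om y) else om u.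

(** * The Burke map iterated over a strip *)

Definition dual (om : pt -> nat) (i j : nat) : nat :=
  minn (lpp om j.-1 i - lpp om j.-1 i.-1) (lpp om j i.-1 - lpp om j.-1 i.-1).

(* The weights after the flips of rows [1 .. j] and of the first [i] cells of row [j + 1]: the
   x-axis carries the increments along the current down-right path, the y-axis the increments
   of the right boundary already reached, and the processed bulk the dual weights. *)
Definition burke_state (om : pt -> nat) (m j i : nat) : pt -> nat := fun u =>
  let: (a, b) := u in
  if b == 0%N then
    if (0 < a <= m)%N then
      (if (a <= i)%N then lpp om j.+1 a - lpp om j.+1 a.-1
       else lpp om j a - lpp om j a.-1)%N
    else om u
  else if a == 0%N then
    if (b <= j)%N then (lpp om b m - lpp om b.-1 m)%N
    else if b == j.+1 then (lpp om b i - lpp om b.-1 i)%N else om u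
  else if ((b <= j)%N && (a <= m)%N) || ((b == j.+1) && (a <= i)%N) then dual om a b
  else om u.

Lemma burke_state0 om m : burke_state om m 0 0 = om.
Proof.
apply/funext => -[a b]; rewrite /burke_state.
case: eqP => [->|hb].
  by case: a => [|a] //=; case: ifP => // _; rewrite lpp0S; lia.
case: eqP => [->|ha].
  by case: b hb => [|[|b]] //= _; rewrite lppS0 addnK.
by case: ifP => //; lia.
Qed.

Lemma burke_state_next om m j : burke_state om m j m = burke_state om m j.+1 0.
Proof.
apply/funext => -[a b]; rewrite /burke_state.
case: eqP => [->|hb].
  by case: ifP => // ham; rewrite ifT ?ifF //; lia.
case: eqP => [->|ha].
  case: (ltngtP b j.+1) => [hbj|hbj|->].
  - by rewrite !ifT //; lia.
  - rewrite ifF; last by lia.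
    by case: eqP => // hb2; rewrite hb2 /= lppS0 addnK.
  - by rewrite ifF ?leqnn //; lia.
congr (if _ then _ else _); apply/idP/idP; lia.
Qed.

(** One cell of the passage time recursion is one [flip], so the law of the whole strip can be
    followed through a single-square identity. *)
Lemma burke_state_flip om m j i : (i < m)%N ->
  burke_state om m j i.+1 =
  flip (i.+1, 0%N) (0%N, j.+1) (i.+1, j.+1) (burke_state om m j i).
Proof.
move=> im; apply/funext => -[a b]; rewrite /flip.
have e1 : burke_state om m j i (i.+1, 0%N) = (lpp om j i.+1 - lpp om j i)%N.
  by rewrite /burke_state /= ifT ?ifF //; lia.
have e2 : burke_state om m j i (0%N, j.+1) = (lpp om j.+1 i - lpp om j i)%N.
  by rewrite /burke_state /= ifF ?eqxx //; lia.
have e3 : burke_state om m j i (i.+1, j.+1) = om (i.+1, j.+1).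
  by rewrite /burke_state /= ifF //; lia.
rewrite e1 e2 e3.
have h1 := lpp_leh om j i; have h2 := lpp_lev om j i.
case: eqP => [[-> ->]|n1].
  by rewrite /burke_state /= leqnn im lppSS; lia.
case: eqP => [[-> ->]|n2].
  by rewrite /burke_state /= ltnn eqxx lppSS; lia.
case: eqP => [[-> ->]|n3].
  by rewrite /burke_state /= eqxx leqnn orbT.
rewrite /burke_state; case: eqP => [hb|hb].
  case: ifP => // ha; case: (ltngtP a i.+1) => hai.
  - by rewrite !ifT //; lia.
  - by rewrite !ifF //; lia.
  - by case: n1; rewrite hb hai.
case: eqP => [ha|ha].
  by case: ifP => // hbj; case: eqP => // hbj1; case: n2; rewrite ha hbj1.
congr (if _ then _ else _).
case: (eqVneq b j.+1) => [hbj|] //=.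
have hai : a <> i.+1 by move=> hai; apply: n3; rewrite hbj hai.
congr orb; lia.
Qed.

Definition burke (om : pt -> nat) (m h : nat) := burke_state om m h 0.

Lemma burke_top om m h i : (i < m)%N -> burke om m h (i.+1, 0%N) = dincr (lpp om h) i.
Proof. by move=> im; rewrite /burke /burke_state /= ifT //. Qed.

Lemma burke_right om m h j : (j < h)%N ->
  burke om m h (0%N, j.+1) = (lpp om j.+1 m - lpp om j m)%N.
Proof. by move=> jh; rewrite /burke /burke_state /= ifT //. Qed.

Lemma burke_bulk om m h i j : (i < m)%N -> (j < h)%N ->
  burke om m h (i.+1, j.+1) = dual om i.+1 j.+1.
Proof. by move=> im jh; rewrite /burke /burke_state /= ifT //; lia. Qed.

(* Invariant: first passage value through the lower row equals
   max (total - sojourn, value through the dual row). *)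
Lemma rowmax_swap (sg w D Rr J f : nat -> nat) (m : nat) :
  (forall i, (i < m)%N -> D i.+1 = w i.+1 + (sg i.+1 - J i))%N ->
  (forall i, (i < m)%N -> Rr i.+1 = minn (sg i.+1) (J i)) ->
  (forall i, (i < m)%N -> J i.+1 = w i.+1 + (J i - sg i.+1))%N ->
  forall i, (i <= m)%N ->
  rowmax w 0 (rowmax sg 0 f) i = rowmax D 0 (rowmax Rr 0 f) i /\
  rowmax sg 0 f i = maxn (rowmax w 0 (rowmax sg 0 f) i - J i) (rowmax Rr 0 f i).
Proof.
move=> hD hR hJ; elim=> [|i IH] him; first by rewrite /= sub0n maxn0.
have [e1 e2] := IH (ltnW him).
rewrite /= (hD _ him) (hR _ him) (hJ _ him) -e1.
set M := rowmax w 0 _ i in e1 e2 *.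
set S := rowmax sg 0 f i in e2 *; set SR := rowmax Rr 0 f i in e2 *.
by split; lia.
Qed.

Fixpoint dual_rows (om : pt -> nat) (h : nat) : nat -> nat :=
  if h is h'.+1 then rowmax (fun i => om (i, h)) 0 (dual_rows om h') else fun _ => 0%N.

(** In the dual picture the boundary row comes last: the top increments, which [burke] stores on the
    x-axis, are traversed after the dual bulk rows. *)
Definition dual_lpp (om : pt -> nat) (h : nat) : nat -> nat :=
  rowmax (fun i => om (i, 0%N)) 0 (dual_rows om h).

Lemma lpp_stepI om j i :
  (lpp om j.+1 i.+1 - lpp om j.+1 i =
   om (i.+1, j.+1) + ((lpp om j i.+1 - lpp om j i) - (lpp om j.+1 i - lpp om j i)))%N.
Proof. rewrite lppSS; have := lpp_leh om j i; have := lpp_lev om j i; lia. Qed.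

Lemma lpp_stepJ om j i :
  (lpp om j.+1 i.+1 - lpp om j i.+1 =
   om (i.+1, j.+1) + ((lpp om j.+1 i - lpp om j i) - (lpp om j i.+1 - lpp om j i)))%N.
Proof. rewrite lppSS; have := lpp_leh om j i; have := lpp_lev om j i; lia. Qed.

(** [rowmax_swap] moves the boundary row up past one bulk row at a time without changing the passage
    time. The outcome reads dual weights and top increments in columns up to [i] only; this is the
    source of independence in [joint_increments]. *)
Lemma lpp_zeroy_dual om h m i : (i <= m)%N ->
  lpp (zeroy om) h i = dual_lpp (burke om m h) h i.
Proof.
(* [R] takes the dual weights from [om] itself, so that the induction on [h] is not tied to the
   strip of one fixed [burke om m h]. *)
pose R := fix R h := if h is h'.+1 then rowmax (fun i => dual om i h) 0 (R h') else fun _ => 0%N.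
have hR : forall k i, (k <= h)%N -> (i <= m)%N -> dual_rows (burke om m h) k i = R k i.
  elim=> //= k IHk i' kh im; apply: rowmax_ext => l /andP[l0 li].
    by case: l l0 li => // l _ li; apply: burke_bulk; lia.
  by apply: IHk; lia.
move=> him; rewrite /dual_lpp.
transitivity (rowmax (fun i => lpp om h i - lpp om h i.-1)%N 0 (R h) i); last first.
  apply: rowmax_ext => l /andP[l0 li]; last by rewrite hR //; lia.
  by case: l l0 li => // l _ li; rewrite burke_top //; lia.
have e0 k : lpp (zeroy om) k 0 = 0%N by elim: k => // k IH; rewrite lppS0 IH.
elim: h i {hR him} => [|h IH] i.
  apply: rowmax_ext => // -[|k] //= _.
  by rewrite lpp0S addnK.
transitivity (rowmax (fun k => om (k, h.+1)) 0
   (rowmax (fun i => lpp om h i - lpp om h i.-1)%N 0 (R h)) i).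
  rewrite [LHS]/(lpp _ _.+1 _) /= -/(lpp _) e0 addn0 /zeroy /=.
  apply: rowmax_ext => k /andP[k0 ki]; last exact: IH.
  by case: k k0 ki.
have [-> _] := @rowmax_swap (fun i => lpp om h i - lpp om h i.-1)%N (fun k => om (k, h.+1))
  (fun i => lpp om h.+1 i - lpp om h.+1 i.-1)%N (fun i => dual om i h.+1)
  (fun i => lpp om h.+1 i - lpp om h i)%N (R h) i
  (fun k _ => lpp_stepI om h k) (fun k _ => erefl) (fun k _ => lpp_stepJ om h k) i (leqnn i).
by [].
Qed.

Lemma lpp_bottom_right om h m :
  lpp om h m = (\sum_(i < m) om (i.+1, 0) + \sum_(j < h) (lpp om j.+1 m - lpp om j m))%N.
Proof.
elim: h => [|h IH].
  by rewrite big_ord0 addn0; elim: m => [|m IH]; rewrite ?big_ord0 // big_ord_recr lpp0S IH /=; lia.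
by rewrite big_ord_recr /= addnA -IH; have := lpp_lev om h m; lia.
Qed.

(** * Sums against a geometric law *)

Local Open Scope ereal_scope.

Definition gsum {R : realType} (r : R) (f : nat -> \bar R) : \bar R :=
  \esum_(k in [set: nat]) (((1 - r) * r ^+ k)%:E * f k).

Section GeometricSum.
Context {R : realType}.
Implicit Types (r t x y : R) (f g : nat -> \bar R).

Lemma gweight_ge0 r k : (0 <= r < 1)%R -> 0 <= ((1 - r) * r ^+ k)%:E.
Proof. by move=> /andP[r0 r1]; rewrite lee_fin mulr_ge0 ?exprn_ge0 ?subr_ge0 // ltW. Qed.

Lemma gsum_ge0 r f : (0 <= r < 1)%R -> (forall k, 0 <= f k) -> 0 <= gsum r f.
Proof. by move=> hr f0; apply: esum_ge0 => k _; rewrite mule_ge0 ?gweight_ge0. Qed.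

Lemma le_gsum r f g : (0 <= r < 1)%R -> (forall k, f k <= g k) -> gsum r f <= gsum r g.
Proof. by move=> hr fg; apply: le_esum => k _; apply: lee_wpmul2l; rewrite ?gweight_ge0. Qed.

Lemma eq_gsum r f g : (forall k, f k = g k) -> gsum r f = gsum r g.
Proof. by move=> fg; apply: eq_esum => k _; rewrite fg. Qed.

Lemma gsumD r f g : (0 <= r < 1)%R -> (forall k, 0 <= f k) -> (forall k, 0 <= g k) ->
  gsum r (fun k => f k + g k) = gsum r f + gsum r g.
Proof.
move=> hr f0 g0; rewrite /gsum -esumD; last 2 first.
- by move=> k _; rewrite mule_ge0 ?gweight_ge0.
- by move=> k _; rewrite mule_ge0 ?gweight_ge0.
by apply: eq_esum => k _; rewrite ge0_muleDr.
Qed.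

Lemma gsumZl r c f : (0 <= r < 1)%R -> (0 <= c)%R -> (forall k, 0 <= f k) ->
  gsum r (fun k => c%:E * f k) = c%:E * gsum r f.
Proof.
move=> hr c0 f0; have h k : 0 <= ((1 - r) * r ^+ k)%:E * f k.
  by rewrite mule_ge0 ?gweight_ge0.
rewrite /gsum -!nneseries_esumT //; last first.
  by move=> k; rewrite muleCA mule_ge0.
by rewrite -nneseriesZl //; apply: eq_eseriesr => k _; rewrite muleCA.
Qed.

Lemma gsum1 r : (0 <= r < 1)%R -> gsum r (fun=> 1) = 1.
Proof.
move=> hr; rewrite /gsum -nneseries_esumT; last first.
  by move=> k; rewrite mule1 gweight_ge0.
transitivity (\sum_(0 <= k <oo) ((1 - r) * r ^+ k)%:E).
  by apply: eq_eseriesr => k _; rewrite mule1.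
apply: cvg_lim => //; case/andP: hr => r0 r1.
have := @cvg_geometric_series R (1 - r)%R r; rewrite ger0_norm // => /(_ r1).
rewrite mulfV ?subr_eq0 ?gt_eqF // => h.
apply/fine_cvgP; split; first by apply: nearW => n; rewrite sumEFin.
rewrite (_ : _ \o _ = series (geometric (1 - r)%R r)) //.
by apply/funext => n /=; rewrite sumEFin.
Qed.

Lemma gsum_cst r (c : \bar R) : (0 <= r < 1)%R -> 0 <= c -> gsum r (fun=> c) = c.
Proof.
move=> hr; case: c => [c| |] // c0.
  rewrite -[RHS]mule1 -[in RHS](gsum1 hr) -gsumZl //.
  by apply: eq_gsum => k; rewrite mule1.
apply/eqP; rewrite eq_le leey /=; apply: esum_ge; exists [set 0%N].
  by split => //; exact: finite_set1.
rewrite fsbig_set1 expr0 mulr1 gt0_muley // lte_fin subr_gt0.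
by case/andP: hr.
Qed.

Lemma gsum_le1 r f : (0 <= r < 1)%R -> (forall k, f k <= 1) -> gsum r f <= 1.
Proof. by move=> hr f1; rewrite -(gsum1 hr); apply: le_gsum. Qed.

Lemma gsum_pairE x y (F : nat -> nat -> \bar R) : (0 <= x < 1)%R -> (0 <= y < 1)%R ->
  (forall a b, 0 <= F a b) ->
  gsum x (fun a => gsum y (F a)) = \esum_(p in [set: nat * nat])
    (((1 - x) * x ^+ p.1 * ((1 - y) * y ^+ p.2))%:E * F p.1 p.2).
Proof.
move=> hx hy F0; rewrite /gsum.
transitivity (\esum_(a in [set: nat]) \esum_(b in [set: nat])
  (((1 - x) * x ^+ a * ((1 - y) * y ^+ b))%:E * F a b)).
  apply: eq_esum => a _.
  have h0 : (0 <= (1 - x) * x ^+ a)%R by rewrite -lee_fin gweight_ge0.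
  rewrite -[X in _ * X]/(gsum y (F a)) -gsumZl //.
  by apply: eq_esum => b _; rewrite muleA -EFinM mulrC.
rewrite esum_esum; last first.
  move=> a b _ _; rewrite mule_ge0 // lee_fin mulr_ge0 //.
    by rewrite -lee_fin gweight_ge0.
  by rewrite -lee_fin gweight_ge0.
by congr esum; apply/seteqP; split.
Qed.

Lemma gsum_swap x y (F : nat -> nat -> \bar R) : (0 <= x < 1)%R -> (0 <= y < 1)%R ->
  (forall a b, 0 <= F a b) ->
  gsum x (fun a => gsum y (F a)) = gsum y (fun b => gsum x (F^~ b)).
Proof.
move=> hx hy F0; rewrite !gsum_pairE //.
rewrite (@reindex_esum _ _ _ setT setT (fun p : nat * nat => (p.2, p.1))) /=.
  by apply: eq_esum => -[a b] _ /=; rewrite mulrC.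
by split => // [[a b] [c d] _ _ /= [-> ->]|[a b] _ /=]; last by exists (b, a).
Qed.

Lemma gsum_tilt r t f : (0 <= r < 1)%R -> (0 <= t)%R -> (r * t < 1)%R ->
  (forall k, 0 <= f k) ->
  gsum r (fun k => (t ^+ k)%:E * f k) = ((1 - r) / (1 - r * t))%:E * gsum (r * t)%R f.
Proof.
move=> hr t0 rt f0; have /andP[r0 r1] := hr.
rewrite -gsumZl //; first last.
- by rewrite divr_ge0 // subr_ge0 ltW.
- by rewrite mulr_ge0.
apply: eq_esum => k _; rewrite !muleA; congr (_ * _).
rewrite -!EFinM exprMn; congr EFin; field.
by rewrite subr_eq0 gt_eqF.
Qed.

Lemma gsum_mgf r t : (0 <= r < 1)%R -> (0 <= t)%R -> (r * t < 1)%R ->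
  gsum r (fun k => (t ^+ k)%:E) = ((1 - r) / (1 - r * t))%:E.
Proof.
move=> hr t0 rt; have /andP[r0 r1] := hr.
transitivity (gsum r (fun k => (t ^+ k)%:E * 1)); first by apply: eq_gsum => k; rewrite mule1.
by rewrite gsum_tilt // gsum1 ?mule1 // mulr_ge0.
Qed.

(* Compare with the value [c] of [f] at the crossing point of the two weights. *)
Lemma gsum_mono r r' (f : nat -> R) : (0 <= r)%R -> (r <= r')%R -> (r' < 1)%R ->
  (forall k, (0 <= f k <= 1)%R) -> (forall k, (f k <= f k.+1)%R) ->
  gsum r (fun k => (f k)%:E) <= gsum r' (fun k => (f k)%:E).
Proof.
move=> r0 rr r1 f01 fS.
have hr : (0 <= r < 1)%R by rewrite r0 (le_lt_trans rr r1).
have hr' : (0 <= r' < 1)%R by rewrite r1 (le_trans r0 rr).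
have fm i j : (i <= j)%N -> (f i <= f j)%R.
  by move/subnK <-; elim: (j - i)%N => // n IH; rewrite addSn (le_trans IH).
pose w k := ((1 - r) * r ^+ k)%R; pose w' k := ((1 - r') * r' ^+ k)%R.
have ww k : (w k <= w' k)%R -> (w k.+1 <= w' k.+1)%R.
  have wk0 : (0 <= w k)%R by rewrite -lee_fin gweight_ge0.
  move=> h; rewrite /w /w' !exprSr !mulrA.
  by apply: ler_pM.
have ww2 i j : (i <= j)%N -> (w i <= w' i)%R -> (w j <= w' j)%R.
  by move/subnK <-; elim: (j - i)%N => // n IH h; rewrite addSn; apply: ww; apply: IH.
pose A := [set f k | k in [set k | (w' k < w k)%R]] `|` [set 0%R].
have A0 : A !=set0 by exists 0%R; right.
have Aub : has_ubound A.
  by exists 1%R => _ [[k _ <-]| ->] //; have /andP[] := f01 k.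
pose c := sup A.
have c0 : (0 <= c)%R by apply: ub_le_sup => //; right.
have key k : (w k * f k + w' k * c <= w' k * f k + w k * c)%R.
  have -> : (w k * f k + w' k * c <= w' k * f k + w k * c)%R =
            (0 <= (w' k - w k) * (f k - c))%R by lra.
  have [h|h] := leP (w k) (w' k).
    apply: mulr_ge0; rewrite subr_ge0 // ge_sup // => _ [[j /= hj <-]| ->]; last first.
      by have /andP[] := f01 k.
    apply: fm; rewrite leqNgt; apply/negP => kj.
    by have := ww2 _ _ (ltnW kj) h; rewrite leNgt hj.
  rewrite -mulrNN; apply: mulr_ge0; rewrite oppr_ge0 subr_le0; first exact: ltW.
  by apply: ub_le_sup => //; left; exists k.
have : gsum r (fun k => (f k)%:E) + gsum r' (fun k => c%:E) <=
       gsum r' (fun k => (f k)%:E) + gsum r (fun k => c%:E).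
  have fk0 k : 0 <= (f k)%:E by rewrite lee_fin; case/andP: (f01 k).
  have cE0 : 0 <= c%:E by rewrite lee_fin.
  rewrite /gsum -!esumD; try by move=> k _; rewrite mule_ge0 ?gweight_ge0 ?fk0.
  by apply: le_esum => k _; rewrite -!EFinM -!EFinD lee_fin; exact: key.
have ec q : (0 <= q < 1)%R -> gsum q (fun=> c%:E) = c%:E by move=> hq; apply: gsum_cst.
by rewrite !ec // leeD2rE.
Qed.

Definition burke_map (p : nat * (nat * nat)) : nat * (nat * nat) :=
  let: (a, (b, c)) := p in ((c + (a - b))%N, ((c + (b - a))%N, minn a b)).

Lemma burke_mapK : involutive burke_map.
Proof. by case=> a [b c] /=; congr (_, (_, _)); lia. Qed.

Lemma gsum_tripleE x y z (F : nat -> nat -> nat -> \bar R) :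
  (0 <= x < 1)%R -> (0 <= y < 1)%R -> (0 <= z < 1)%R ->
  (forall a b c, 0 <= F a b c) ->
  gsum x (fun a => gsum y (fun b => gsum z (F a b))) =
  \esum_(p in [set: nat * (nat * nat)])
    (((1 - x) * x ^+ p.1 * (((1 - y) * y ^+ p.2.1) * ((1 - z) * z ^+ p.2.2)))%:E
     * F p.1 p.2.1 p.2.2).
Proof.
move=> hx hy hz F0.
have w0 r k : (0 <= r < 1)%R -> (0 <= (1 - r) * r ^+ k)%R.
  by move=> h; rewrite -lee_fin gweight_ge0.
rewrite [LHS]/gsum.
transitivity (\esum_(a in [set: nat]) \esum_(p in [set: nat * nat])
  (((1 - x) * x ^+ a * (((1 - y) * y ^+ p.1) * ((1 - z) * z ^+ p.2)))%:E * F a p.1 p.2)).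
  apply: eq_esum => a _.
  transitivity (gsum y (fun b => gsum z (fun c => ((1 - x) * x ^+ a)%:E * F a b c))).
    rewrite -[X in _ * X]/(gsum y (fun b => gsum z (F a b))) -gsumZl ?w0 //.
      by apply: eq_gsum => b; rewrite gsumZl ?w0.
    by move=> b; exact: gsum_ge0.
  rewrite gsum_pairE // => [|b c]; last by rewrite mule_ge0 ?lee_fin ?w0.
  by apply: eq_esum => p _; rewrite muleA -EFinM; congr (_%:E * _); ring.
rewrite esum_esum => [|a p _ _]; last first.
  by rewrite mule_ge0 // lee_fin mulr_ge0 ?w0 // mulr_ge0 ?w0.
by congr esum; apply/seteqP; split.
Qed.

(** [burke_map] is an involution that preserves a + c and b + c, while the weight x^a y^b (x y)^c
    depends on these two sums only. *)
Lemma gsum_burke x y (F : nat -> nat -> nat -> \bar R) :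
  (0 <= x < 1)%R -> (0 <= y < 1)%R -> (forall a b c, 0 <= F a b c) ->
  gsum x (fun a => gsum y (fun b => gsum (x * y)%R (fun c =>
    F (c + (a - b))%N (c + (b - a))%N (minn a b)))) =
  gsum x (fun a => gsum y (fun b => gsum (x * y)%R (F a b))).
Proof.
move=> hx hy F0; have hz : (0 <= x * y < 1)%R.
  case/andP: hx hy => x0 x1 /andP[y0 y1]; rewrite mulr_ge0 //=.
  by rewrite mulr_ilt1.
rewrite (@gsum_tripleE x y _ F) // gsum_tripleE //.
rewrite [RHS](@reindex_esum _ _ _ setT setT burke_map); last first.
  by rewrite setTT_bijective; exact: inv_bij burke_mapK.
apply: eq_esum => -[a [b c]] _ /=; congr (_%:E * _).
have e1 : (c + (a - b) + minn a b = a + c)%N by lia.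
have e2 : (c + (b - a) + minn a b = b + c)%N by lia.
rewrite !exprMn.
transitivity ((1 - x) * (1 - y) * (1 - x * y) * (x ^+ (a + c) * y ^+ (b + c)))%R.
  by rewrite !exprD; ring.
by rewrite -e1 -e2 !exprD; ring.
Qed.

End GeometricSum.

(** * Expectations over independent geometric coordinates *)

Definition upd {K : eqType} (om : K -> nat) (x : K) (k : nat) : K -> nat :=
  fun u => if u == x then k else om u.

(* Expectation when the coordinates in [l] are independent geometric variables with ratios
   [par], the other ones being kept from the argument. *)
Definition expect {R : realType} {K : eqType} (par : K -> R) (l : seq K)
    (F : (K -> nat) -> \bar R) : (K -> nat) -> \bar R :=
  foldr (fun x H om => gsum (par x) (fun k => H (upd om x k))) F l.

Arguments expect : simpl never.

Definition const_in {R : realType} {K : eqType} (x : K) (F : (K -> nat) -> \bar R) :=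
  forall om k, F (upd om x k) = F om.

Definition incr_in {R : realType} {K : eqType} (x : K) (F : (K -> nat) -> \bar R) :=
  forall om k k', (k <= k')%N -> F (upd om x k) <= F (upd om x k').

Section Upd.
Context {K : eqType}.
Implicit Types (om : K -> nat).

Lemma upd_same om x k k' : upd (upd om x k) x k' = upd om x k'.
Proof. by apply/funext => u; rewrite /upd; case: eqP. Qed.

Lemma updC om x y k k' : x != y -> upd (upd om x k) y k' = upd (upd om y k') x k.
Proof.
move=> xy; apply/funext => u; rewrite /upd; case: (eqVneq u y) => // ->.
by rewrite eq_sym (negbTE xy).
Qed.

Lemma upd_at om x k : upd om x k x = k.
Proof. by rewrite /upd eqxx. Qed.

Lemma upd_neq om x k y : y != x -> upd om x k y = om y.
Proof. by rewrite /upd => /negbTE ->. Qed.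

End Upd.

Section Expect.
Context {R : realType} {K : eqType}.
Context (par : K -> R) (hpar : forall x, (0 <= par x < 1)%R).
Implicit Types (l : seq K) (F G : (K -> nat) -> \bar R) (om : K -> nat).

Lemma expect_cons x l F om :
  expect par (x :: l) F om = gsum (par x) (fun k => expect par l F (upd om x k)).
Proof. by []. Qed.

Lemma expect_cat l l' F : expect par (l ++ l') F = expect par l (expect par l' F).
Proof. exact: foldr_cat. Qed.

Lemma expect_ge0 l F : (forall om, 0 <= F om) -> forall om, 0 <= expect par l F om.
Proof. by move=> F0; elim: l => [|x l IH] om; [exact: F0|rewrite !expect_cons; exact: gsum_ge0]. Qed.

Lemma le_expect l F G : (forall om, F om <= G om) ->
  forall om, expect par l F om <= expect par l G om.
Proof. by move=> FG; elim: l => [|x l IH] om; [exact: FG|rewrite !expect_cons; exact: le_gsum]. Qed.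

Lemma eq_expect l F G : (forall om, F om = G om) ->
  forall om, expect par l F om = expect par l G om.
Proof. by move=> FG om; congr expect; apply/funext. Qed.

Lemma expect_le1 l F : (forall om, F om <= 1) -> forall om, expect par l F om <= 1.
Proof. by move=> F1; elim: l => [|x l IH] om; [exact: F1|rewrite !expect_cons; exact: gsum_le1]. Qed.

Lemma expectD l F G : (forall om, 0 <= F om) -> (forall om, 0 <= G om) ->
  forall om, expect par l (fun om => F om + G om) om = expect par l F om + expect par l G om.
Proof.
move=> F0 G0; elim: l => [//|x l IH] om; rewrite !expect_cons.
rewrite -gsumD //; try by move=> k; apply: expect_ge0.
by apply: eq_gsum => k; rewrite IH.
Qed.

Lemma expectZl l (c : R) F : (0 <= c)%R -> (forall om, 0 <= F om) ->
  forall om, expect par l (fun om => c%:E * F om) om = c%:E * expect par l F om.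
Proof.
move=> c0 F0; elim: l => [//|x l IH] om; rewrite !expect_cons.
rewrite -gsumZl //; last by move=> k; apply: expect_ge0.
by apply: eq_gsum => k; rewrite IH.
Qed.

Lemma expect_free x l F : const_in x F -> const_in x (expect par l F).
Proof.
move=> hF; elim: l => [|y l IH] om k; first exact: hF.
rewrite !expect_cons; apply: eq_gsum => k'.
have [->|yx] := eqVneq x y; first by rewrite upd_same.
by rewrite updC // IH.
Qed.

Lemma expect_incr x l F : incr_in x F -> incr_in x (expect par l F).
Proof.
move=> hF; elim: l => [|y l IH] om k k' kk; first exact: hF.
rewrite !expect_cons; apply: le_gsum => // j.
have [->|yx] := eqVneq x y; first by rewrite !upd_same.
by rewrite !(updC _ _ _ yx); exact: IH.
Qed.

Lemma expect_filter (a : pred K) l F : (forall om, 0 <= F om) ->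
  {in l, forall x, ~~ a x -> const_in x F} ->
  expect par l F = expect par [seq x <- l | a x] F.
Proof.
move=> F0; elim: l => // x l IH hF /=.
have {}IH := IH (fun y yl => hF y (mem_behead (s := x :: l) yl)).
case: ifP => ax; first by apply/funext => om; rewrite !expect_cons IH.
rewrite -IH; apply/funext => om; rewrite expect_cons.
have fx : const_in x (expect par l F) by apply/expect_free/hF; rewrite ?mem_head ?ax.
transitivity (gsum (par x) (fun=> expect par l F om)); first exact: eq_gsum.
by apply: gsum_cst => //; exact: expect_ge0.
Qed.

Lemma expect_swap x y l F : (forall om, 0 <= F om) ->
  expect par [:: x, y & l] F = expect par [:: y, x & l] F.
Proof.
move=> F0; have [->//|xy] := eqVneq x y.
apply/funext => om; rewrite !expect_cons gsum_swap //; last by move=> a b; apply: expect_ge0.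
by apply: eq_gsum => b; rewrite expect_cons; apply: eq_gsum => a; rewrite updC.
Qed.

Lemma expect_rem x l F : (forall om, 0 <= F om) -> x \in l ->
  expect par l F = expect par (x :: rem x l) F.
Proof.
move=> F0; elim: l => // y l IH; rewrite inE /= eq_sym.
case: (eqVneq y x) => [-> //|yx /= xl].
rewrite expect_swap //.
by apply/funext => om; rewrite !expect_cons IH.
Qed.

Lemma expect_perm l l' F : (forall om, 0 <= F om) -> perm_eq l l' ->
  expect par l F = expect par l' F.
Proof.
move=> F0; elim: l l' => [|x l IH] l' pl.
  by case: l' pl => // x l' /perm_size.
have xl' : x \in l' by rewrite -(perm_mem pl) mem_head.
rewrite (expect_rem F0 xl'); apply/funext => om; rewrite !expect_cons (IH (rem x l')) //.
by rewrite -(perm_cons x) (perm_trans pl) // perm_to_rem.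
Qed.

Lemma expect_frozen (c : nat -> R) x l F : x \notin l -> (forall k, (0 <= c k)%R) ->
  (forall om, 0 <= F om) ->
  forall om, expect par l (fun om => (c (om x))%:E * F om) om = (c (om x))%:E * expect par l F om.
Proof.
move=> + c0 F0; elim: l => // y l IH; rewrite inE negb_or => /andP[xy xl] om.
rewrite !expect_cons -gsumZl //; last by move=> k; apply: expect_ge0.
by apply: eq_gsum => k; rewrite (IH xl) upd_neq.
Qed.

(** At each coordinate the factor that ignores it is pulled out as a constant; the bounds by 1 make
    this constant a real number. *)
Lemma expectM l F G : (forall om, 0 <= F om <= 1) -> (forall om, 0 <= G om <= 1) ->
  {in l, forall x, const_in x F \/ const_in x G} ->
  forall om, expect par l (fun om => F om * G om) om = expect par l F om * expect par l G om.
Proof.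
move=> F01 G01.
have F0 om : 0 <= F om by case/andP: (F01 om).
have G0 om : 0 <= G om by case/andP: (G01 om).
have fin H l0 om : (forall om, 0 <= H om <= 1) -> 0 <= expect par l0 H om ->
    exists2 r : R, (0 <= r)%R & expect par l0 H om = r%:E.
  move=> H01 H0; exists (fine (expect par l0 H om)); first exact: fine_ge0.
  rewrite fineK // ge0_fin_numE // (le_lt_trans _ (ltry 1)) //.
  by apply: expect_le1 => om'; case/andP: (H01 om').
elim: l => [//|x l IH] hl om; rewrite !expect_cons.
have {}IH := IH (fun y yl => hl y (mem_behead (s := x :: l) yl)).
transitivity (gsum (par x) (fun k => expect par l F (upd om x k) * expect par l G (upd om x k))).
  by apply: eq_gsum => k; rewrite -IH.
have [fF|fG] := hl x (mem_head _ _).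
- have [r r0 er] := fin F l om F01 (expect_ge0 l F0 om).
  transitivity (gsum (par x) (fun k => r%:E * expect par l G (upd om x k))).
    by apply: eq_gsum => k; rewrite (expect_free l fF) er.
  rewrite gsumZl // => [|k]; last exact: expect_ge0.
  congr (_ * _); rewrite -er -[LHS](gsum_cst (hpar x)) ?expect_ge0 //.
  by apply: eq_gsum => k; rewrite (expect_free l fF).
- have [r r0 er] := fin G l om G01 (expect_ge0 l G0 om).
  transitivity (gsum (par x) (fun k => r%:E * expect par l F (upd om x k))).
    by apply: eq_gsum => k; rewrite (expect_free l fG) er muleC.
  rewrite gsumZl // => [|k]; last exact: expect_ge0.
  rewrite muleC; congr (_ * _); rewrite -er -[LHS](gsum_cst (hpar x)) ?expect_ge0 //.
  by apply: eq_gsum => k; rewrite (expect_free l fG).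
Qed.

(** A permutation brings the three coordinates to the front, where [gsum_burke] applies, since
    [flip] commutes with resampling any other coordinate. *)
Lemma expect_flip x y z l F : uniq l -> x \in l -> y \in l -> z \in l ->
  x != y -> x != z -> y != z -> (par x * par y = par z)%R -> (forall om, 0 <= F om) ->
  expect par l (F \o flip x y z) = expect par l F.
Proof.
move=> ul xl yl zl xy xz yz hxyz F0.
pose l' := [seq u <- l | u \notin [:: x; y; z]].
have ml' u : u \in [:: x; y; z] -> u \notin l' by move=> h; rewrite mem_filter h.
have pl : perm_eq l [:: x, y, z & l'].
  apply: uniq_perm => //.
    rewrite /= !inE !negb_or xy xz yz /= filter_uniq // andbT.
    by rewrite !ml' ?inE ?eqxx ?orbT.
  move=> u; rewrite !inE mem_filter !inE.
  case: (eqVneq u x) => [->|] //=; case: (eqVneq u y) => [->|] //=.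
  by case: (eqVneq u z) => [->|].
have comm l0 : (forall u, u \in [:: x; y; z] -> u \notin l0) ->
    forall om, expect par l0 (F \o flip x y z) om = expect par l0 F (flip x y z om).
  elim: l0 => // v l0 IH h om; rewrite !expect_cons; apply: eq_gsum => k.
  rewrite IH => [|u /h]; last by rewrite inE negb_or => /andP[].
  congr (expect _ _ _ _); apply/funext => u; rewrite /flip /upd.
  have := h x; have := h y; have := h z; rewrite !inE !eqxx !orbT /= !negb_or.
  move=> /(_ isT)/andP[/negbTE zv _] /(_ isT)/andP[/negbTE yv _] /(_ isT)/andP[/negbTE xv _].
  rewrite xv yv zv; case: (eqVneq u v) => [->|] //.
  by rewrite ![v == _]eq_sym xv yv zv.
have Ff0 om : 0 <= (F \o flip x y z) om by rewrite /=.
rewrite (expect_perm Ff0 pl) (expect_perm F0 pl); apply/funext => om.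
have E H : expect par [:: x, y, z & l'] H om = gsum (par x) (fun a => gsum (par y) (fun b =>
  gsum (par z) (fun c => expect par l' H (upd (upd (upd om x a) y b) z c)))) by [].
rewrite !E -hxyz.
rewrite -(@gsum_burke _ _ _ (fun a b c => expect par l' F (upd (upd (upd om x a) y b) z c))) //.
  apply: eq_gsum => a; apply: eq_gsum => b; apply: eq_gsum => c.
  rewrite comm //.
  congr (expect _ _ _ _); apply/funext => u; rewrite /flip /upd !eqxx.
  rewrite (negbTE xy) (negbTE xz) (negbTE yz).
  case: (eqVneq u x) => [->|ux]; first by rewrite (negbTE xy) (negbTE xz).
  case: (eqVneq u y) => [->|uy]; first by rewrite (negbTE yz).
  by case: (eqVneq u z).
by move=> a b c; apply: expect_ge0.
Qed.

End Expect.

Section ExpectParameters.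
Context {R : realType} {K : eqType}.
Implicit Types (par : K -> R) (l : seq K) (F G : (K -> nat) -> \bar R) (om : K -> nat).

Lemma expect_indep par l F : (forall x, (0 <= par x < 1)%R) -> (forall om, 0 <= F om) ->
  {in l, forall x, const_in x F} -> expect par l F = F.
Proof.
move=> hpar F0 hF; rewrite (@expect_filter _ _ _ hpar pred0) //; last by move=> x /hF.
by rewrite filter_pred0.
Qed.

Lemma eq_par_expect par par' l F : {in l, par =1 par'} ->
  expect par l F = expect par' l F.
Proof.
elim: l => // x l IH h; apply/funext => om; rewrite !expect_cons h ?mem_head //.
by rewrite IH // => y yl; apply: h; rewrite inE yl orbT.
Qed.

(** Exponential change of measure: a factor t^k turns the ratio r into r t, at the cost of the
    normalisation (1 - r) / (1 - r t). *)
Lemma expect_tilt (a : pred K) (t : R) par l F :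
  (forall x, (0 <= par x < 1)%R) -> (0 <= t)%R ->
  (forall x, a x -> (par x * t < 1)%R) -> uniq l -> (forall om, 0 <= F om) ->
  forall om, expect par l (fun om => (t ^+ (\sum_(x <- l | a x) om x))%:E * F om) om =
    (\prod_(x <- l | a x) ((1 - par x) / (1 - par x * t)))%:E *
    expect (fun x => if a x then (par x * t)%R else par x) l F om.
Proof.
move=> hpar t0 hat + F0; pose par' x := if a x then (par x * t)%R else par x; rewrite -/par'.
have hpar' x : (0 <= par' x < 1)%R.
  rewrite /par'; case: ifP => ax //; rewrite hat // andbT mulr_ge0 //.
  by case/andP: (hpar x).
have prod0 l0 : (0 <= \prod_(x <- l0 | a x) ((1 - par x) / (1 - par x * t)))%R.
  apply: prodr_ge0 => x ax; rewrite divr_ge0 // subr_ge0 ltW ?hat //.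
  by case/andP: (hpar x).
elim: l => [|x l IH] /=.
  by move=> _ om; rewrite /expect /= !big_nil expr0.
move=> /andP[xl ul] om; rewrite !expect_cons !big_cons.
case: ifP => ax.
- transitivity (gsum (par x) (fun k => (t ^+ k)%:E *
    ((\prod_(y <- l | a y) ((1 - par y) / (1 - par y * t)))%:E * expect par' l F (upd om x k)))).
    apply: eq_gsum => k; rewrite -(IH ul).
    have := @expect_frozen _ _ par hpar (fun n => t ^+ n)%R x l
      (fun om => (t ^+ (\sum_(x <- l | a x) om x))%:E * F om) xl _ _ (upd om x k).
    rewrite upd_at => <- //.
    + by apply: eq_expect => om'; rewrite big_cons ax exprD EFinM muleA.
    + by move=> k'; rewrite exprn_ge0.
    + by move=> om'; rewrite mule_ge0 // lee_fin exprn_ge0.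
  rewrite gsum_tilt ?hat // => [|k]; last first.
    by rewrite mule_ge0 ?lee_fin // expect_ge0.
  rewrite gsumZl //; first by rewrite muleA EFinM /par' ax.
  + by have := hpar' x; rewrite /par' ax.
  + by move=> k; rewrite expect_ge0.
- rewrite -gsumZl //; last by move=> k; rewrite expect_ge0.
  rewrite /par' ax; apply: eq_gsum => k; rewrite -(IH ul).
  by apply: eq_expect => om'; rewrite big_cons ax.
Qed.

Lemma expect_mgf (a : pred K) (t : R) par l om :
  (forall x, (0 <= par x < 1)%R) -> (0 <= t)%R ->
  (forall x, a x -> (par x * t < 1)%R) -> uniq l ->
  expect par l (fun om => (t ^+ (\sum_(x <- l | a x) om x))%:E) om =
    (\prod_(x <- l | a x) ((1 - par x) / (1 - par x * t)))%:E.
Proof.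
move=> hpar t0 hat ul.
transitivity (expect par l (fun om => (t ^+ (\sum_(x <- l | a x) om x))%:E * 1) om).
  by apply: eq_expect => om'; rewrite mule1.
rewrite expect_tilt // expect_indep ?mule1 // => x; case: ifP => // ax.
by rewrite hat // andbT mulr_ge0 //; case/andP: (hpar x).
Qed.

(** The ratios are changed one coordinate at a time, each change being an instance of
    [gsum_mono]. *)
Lemma expect_mono par par' l F : (forall x, (0 <= par x < 1)%R) ->
  (forall x, (0 <= par' x < 1)%R) -> (forall om, 0 <= F om <= 1) ->
  {in l, forall x, const_in x F \/ ((par x <= par' x)%R /\ incr_in x F) \/ par x = par' x} ->
  forall om, expect par l F om <= expect par' l F om.
Proof.
move=> hpar hpar' F01.
have F0 om : 0 <= F om by case/andP: (F01 om).
have F1 om : F om <= 1 by case/andP: (F01 om).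
elim: l => // x l IH hl om; rewrite !expect_cons.
have {}IH := IH (fun y yl => hl y (mem_behead (s := x :: l) yl)).
apply: (@le_trans _ _ (gsum (par x) (fun k => expect par' l F (upd om x k)))).
  by apply: le_gsum.
have E0 k : 0 <= expect par' l F (upd om x k) by apply: expect_ge0.
have E1 k : expect par' l F (upd om x k) <= 1 by apply: expect_le1.
have Efin k : expect par' l F (upd om x k) = (fine (expect par' l F (upd om x k)))%:E.
  by rewrite fineK // ge0_fin_numE // (le_lt_trans (E1 k)) // ltry.
case: (hl x (mem_head _ _)) => [fF|[[lep incF]|->//]].
  have e k : expect par' l F (upd om x k) = expect par' l F om by rewrite (expect_free par' l fF).
  by rewrite (eq_gsum _ e) (eq_gsum (par' x) e) !gsum_cst // expect_ge0.
rewrite (eq_gsum _ Efin) (eq_gsum (par' x) Efin); apply: gsum_mono => //.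
- by case/andP: (hpar x).
- by case/andP: (hpar' x).
- by move=> k; rewrite -!lee_fin -Efin E0 E1.
- by move=> k; rewrite -lee_fin -!Efin; apply: (expect_incr hpar').
Qed.

End ExpectParameters.

(** The set [s] is there because the renamings used later, such as [unshift], truncate and are
    injective only on the coordinates that matter. *)
Lemma expect_rename {R : realType} (K K' : eqType) (h : K -> K') (par : K' -> R)
    (s : {pred K}) (l : seq K) (F : (K -> nat) -> \bar R) : {subset l <= s} ->
  {in s &, injective h} -> (forall a b, {in s, a =1 b} -> F a = F b) ->
  forall om, expect par (map h l) (fun om => F (om \o h)) om =
    expect (par \o h) l F (om \o h).
Proof.
move=> + inj_h; elim: l => // x l IH ls locF om; rewrite map_cons !expect_cons.
have xs : x \in s by apply: ls; rewrite mem_head.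
have ls' : {subset l <= s} by move=> y yl; apply: ls; rewrite inE yl orbT.
apply: eq_gsum => k; rewrite IH //.
have loc : forall l0 a b, {in s, a =1 b} -> expect (par \o h) l0 F a = expect (par \o h) l0 F b.
  elim=> [|y l0 IHl] a b ab; first exact: locF.
  rewrite !expect_cons; apply: eq_gsum => j; apply: IHl => u us.
  by rewrite /upd; case: ifP => // _; apply: ab.
apply: loc => y ys; rewrite /upd /=.
by rewrite (inj_in_eq inj_h).
Qed.

Lemma expect_local {R : realType} (K : eqType) (par : K -> R) (s : {pred K}) (l : seq K)
    (F : (K -> nat) -> \bar R) (a b : K -> nat) :
  (forall a b, {in s, a =1 b} -> F a = F b) ->
  {in s, forall u, u \notin l -> a u = b u} -> expect par l F a = expect par l F b.
Proof.
move=> locF; elim: l a b => [|x l IH] a b ab.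
  by apply: locF => u us; apply: ab.
rewrite !expect_cons; apply: eq_gsum => k; apply: IH => u us ul.
by rewrite /upd; case: eqP => // /eqP ux; apply: ab; rewrite // inE negb_or ux.
Qed.

Lemma expect_par_const {R : realType} (K : eqType) (par par' : K -> R) l
    (F : (K -> nat) -> \bar R) :
  (forall x, (0 <= par x < 1)%R) -> (forall x, (0 <= par' x < 1)%R) ->
  (forall om, 0 <= F om) ->
  {in l, forall x, par x = par' x \/ const_in x F} -> expect par l F = expect par' l F.
Proof.
move=> hpar hpar' F0; elim: l => // x l IH hl; apply/funext => om; rewrite !expect_cons.
rewrite -(IH (fun y yl => hl y (mem_behead (s := x :: l) yl))).
case: (hl x (mem_head _ _)) => [->//|fF].
have e k : expect par l F (upd om x k) = expect par l F om by rewrite (expect_free par l fF).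
by rewrite (eq_gsum _ e) (eq_gsum (par' x) e) !gsum_cst // expect_ge0.
Qed.

Lemma lpp_local om om' j i :
  (forall a b, (a <= i)%N -> (b <= j)%N -> om (a, b) = om' (a, b)) ->
  lpp om j i = lpp om' j i.
Proof.
elim: j i => [|j IHj] i h.
  elim: i h => // i IHi h; rewrite !lpp0S h // IHi // => a b ha hb.
  by apply: h => //; exact: leqW.
elim: i h => [|i IHi] h.
  rewrite !lppS0 h // IHj // => a b ha hb; by apply: h => //; exact: leqW.
rewrite !lppSS h // IHi ?IHj // => a b ha hb; apply: h => //; exact: leqW.
Qed.

(** * Rectangles and their axes *)

Definition box (m h : nat) : seq pt := [seq (i, j) | i <- iota 0 m.+1, j <- iota 0 h.+1].

Lemma mem_box m h (u : pt) : (u \in box m h) = (u.1 <= m)%N && (u.2 <= h)%N.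
Proof.
case: u => a b; apply/allpairsP/andP => [[[i j] [hi hj [-> ->]]]|[ha hb]].
  by move: hi hj; rewrite !mem_iota /=; lia.
by exists (a, b); rewrite !mem_iota; split => //; move: ha hb => /=; lia.
Qed.

Lemma uniq_box m h : uniq (box m h).
Proof. by apply: allpairs_uniq; rewrite ?iota_uniq // => -[a b] [c d] _ _ [-> ->]. Qed.

(* The boundary of the model is stationary when [x * y = q]. *)
Definition bpar {R : realType} (x y q : R) (u : pt) : R :=
  if u.2 == 0%N then (if u.1 == 0%N then 0%R else x) else if u.1 == 0%N then y else q.

Lemma perm_axisx m h : perm_eq [seq u <- box m h | (u.2 == 0%N) && (0 < u.1)%N]
  [seq (i.+1, 0%N) | i <- iota 0 m].
Proof.
apply: uniq_perm; first exact/filter_uniq/uniq_box.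
  by rewrite map_inj_uniq ?iota_uniq // => a b [].
move=> [a b]; rewrite mem_filter mem_box /=; apply/idP/mapP => [h0|[i]].
  exists a.-1; first by rewrite mem_iota; lia.
  by congr pair; lia.
by rewrite mem_iota => hi [-> ->]; lia.
Qed.

Lemma perm_axisy m h : perm_eq [seq u <- box m h | (u.1 == 0%N) && (0 < u.2)%N]
  [seq (0%N, j.+1) | j <- iota 0 h].
Proof.
apply: uniq_perm; first exact/filter_uniq/uniq_box.
  by rewrite map_inj_uniq ?iota_uniq // => a b [].
move=> [a b]; rewrite mem_filter mem_box /=; apply/idP/mapP => [h0|[i]].
  exists b.-1; first by rewrite mem_iota; lia.
  by congr pair; lia.
by rewrite mem_iota => hi [-> ->]; lia.
Qed.

Lemma sum_axisx m h (om : pt -> nat) :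
  (\sum_(u <- box m h | (u.2 == 0) && (0 < u.1)) om u = \sum_(i < m) om (i.+1, 0))%N.
Proof.
rewrite -big_filter (perm_big _ (perm_axisx m h)) big_map.
by rewrite -[in iota _ _](subn0 m) -/(index_iota 0 m) big_mkord.
Qed.

Lemma sum_axisy m h (om : pt -> nat) :
  (\sum_(u <- box m h | (u.1 == 0) && (0 < u.2)) om u = \sum_(j < h) om (0, j.+1))%N.
Proof.
rewrite -big_filter (perm_big _ (perm_axisy m h)) big_map.
by rewrite -[in iota _ _](subn0 h) -/(index_iota 0 h) big_mkord.
Qed.

(** * The stationary model *)

Section Stationary.
Context {R : realType}.
Implicit Types (x y q t tau : R) (om : pt -> nat) (F : (pt -> nat) -> \bar R).

Lemma prod_axisx m h (c : pt -> R) (d : R) : (forall u, u.2 = 0%N -> (0 < u.1)%N -> c u = d) ->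
  (\prod_(u <- box m h | (u.2 == 0%N) && (0 < u.1)%N) c u = d ^+ m)%R.
Proof.
move=> hc; rewrite -big_filter (perm_big _ (perm_axisx m h)) big_map.
rewrite (eq_bigr (fun=> d)) => [|i _]; last by rewrite hc.
by rewrite big_const_seq count_predT size_iota; elim: m => // m IH; rewrite iterS IH exprS.
Qed.

Lemma prod_axisy m h (c : pt -> R) (d : R) : (forall u, u.1 = 0%N -> (0 < u.2)%N -> c u = d) ->
  (\prod_(u <- box m h | (u.1 == 0%N) && (0 < u.2)%N) c u = d ^+ h)%R.
Proof.
move=> hc; rewrite -big_filter (perm_big _ (perm_axisy m h)) big_map.
rewrite (eq_bigr (fun=> d)) => [|i _]; last by rewrite hc.
by rewrite big_const_seq count_predT size_iota; elim: h => // h IH; rewrite iterS IH exprS.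
Qed.

Lemma bpar_ratio x y q : (0 <= x < 1)%R -> (0 <= y < 1)%R -> (0 <= q < 1)%R ->
  forall u, (0 <= bpar x y q u < 1)%R.
Proof. by move=> hx hy hq u; rewrite /bpar; do 2!case: ifP => // _; rewrite lexx ltr01. Qed.

(** [burke] is a composition of [flip]s, each preserving the law because the two axis ratios
    multiply to the bulk ratio. *)
Lemma expect_burke x y m h F : (0 <= x < 1)%R -> (0 <= y < 1)%R -> (forall om, 0 <= F om) ->
  forall om, expect (bpar x y (x * y)) (box m h) (fun om => F (burke om m h)) om =
    expect (bpar x y (x * y)) (box m h) F om.
Proof.
move=> hx hy F0.
have hq : (0 <= x * y < 1)%R.
  by case/andP: hx hy => x0 x1 /andP[y0 y1]; rewrite mulr_ge0 //= mulr_ilt1.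
have hp := bpar_ratio hx hy hq.
suff P j : (j <= h)%N -> forall F', (forall om, 0 <= F' om) ->
    expect (bpar x y (x * y)) (box m h) (fun om => F' (burke_state om m j 0)) =
    expect (bpar x y (x * y)) (box m h) F'.
  by move=> om; rewrite /burke P.
elim: j => [_|j IHj jh] F' F'0.
  by congr expect; apply/funext => om; rewrite burke_state0.
suff Q i : (i <= m)%N -> forall G, (forall om, 0 <= G om) ->
    expect (bpar x y (x * y)) (box m h) (fun om => G (burke_state om m j i)) =
    expect (bpar x y (x * y)) (box m h) G.
  rewrite -[RHS](Q m) //; congr expect; apply/funext => om.
  by rewrite burke_state_next.
elim: i => [_|i IHi im] G G0; first by apply: IHj => //; exact: ltnW.
rewrite -[RHS](@expect_flip _ _ _ hp (i.+1, 0%N) (0%N, j.+1) (i.+1, j.+1)) ?uniq_box ?mem_box //=.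
- rewrite -[RHS](IHi (ltnW im)) //.
  by congr expect; apply/funext => om; rewrite /= burke_state_flip.
- by move=> om; exact: G0.
- by rewrite im.
- by rewrite im.
- by rewrite xpair_eqE andbF.
Qed.

(** With bulk ratio x t y the model becomes stationary once the x-axis is tilted from x to x t. In
    the decomposition [lpp_bottom_right], the power of t on the bottom side performs this tilt, and
    the vertical increments on the right side are then i.i.d. of ratio y. *)
Lemma expect_lpp_mgf x y t m h : (0 <= x < 1)%R -> (0 <= y < 1)%R -> (0 < t)%R ->
  (x * t < 1)%R -> (y * t < 1)%R -> (x * t * y < 1)%R ->
  forall om, expect (bpar x y (x * t * y)) (box m h) (fun om => (t ^+ lpp om h m)%:E) om =
    (((1 - x) / (1 - x * t)) ^+ m * ((1 - y) / (1 - y * t)) ^+ h)%:E.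
Proof.
move=> hx hy t0 xt yt xyt om.
have /andP[x0 x1] := hx; have /andP[y0 y1] := hy.
have hxt : (0 <= x * t < 1)%R by rewrite xt mulr_ge0 // ltW.
have hq : (0 <= x * t * y < 1)%R by rewrite xyt !mulr_ge0 // ltW.
pose ax (u : pt) := (u.2 == 0%N) && (0 < u.1)%N.
pose ay (u : pt) := (u.1 == 0%N) && (0 < u.2)%N.
pose F om := (t ^+ (\sum_(u <- box m h | ay u) om u))%:E.
have F0 om' : 0 <= F om' by rewrite lee_fin exprn_ge0 // ltW.
transitivity (expect (bpar x y (x * t * y)) (box m h)
    (fun om => (t ^+ (\sum_(u <- box m h | ax u) om u))%:E * F (burke om m h)) om).
  apply: eq_expect => om'; rewrite -EFinM -exprD /F sum_axisx sum_axisy lpp_bottom_right.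
  by congr ((t ^+ (_ + _))%:E); apply: eq_bigr => j _; rewrite burke_right.
have hp := bpar_ratio hx hy hq; have hp' := bpar_ratio hxt hy hq.
rewrite expect_tilt ?uniq_box //; first last.
- by move=> [a b] /andP[/= /eqP -> a0]; rewrite /bpar /= gtn_eqF.
- exact: ltW.
rewrite (@prod_axisx _ _ _ ((1 - x) / (1 - x * t)))%R; last first.
  by move=> [a b] /= -> a0; rewrite /bpar /= gtn_eqF.
rewrite EFinM; congr (_ * _).
rewrite (@eq_par_expect _ _ _ (bpar (x * t) y (x * t * y))); last first.
  move=> [a b] _; rewrite /ax /bpar /=; case: (b == 0%N) => //=.
  by case: a => [|a] //=.
rewrite expect_burke // expect_mgf ?uniq_box //; first last.
- by move=> [a b] /andP[/= /eqP -> b0]; rewrite /bpar /= gtn_eqF.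
- exact: ltW.
by rewrite (@prod_axisy _ _ _ ((1 - y) / (1 - y * t))%R) // => -[a b] /= -> b0; rewrite /bpar /= gtn_eqF.
Qed.

Definition ind (b : bool) : \bar R := (b%:R)%:E.

Lemma ind01 b : 0 <= ind b <= 1.
Proof. by case: b; rewrite /ind lexx lee_fin ler01. Qed.

(* AM-GM: on the event the two powers multiply to one. *)
Lemma ind_chernoff tau lam (a g : nat) (b : bool) : (0 < tau)%R -> (0 < lam)%R ->
  (b -> a = g) ->
  ind b <= (lam / 2)%:E * (tau ^+ a)%:E + (lam^-1 / 2)%:E * (tau^-1 ^+ g)%:E.
Proof.
move=> t0 l0 bag; rewrite -!EFinM -EFinD lee_fin.
have ta : (0 < tau ^+ a)%R by rewrite exprn_gt0.
case: b bag => [/(_ isT) <-|_]; last first.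
  by rewrite addr_ge0 // mulr_ge0 ?exprn_ge0 ?divr_ge0 // ?invr_ge0 ltW.
rewrite exprVn; set z := (lam * tau ^+ a)%R.
have z0 : (0 < z)%R by rewrite mulr_gt0.
have -> : (lam / 2 * tau ^+ a + lam^-1 / 2 * (tau ^+ a)^-1 = (z + z^-1) / 2)%R.
  by rewrite /z invfM; field; rewrite ?gt_eqF.
have h2 : (2 <= z + z^-1)%R.
  rewrite -subr_ge0.
  have -> : (z + z^-1 - 2 = (z - 1) ^+ 2 / z)%R by field; rewrite gt_eqF.
  by rewrite divr_ge0 ?sqr_ge0 // ltW.
by rewrite ler_pdivlMr // mul1r.
Qed.

End Stationary.

(** * Exponential bounds for exits through the wrong axis *)

Section Exit.
Context {R : realType}.
Implicit Types (x y q t tau : R) (om : pt -> nat) (F : (pt -> nat) -> \bar R).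

Lemma zerox_upd om a k : zerox (upd om (a, 0%N) k) = zerox om.
Proof.
apply/funext => -[c d]; rewrite /zerox /upd /=; case: eqP => // d0.
by rewrite xpair_eqE; case: (d == 0%N) / eqP => //; rewrite andbF.
Qed.

Lemma zeroy_upd om b k : zeroy (upd om (0%N, b) k) = zeroy om.
Proof.
apply/funext => -[c d]; rewrite /zeroy /upd /=; case: eqP => // d0.
by rewrite xpair_eqE; case: (c == 0%N) / eqP.
Qed.

(* The stationarity relation is violated by a factor [tau], so both exponential
   moments are explicit. *)
Lemma exit_chernoff (A B : R) (P : R) (par : pt -> R) l (V G : (pt -> nat) -> nat)
    (b : (pt -> nat) -> bool) tau om :
  (forall u, (0 <= par u < 1)%R) -> (0 < tau)%R -> (0 < A)%R -> (0 < B)%R ->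
  (forall om, b om -> V om = G om) ->
  expect par l (fun om => (tau^-1 ^+ G om)%:E) om = A%:E ->
  expect par l (fun om => (tau ^+ V om)%:E) om <= B%:E ->
  expect par l (fun om => ind (b om)) om <= (Num.sqrt (A * B))%:E.
Proof.
move=> hp t0 A0 B0 hb eA eB.
have sA : (0 < Num.sqrt A)%R by rewrite sqrtr_gt0.
have sB : (0 < Num.sqrt B)%R by rewrite sqrtr_gt0.
(* This value balances the two terms and turns their sum into the Cauchy-Schwarz bound. *)
pose lam := (Num.sqrt A / Num.sqrt B)%R.
have l0 : (0 < lam)%R by rewrite divr_gt0.
apply: (@le_trans _ _ (expect par l (fun om =>
   (lam / 2)%:E * (tau ^+ V om)%:E + (lam^-1 / 2)%:E * (tau^-1 ^+ G om)%:E) om)).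
  by apply: le_expect => // om'; apply: ind_chernoff => //; exact: hb.
have c0 : (0 <= lam / 2)%R by rewrite divr_ge0 // ltW.
have d0 : (0 <= lam^-1 / 2)%R by rewrite divr_ge0 // invr_ge0 ltW.
have V0 om' : 0 <= (tau ^+ V om')%:E by rewrite lee_fin exprn_ge0 // ltW.
have G0 om' : 0 <= (tau^-1 ^+ G om')%:E by rewrite lee_fin exprn_ge0 // invr_ge0 ltW.
rewrite expectD //; try by move=> om'; rewrite mule_ge0 // lee_fin.
rewrite !expectZl // eA.
apply: (@le_trans _ _ ((lam / 2)%:E * B%:E + (lam^-1 / 2)%:E * A%:E)).
  by rewrite leeD2r // lee_wpmul2l // lee_fin.
rewrite -!EFinM -EFinD lee_fin sqrtrM ?(ltW A0) // /lam.
have eA2 : A = (Num.sqrt A ^+ 2)%R by rewrite sqr_sqrtr ?(ltW A0).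
have eB2 : B = (Num.sqrt B ^+ 2)%R by rewrite sqr_sqrtr ?(ltW B0).
rewrite le_eqVlt; apply/orP; left; apply/eqP.
rewrite {2}eB2 {3}eA2; field; by rewrite ?gt_eqF.
Qed.

(** The exponent of an exit will be half of [tgap] times a difference of [gpsi] and [gphi] terms. At
    [tau = 1] both of these are r / (1 - r)^2, the variance of a geometric variable of ratio r. *)
Definition tgap tau : R := ((tau - 1) ^+ 2 / tau)%R.
Definition gphi tau x : R := ((x / tau) / (1 - x / tau) ^+ 2)%R.
Definition gpsi tau y : R := (y * tau / ((1 - y * tau ^+ 2) * (1 - y)))%R.

(** The left-hand side is exactly [1 - tgap tau * gphi tau x]. *)
Lemma exit_factor_phi tau x : (1 < tau)%R -> (0 < x < 1)%R ->
  ((1 - x) / (1 - x / tau) * ((1 - x / tau ^+ 2) / (1 - x / tau)) <=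
    expR (- (tgap tau * gphi tau x)))%R.
Proof.
move=> t1 /andP[x0 x1]; have t0 : (0 < tau)%R by rewrite (lt_trans _ t1).
have xt : (x / tau < 1)%R by rewrite ltr_pdivrMr // mul1r (lt_trans x1).
apply: le_trans (expR_ge1Dx _).
rewrite le_eqVlt; apply/orP; left; apply/eqP; rewrite /tgap /gphi.
by field; rewrite gt_eqF //= subr_eq0 gt_eqF // (lt_trans x1).
Qed.

Lemma exit_factor_psi tau y : (1 < tau)%R -> (0 < y)%R -> (y * tau ^+ 2 < 1)%R ->
  ((1 - y * tau) / (1 - y) * ((1 - y * tau) / (1 - y * tau ^+ 2)) <=
    expR (tgap tau * gpsi tau y))%R.
Proof.
move=> t1 y0 yt; have t0 : (0 < tau)%R by rewrite (lt_trans _ t1).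
have y1 : (y < 1)%R by rewrite (le_lt_trans _ yt) // ler_pMr // exprn_ege1 // ltW.
apply: le_trans (expR_ge1Dx _).
rewrite le_eqVlt; apply/orP; left; apply/eqP; rewrite /tgap /gpsi.
by field; rewrite !subr_eq0 !gt_eqF.
Qed.

Lemma lpp_incr_env a b j i : (forall u, (a u <= b u)%N) -> (lpp a j i <= lpp b j i)%N.
Proof.
move=> ab; elim: j i => [|j IHj] i.
  by elim: i => // i IHi; rewrite !lpp0S leq_add.
elim: i => [|i IHi]; first by rewrite !lppS0 leq_add.
by rewrite !lppSS leq_add //; have := IHj i.+1; lia.
Qed.

(** Raising the y-axis ratio to y tau favours the event. In the new model a tilt of the x-axis by 1
    / tau restores stationarity, which gives the moment of the full passage time. The vertical
    passage time ignores the x-axis, whose ratio may be lowered to x / tau^2; from there the tilt by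
    tau is the stationary one. *)
Lemma exit_V x y m h : forall tau, (1 < tau)%R -> (0 < x < 1)%R -> (0 < y)%R ->
  (y * tau ^+ 2 < 1)%R ->
  forall om, expect (bpar x y (x * y)) (box m h)
    (fun om => ind (lpp (zeroy om) h m <= lpp (zerox om) h m)%N) om <=
  (expR (tgap tau / 2 * (h%:R * gpsi tau y - m%:R * gphi tau x)))%:E.
Proof.
move=> tau t1 /andP[x0 x1] ys0 yt2 om.
have t0 : (0 < tau)%R by rewrite (lt_trans _ t1).
have t1' := ltW t1; have x0' := ltW x0; have ys0' := ltW ys0.
pose y' := (y * tau)%R; pose x2 := (x / tau ^+ 2)%R.
have y'0 : (0 < y')%R by rewrite mulr_gt0.
have y't : (y' * tau < 1)%R by rewrite /y' -mulrA -expr2.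
have yy' : (y <= y')%R by rewrite ler_peMr.
have y'1 : (y' < 1)%R by rewrite (le_lt_trans _ y't) // ler_peMr // ltW.
have xy1 : (0 <= x * y < 1)%R by rewrite mulr_ge0 //= mulr_ilt1 // (le_lt_trans yy').
have x20 : (0 < x2)%R by rewrite divr_gt0 // exprn_gt0.
have xt1 : (x / tau < 1)%R by rewrite ltr_pdivrMr // mul1r (lt_trans x1).
have x2t : (x2 * tau = x / tau)%R by rewrite /x2; field; rewrite gt_eqF.
have x21 : (x2 < 1)%R.
  by rewrite (le_lt_trans _ xt1) // -x2t ler_peMr // ltW.
have hx : (0 <= x < 1)%R by rewrite x0'.
have hy : (0 <= y < 1)%R by rewrite ys0' (le_lt_trans yy').
have hy' : (0 <= y' < 1)%R by rewrite y'1 ltW.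
have hx2 : (0 <= x2 < 1)%R by rewrite x21 ltW.
have p1 := bpar_ratio hx hy xy1; have p2 := bpar_ratio hx hy' xy1.
have p3 := bpar_ratio hx2 hy' xy1.
pose V om := lpp (zerox om) h m; pose G om := lpp om h m; pose H om := lpp (zeroy om) h m.
have constV a k om' : V (upd om' (a, 0%N) k) = V om' by rewrite /V zerox_upd.
have constH b k om' : H (upd om' (0%N, b) k) = H om' by rewrite /H zeroy_upd.
apply: (@le_trans _ _ (expect (bpar x y' (x * y)) (box m h) (fun om => ind (H om <= V om)%N) om)).
  rewrite -[leLHS]/(expect (bpar x y (x * y)) (box m h) (fun om => ind (H om <= V om)%N) om).
  apply: expect_mono => // [om'|[a b] _]; first exact: ind01.
  rewrite /bpar /=; case: (b == 0%N); first by right; right.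
  case: (eqVneq a 0%N) => [->|_]; last by right; right.
  right; left; split => // om' k k' kk; rewrite /= !constH /ind lee_fin ler_nat.
  have : (V (upd om' (0%N, b) k) <= V (upd om' (0%N, b) k'))%N.
    apply: lpp_incr_env => u; rewrite /zerox /upd; case: ifP => // _; by case: ifP.
  move: (V _) (V _) (H _) => v2 v1 h0 hV.
  by case E: (h0 <= v1)%N => //; rewrite (leq_trans E hV).
pose A := ((((1 - x) / (1 - x / tau)) ^+ m) * ((1 - y') / (1 - y' / tau)) ^+ h)%R.
pose B := ((((1 - x2) / (1 - x2 * tau)) ^+ m) * ((1 - y') / (1 - y' * tau)) ^+ h)%R.
have y't1 : (y' / tau = y)%R by rewrite /y'; field; rewrite gt_eqF.
have pos a : (a < 1)%R -> (0 < 1 - a)%R by rewrite subr_gt0.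
have y1 : (y < 1)%R by case/andP: hy.
have A0 : (0 < A)%R by rewrite /A mulr_gt0 // exprn_gt0 // divr_gt0 ?pos // y't1.
have B0 : (0 < B)%R by rewrite /B mulr_gt0 // exprn_gt0 // divr_gt0 ?pos // x2t.
have eq1 : (x * y = x * tau^-1 * y')%R by rewrite /y'; field; rewrite gt_eqF.
have eq2 : (x * y = x2 * tau * y')%R by rewrite x2t eq1.
apply: (@le_trans _ _ (Num.sqrt (A * B))%:E).
  apply: (@exit_chernoff A B 0%R _ (box m h) V G (fun om => (H om <= V om)%N) tau) => //.
  - by move=> om' /maxn_idPl; rewrite /G lpp_max -/(V om') -/(H om') => ->.
  - rewrite eq1 /G expect_lpp_mgf // ?invr_gt0 // ?y't1 //.
    by rewrite -eq1; case/andP: xy1.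
  - apply: (@le_trans _ _ (expect (bpar x y' (x * y)) (box m h) (fun om => (tau ^+ V om)%:E) om)) => //.
    rewrite (@expect_par_const _ _ _ (bpar x2 y' (x * y))) //.
    + apply: (@le_trans _ _ (expect (bpar x2 y' (x * y)) (box m h) (fun om => (tau ^+ G om)%:E) om)).
        apply: le_expect => // om'; rewrite lee_fin ler_weXn2l //.
        by rewrite /G lpp_max leq_maxl.
      by rewrite eq2 /G expect_lpp_mgf // ?x2t // -eq1; case/andP: xy1.
    + by move=> om'; rewrite lee_fin exprn_ge0 // ltW.
    + move=> [a b] _; rewrite /bpar /=; case: (eqVneq b 0%N) => [->|_]; last by left.
      by right => om' k; rewrite constV.
rewrite lee_fin.
have -> : (A * B = ((1 - x) / (1 - x / tau) * ((1 - x / tau ^+ 2) / (1 - x / tau))) ^+ m *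
   ((1 - y * tau) / (1 - y) * ((1 - y * tau) / (1 - y * tau ^+ 2))) ^+ h)%R.
  have y'tt : (y' * tau = y * tau ^+ 2)%R by rewrite /y' -mulrA -expr2.
  by rewrite /A /B x2t y't1 y'tt -/x2 -/y' mulrACA -!exprMn.
apply: (@le_trans _ _ (Num.sqrt (expR (- (tgap tau * gphi tau x)) ^+ m *
    expR (tgap tau * gpsi tau y) ^+ h))%R).
  rewrite ler_sqrt; last by rewrite mulr_ge0 // exprn_ge0 // expR_ge0.
  have e0 : (0 <= (1 - x) / (1 - x / tau) * ((1 - x / tau ^+ 2) / (1 - x / tau)))%R.
    by rewrite mulr_ge0 // divr_ge0 // ltW ?pos.
  have e1 : (0 <= (1 - y * tau) / (1 - y) * ((1 - y * tau) / (1 - y * tau ^+ 2)))%R.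
    by rewrite mulr_ge0 // divr_ge0 // ltW ?pos.
  apply: ler_pM; rewrite ?exprn_ge0 // lerXn2r ?nnegrE ?expR_ge0 //.
  - by apply: exit_factor_phi => //; rewrite x0.
  - exact: exit_factor_psi.
have -> : (expR (- (tgap tau * gphi tau x)) ^+ m * expR (tgap tau * gpsi tau y) ^+ h =
  (expR (tgap tau / 2 * (h%:R * gpsi tau y - m%:R * gphi tau x))) ^+ 2)%R.
  by rewrite -!expRM_natl -expRD; congr expR; field.
by rewrite sqrtr_sqr ger0_norm // expR_ge0.
Qed.

End Exit.

(** * Reflection, restriction and i.i.d. rows *)

Definition transpose (u : pt) : pt := (u.2, u.1).

Lemma transposeK : involutive transpose. Proof. by case. Qed.

Lemma lpp_transpose om j i : lpp (om \o transpose) i j = lpp om j i.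
Proof.
elim: j i => [|j IHj] i.
  by elim: i => // i IHi; rewrite lppS0 lpp0S IHi.
elim: i => [|i IHi]; first by rewrite lppS0 lpp0S IHj.
by rewrite !lppSS /= IHi IHj maxnC.
Qed.

Section JointDomination.
Context {R : realType}.
Implicit Types (x y q t tau : R) (om : pt -> nat) (F : (pt -> nat) -> \bar R).

Lemma perm_box_transpose m h : perm_eq (box m h) (map transpose (box h m)).
Proof.
apply: uniq_perm; rewrite ?map_inj_uniq ?uniq_box //; first exact: can_inj transposeK.
by move=> u; rewrite -[u]transposeK mem_map ?mem_box 1?andbC //; exact: can_inj transposeK.
Qed.

Lemma expect_transpose (par : pt -> R) m h F :
  (forall u, (0 <= par u < 1)%R) -> (forall om, 0 <= F om) ->
  forall om, expect par (box m h) F om =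
    expect (par \o transpose) (box h m) (fun om => F (om \o transpose)) (om \o transpose).
Proof.
move=> hp F0 om; rewrite (expect_perm hp F0 (perm_box_transpose m h)).
rewrite -(@expect_rename _ _ _ transpose par predT) //; last 2 first.
- by move=> u v _ _; apply: can_inj transposeK _ _.
- by move=> a b ab; congr F; apply/funext => u; exact: ab.
by apply: eq_expect => om'; congr F; apply/funext => u; rewrite /= transposeK.
Qed.

Lemma exit_H x y m h tau : (1 < tau)%R -> (0 < x)%R -> (0 < y < 1)%R ->
  (x * tau ^+ 2 < 1)%R ->
  forall om, expect (bpar x y (x * y)) (box m h)
    (fun om => ind (lpp (zerox om) h m <= lpp (zeroy om) h m)%N) om <=
  (expR (tgap tau / 2 * (m%:R * gpsi tau x - h%:R * gphi tau y)))%:E.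
Proof.
move=> t1 x0 hy xt om; have /andP[y0 y1] := hy.
have x1 : (x < 1)%R by rewrite (le_lt_trans _ xt) // ler_peMr ?exprn_ege1 ?(ltW x0) // ltW.
have hp : forall u, (0 <= bpar x y (x * y) u < 1)%R.
  by apply: bpar_ratio; rewrite ?mulr_ge0 ?mulr_ilt1 ?x1 ?y1 ?(ltW x0) ?(ltW y0).
rewrite expect_transpose //; last by move=> om'; case/andP: (@ind01 R (lpp (zerox om') h m <= lpp (zeroy om') h m)%N).
have E := @exit_V R y x h m tau t1 hy x0 xt (om \o transpose).
refine (le_trans _ E).
rewrite (@eq_par_expect _ _ (bpar x y (x * y) \o transpose) (bpar y x (y * x))); last first.
  move=> [a b] _; rewrite /bpar /= mulrC.
  by case: (eqVneq a 0%N); case: (eqVneq b 0%N).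
rewrite le_eqVlt; apply/orP; left; apply/eqP; apply: eq_expect => om'.
have e1 : zerox (om' \o transpose) = zeroy om' \o transpose by [].
have e2 : zeroy (om' \o transpose) = zerox om' \o transpose by [].
by rewrite e1 e2 !lpp_transpose.
Qed.

Lemma expect_shrink (par : pt -> R) m h M F : (forall u, (0 <= par u < 1)%R) ->
  (forall om, 0 <= F om) -> (m <= M)%N ->
  (forall u, (m < u.1)%N -> const_in u F) ->
  expect par (box M h) F = expect par (box m h) F.
Proof.
move=> hp F0 mM hF; rewrite (@expect_filter _ _ _ hp (fun u => (u.1 <= m)%N)) //; last first.
  by move=> u _; rewrite -ltnNge; exact: hF.
apply: expect_perm => //; apply: uniq_perm; rewrite ?filter_uniq ?uniq_box // => -[a b].
by rewrite mem_filter !mem_box /=; apply/idP/idP; lia.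
Qed.

Definition expect_iid (r : R) (L : nat) (F : (nat -> nat) -> \bar R) : \bar R :=
  expect (fun=> r) (iota 0 L) F (fun=> 0%N).

(** [g] lists columns of the axis without repetition. It will run away from the column of the edge,
    to the left or to the right. *)
Lemma expect_axisx x y q M h L (g : nat -> nat) (F : (nat -> nat) -> \bar R) :
  (0 <= x < 1)%R -> (0 <= y < 1)%R -> (0 <= q < 1)%R ->
  (forall a, 0 <= F a) -> (forall a b, (forall l, (l < L)%N -> a l = b l) -> F a = F b) ->
  (forall l, (l < L)%N -> (0 < g l <= M)%N) ->
  (forall l l', (l < L)%N -> (l' < L)%N -> g l = g l' -> l = l') ->
  forall om, expect (bpar x y q) (box M h) (fun om => F (fun l => om (g l, 0%N))) om =
    expect_iid x L F.
Proof.
move=> hx hy hq F0 locF gM ginj om; have hp := bpar_ratio hx hy hq.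
pose k l : pt := (g l, 0%N).
have inL l : (l \in iota 0 L) = (l < L)%N by rewrite mem_iota.
have kinj : {in iota 0 L &, injective k}.
  by move=> l l'; rewrite !inL => hl hl' [] /ginj; exact.
rewrite (@expect_filter _ _ _ hp (mem (map k (iota 0 L)))) //; last first.
  move=> u _ hu om' j; apply: locF => l lL; rewrite upd_neq //.
  by apply: contra hu => /eqP <-; apply/mapP; exists l; rewrite ?inL.
rewrite (@expect_perm _ _ _ hp _ (map k (iota 0 L))) //; last first.
  apply: uniq_perm; first by rewrite filter_uniq ?uniq_box.
    by rewrite map_inj_in_uniq ?iota_uniq.
  move=> u; rewrite mem_filter andb_idr // => /mapP[l]; rewrite inL => /gM hl ->.
  by rewrite mem_box /=; lia.
have locF' : forall a b, {in mem (iota 0 L), a =1 b} -> F a = F b.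
  by move=> a b ab; apply: locF => l lL; apply: ab; rewrite /= inL.
rewrite (@expect_rename _ _ _ k _ (mem (iota 0 L))) //.
rewrite (@eq_par_expect _ _ _ (fun=> x)) => [|l]; last first.
  by rewrite inL => /gM hl; rewrite /bpar /= gtn_eqF //; lia.
by apply: (expect_local _ locF') => l /= ->.
Qed.

End JointDomination.

(** * Comparing increments with stationary ones *)

Definition mono_upto {R : realType} (L : nat) (F : (nat -> nat) -> \bar R) :=
  forall a b, (forall l, (l < L)%N -> (a l <= b l)%N) -> F a <= F b.

Definition anti_upto {R : realType} (L : nat) (F : (nat -> nat) -> \bar R) :=
  forall a b, (forall l, (l < L)%N -> (a l <= b l)%N) -> F b <= F a.

Lemma dincr_le f g i : (f i.+1 + g i <= g i.+1 + f i)%N -> (dincr f i <= dincr g i)%N.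
Proof. by rewrite /dincr; lia. Qed.

Section Joint.
Context {R : realType}.
Implicit Types (x y q : R) (om : pt -> nat) (F : (nat -> nat) -> \bar R).

Lemma mono_local L F : mono_upto L F ->
  forall a b, (forall l, (l < L)%N -> a l = b l) -> F a = F b.
Proof. by move=> h a b ab; apply/eqP; rewrite eq_le !h // => l lL; rewrite ab. Qed.

Lemma anti_local L F : anti_upto L F ->
  forall a b, (forall l, (l < L)%N -> a l = b l) -> F a = F b.
Proof. by move=> h a b ab; apply/eqP; rewrite eq_le !h // => l lL; rewrite ab. Qed.

Lemma dual_lpp_upd om u k h i : (i < u.1)%N \/ u.1 = 0%N ->
  dual_lpp (upd om u k) h i = dual_lpp om h i.
Proof.
move=> hu.
have ne a b : (0 < a <= i)%N -> upd om u k (a, b) = om (a, b).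
  by move=> ha; rewrite upd_neq //; case: u hu => u1 u2 /=; rewrite xpair_eqE; lia.
have hrow n : forall a, (a <= i)%N -> dual_rows (upd om u k) n a = dual_rows om n a.
  elim: n => //= n IH a ai; apply: rowmax_ext => b hb; first by apply: ne; lia.
  by apply: IH; lia.
rewrite /dual_lpp; apply: rowmax_ext => a ha; first exact: ne.
by apply: hrow; lia.
Qed.

(* Left increments of the model with horizontal exits only are functions of the dual
   weights, hence independent of the stationary increments further right. *)
Lemma joint_increments x y c h L1 L2 F1 F2 :
  (0 <= x < 1)%R -> (0 <= y < 1)%R -> (L1 <= c)%N ->
  mono_upto L1 F1 -> anti_upto L2 F2 ->
  (forall a, 0 <= F1 a <= 1) -> (forall a, 0 <= F2 a <= 1) ->
  let M := (c + L2).+1 in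
  forall om,
  expect (bpar x y (x * y)) (box M h) (fun om =>
      F1 (fun l => dincr (lpp (zerox (zeroy om)) h) (c - l)) *
      F2 (fun l => dincr (lpp (zerox (zeroy om)) h) (c + l).+1)) om <=
  expect (bpar x y (x * y)) (box M h)
      (fun om => F1 (fun l => dincr (lpp (zeroy om) h) (c - l))) om * expect_iid x L2 F2 +
  expect (bpar x y (x * y)) (box M h)
      (fun om => ind (lpp (zerox om) h M <= lpp (zeroy om) h M)%N) om.
Proof.
move=> hx hy L1c mF1 aF2 F101 F201 M om.
have /andP[x0 x1] := hx; have /andP[y0 y1] := hy.
have hq : (0 <= x * y < 1)%R by rewrite mulr_ge0 //= mulr_ilt1.
have hp := bpar_ratio hx hy hq.
have F10 a : 0 <= F1 a by case/andP: (F101 a).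
have F11 a : F1 a <= 1 by case/andP: (F101 a).
have F20 a : 0 <= F2 a by case/andP: (F201 a).
have F21 a : F2 a <= 1 by case/andP: (F201 a).
have lF1 := mono_local mF1; have lF2 := anti_local aF2.
pose G1 (w : pt -> nat) := F1 (fun l => dincr (dual_lpp w h) (c - l)).
pose G2 (w : pt -> nat) := F2 (fun l => w ((c + l).+2, 0%N)).
have e1 w : F1 (fun l => dincr (lpp (zeroy w) h) (c - l)) = G1 (burke w M h).
  apply: lF1 => l lL; rewrite /dincr !(@lpp_zeroy_dual w h M) //; lia.
have e2 w : F2 (fun l => dincr (lpp w h) (c + l).+1) = G2 (burke w M h).
  by apply: lF2 => l lL; rewrite burke_top //; lia.
have G101 w : 0 <= G1 w <= 1 by exact: F101.
have G201 w : 0 <= G2 w <= 1 by exact: F201.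
have G1G2 w : 0 <= G1 w * G2 w by rewrite /G1 /G2 mule_ge0.
apply: (@le_trans _ _ (expect (bpar x y (x * y)) (box M h) (fun w =>
   G1 (burke w M h) * G2 (burke w M h) +
   ind (lpp (zerox w) h M <= lpp (zeroy w) h M)%N) om)).
  apply: le_expect => // w; rewrite -e1 -e2.
  have [VH|HV] := leqP (lpp (zerox w) h M) (lpp (zeroy w) h M).
    rewrite -[leLHS]add0e leeD //; first by rewrite mule_ge0.
    by rewrite /ind -[leRHS](mule1 1) lee_pmul.
  (* With a vertical exit at column [M], the stationary increments bound the bulk ones from below on
     its left, so the antitone [F2] may be evaluated at them. *)
  rewrite /ind adde0; apply: lee_pmul => //.
    by apply: mF1 => l lL; exact: dincr_T_le_H.
  apply: aF2 => l lL; apply: (@dincr_stat_le_T _ _ M); last exact: ltnW.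
  by rewrite /M; lia.
rewrite expectD //; last by move=> w; case/andP: (@ind01 R (lpp (zerox w) h M <= lpp (zeroy w) h M)%N).
rewrite leeD2r // (expect_burke M h hx hy (F := fun w => G1 w * G2 w)) //.
rewrite expectM //; last first.
  (* [G1] reads columns up to c + 1 and [G2] columns from c + 2 on, so every coordinate is ignored
     by one of them. *)
  move=> [a b] _; case: (ltnP c.+1 a) => hu; [left|right] => w k.
    by rewrite /G1; apply: lF1 => l lL; rewrite /dincr !dual_lpp_upd //=; left; lia.
  apply: lF2 => l lL; rewrite upd_neq // xpair_eqE; lia.
rewrite le_eqVlt; apply/orP; left; apply/eqP; congr (_ * _).
  rewrite -(expect_burke M h hx hy (F := G1)) //; last by move=> w; exact: F10.
  by apply: eq_expect => w; rewrite e1.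
rewrite /G2 (@expect_axisx _ _ _ _ _ _ L2 (fun l => (c + l).+2)) //.
- by move=> l lL; rewrite /M; lia.
- by move=> l l' _ _; lia.
Qed.

(** With horizontal exits only, the y-axis is invisible: its ratio can be lowered to keep the
    product while x is raised to x'. In the new model these increments are the stationary ones as
    soon as the exit at the leftmost column [i0] is horizontal. *)
Lemma left_increments x y x' y' c h L M F :
  (0 <= x)%R -> (x <= x')%R -> (x' < 1)%R -> (0 <= y < 1)%R -> (0 <= y' < 1)%R ->
  (x * y = x' * y')%R ->
  (L <= c)%N -> (c < M)%N -> mono_upto L F -> (forall a, 0 <= F a <= 1) ->
  let i0 := (c - L).+1 in
  forall om,
  expect (bpar x y (x * y)) (box M h)
    (fun om => F (fun l => dincr (lpp (zeroy om) h) (c - l))) om <=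
  expect_iid x' L F + expect (bpar x' y' (x' * y')) (box i0 h)
      (fun om => ind (lpp (zeroy om) h i0 <= lpp (zerox om) h i0)%N) om.
Proof.
move=> x0 xx' x'1 hy hy' hq Lc cM mF F01 i0 om.
have hx : (0 <= x < 1)%R by rewrite x0 (le_lt_trans xx').
have hx' : (0 <= x' < 1)%R by rewrite x'1 (le_trans x0).
have hqq : (0 <= x * y < 1)%R.
  by case/andP: hx hy => _ x1 /andP[y0 y1]; rewrite mulr_ge0 //= mulr_ilt1.
have hp := bpar_ratio hx hy hqq; have hp' := bpar_ratio hx' hy' hqq.
have F0 a : 0 <= F a by case/andP: (F01 a).
have F1 a : F a <= 1 by case/andP: (F01 a).
have lF := mono_local mF.
pose HF (w : pt -> nat) := F (fun l => dincr (lpp (zeroy w) h) (c - l)).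
pose bad (w : pt -> nat) := (lpp (zeroy w) h i0 <= lpp (zerox w) h i0)%N.
have bad0 w : 0 <= ind (bad w) :> \bar R by case/andP: (@ind01 R (bad w)).
apply: (@le_trans _ _ (expect (bpar x' y' (x * y)) (box M h) HF om)).
  apply: expect_mono => // -[a b] _.
  rewrite /bpar /=; case: (eqVneq b 0%N) => [->|b0].
    case: (eqVneq a 0%N) => [_|a0]; first by right; right.
    right; left; split => // w k k' kk; apply: mF => l lL.
    have hcmp i : (lpp (zeroy (upd w (a, 0%N) k)) h i.+1 + lpp (zeroy (upd w (a, 0%N) k')) h i <=
        lpp (zeroy (upd w (a, 0%N) k')) h i.+1 + lpp (zeroy (upd w (a, 0%N) k)) h i)%N.
      apply: (fun h1 h2 h3 => (lpp_compare h1 h2 h3 i h).1) => [i' j'|i'|//].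
        by rewrite /zeroy /upd /= xpair_eqE andbF.
      by rewrite /zeroy /upd /=; case: ((i'.+1, 0%N) == (a, 0%N)).
    exact/dincr_le/hcmp.
  case: (eqVneq a 0%N) => [->|a0]; last by right; right.
  by left => w k; rewrite zeroy_upd.
rewrite hq.
apply: (@le_trans _ _ (expect (bpar x' y' (x' * y')) (box M h) (fun w =>
    F (fun l => burke w M h ((c - l).+1, 0%N)) + ind (bad w)) om)).
  rewrite -hq; apply: le_expect => // w.
  case E: (bad w).
    by rewrite /ind -[leLHS]add0e; apply: leeD; [exact: F0|exact: F1].
  rewrite /ind adde0 le_eqVlt; apply/orP; left; apply/eqP; apply: lF => l lL.
  rewrite burke_top; last by clear -cM; lia.
  apply: (@dincr_H_stat _ _ i0); first by rewrite /i0; clear -lL Lc; lia.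
  by apply: ltnW; rewrite ltnNge; apply/negbT.
rewrite expectD // -?hq // hq leeD //.
  rewrite (expect_burke M h hx' hy' (F := fun w => F (fun l => w ((c - l).+1, 0%N)))) // -hq.
  rewrite (@expect_axisx _ _ _ _ _ _ L (fun l => (c - l).+1)) //.
  - by move=> l lL; clear -cM; lia.
  - by move=> l l' ll ll'; clear -ll ll' Lc; lia.
rewrite -hq (@expect_shrink _ _ i0 h M) //; first by rewrite /i0; clear -Lc cM; lia.
move=> u hu w k; congr ind; congr leq; apply: lpp_local => a b ha hb.
  by rewrite /zeroy; case: ifP => // _; rewrite upd_neq //; clear -hu ha hb; apply: contraTneq hu => <- /=; lia.
by rewrite /zerox; case: ifP => // _; rewrite upd_neq //; clear -hu ha hb; apply: contraTneq hu => <- /=; lia.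
Qed.

End Joint.

(** * The comparison random walk *)

Section Walk.
Context {R : realType}.
Implicit Types (x y : R).

Lemma gsum_shift r (f : nat -> \bar R) : (0 <= r < 1)%R -> (forall k, 0 <= f k) ->
  gsum r f = (1 - r)%:E * f 0%N + r%:E * gsum r (fun k => f k.+1).
Proof.
move=> hr f0; have /andP[r0 r1] := hr.
have a0 k : 0 <= ((1 - r) * r ^+ k)%:E * f k by rewrite mule_ge0 ?gweight_ge0.
rewrite /gsum (esumID [set 0%N]) //; congr (_ + _).
  by rewrite setTI esum_set1 // expr0 mulr1.
rewrite setTI -/(gsum r _) -gsumZl // /gsum.
rewrite (@reindex_esum _ _ _ setT (~` [set 0%N]) S) /=.
  by apply: eq_esum => k _; rewrite exprSr mulrA EFinM muleA.
split => [k _ //|a b _ _ [] //|[|k] //= _]; by exists k.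
Qed.

(** One step of the walk killed below zero; the test guards against truncated subtraction. *)
Definition wstep x y (f : nat -> \bar R) (d : nat) : \bar R :=
  gsum x (fun k => gsum y (fun k' => if (k' <= d + k)%N then f (d + k - k')%N else 0)).

(* Probability that the walk started at [d] with increments [Geom x - Geom y] stays
   nonnegative during [L] steps. *)
Fixpoint walk x y (L : nat) : nat -> \bar R :=
  if L is L'.+1 then wstep x y (walk x y L') else fun=> 1.

Lemma le_wstep x y f g d : (0 <= x < 1)%R -> (0 <= y < 1)%R -> (forall d, f d <= g d) ->
  wstep x y f d <= wstep x y g d.
Proof.
move=> hx hy fg; apply: le_gsum => // k; apply: le_gsum => // k'.
by case: ifP.
Qed.

Lemma wstep_ge0 x y f d : (0 <= x < 1)%R -> (0 <= y < 1)%R -> (forall d, 0 <= f d) ->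
  0 <= wstep x y f d.
Proof. by move=> hx hy f0; apply: gsum_ge0 => // k; apply: gsum_ge0 => // k'; case: ifP. Qed.

Lemma walk_ge0 x y L d : (0 <= x < 1)%R -> (0 <= y < 1)%R -> 0 <= walk x y L d.
Proof. by move=> hx hy; elim: L d => [|L IH] d //=; apply: wstep_ge0. Qed.

Lemma walk_le1 x y L d : (0 <= x < 1)%R -> (0 <= y < 1)%R -> walk x y L d <= 1.
Proof.
move=> hx hy; elim: L d => [|L IH] d //=.
by apply: gsum_le1 => // k; apply: gsum_le1 => // k'; case: ifP.
Qed.

Lemma wstepZl x y (c : R) f d : (0 <= x < 1)%R -> (0 <= y < 1)%R -> (0 <= c)%R ->
  (forall d, 0 <= f d) -> wstep x y (fun d => c%:E * f d) d = c%:E * wstep x y f d.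
Proof.
move=> hx hy c0 f0; rewrite /wstep -gsumZl //; last first.
  by move=> k; apply: gsum_ge0 => // k'; case: ifP.
apply: eq_gsum => k; rewrite -gsumZl //; last by move=> k'; case: ifP.
by apply: eq_gsum => k'; case: ifP => // _; rewrite mule0.
Qed.

Lemma gsum_trunc r (f : nat -> \bar R) w : (0 <= r < 1)%R -> (forall k, 0 <= f k) ->
  gsum r (fun k => if (k <= w.+1)%N then f (w.+1 - k)%N else 0) =
  (1 - r)%:E * f w.+1 + r%:E * gsum r (fun k => if (k <= w)%N then f (w - k)%N else 0).
Proof.
by move=> hr f0; rewrite gsum_shift // => k; case: ifP.
Qed.

Lemma gsum_trunc0 r (f : nat -> \bar R) : (0 <= r < 1)%R -> (forall k, 0 <= f k) ->
  gsum r (fun k => if (k <= 0)%N then f (0 - k)%N else 0) = (1 - r)%:E * f 0%N.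
Proof.
move=> hr f0; rewrite gsum_shift //; last by move=> k; case: ifP.
by rewrite /= gsum_cst // mule0 adde0.
Qed.

Lemma gsum_mean r : (0 <= r < 1)%R -> gsum r (fun k => (k%:R : R)%:E) = (r / (1 - r))%:E.
Proof.
move=> hr; have /andP[r0 r1] := hr.
have n0 k : 0 <= (k%:R : R)%:E by rewrite lee_fin.
(* The mean solves m = r (m + 1), which determines it only once it is finite; an exponential moment
   shows finiteness. *)
have fin : gsum r (fun k => (k%:R : R)%:E) \is a fin_num.
  have [t t1 rt] : exists2 t : R, (1 < t)%R & (r * t < 1)%R.
    exists (1 + (1 - r) / 2)%R; nra.
  have t0 : (0 <= t)%R by rewrite ltW // (lt_trans _ t1).
  rewrite ge0_fin_numE ?gsum_ge0 //.
  apply: (@le_lt_trans _ _ (gsum r (fun k => ((t - 1)^-1)%:E * (t ^+ k)%:E))).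
    apply: le_gsum => // k; rewrite -EFinM lee_fin mulrC ler_pdivlMr ?subr_gt0 //.
    elim: k => [|k IH]; first by rewrite mul0r.
    have tk : (1 <= t ^+ k)%R by rewrite exprn_ege1 // ltW.
    by rewrite exprS -natr1; nra.
  rewrite gsumZl //; last by move=> k; rewrite lee_fin exprn_ge0.
    by rewrite gsum_mgf // -EFinM ltry.
  by rewrite invr_ge0 subr_ge0 ltW.
have := gsum_shift hr n0.
have -> : gsum r (fun k => (k.+1%:R : R)%:E) = gsum r (fun k => (k%:R : R)%:E) + 1.
  rewrite -[X in _ + X](gsum1 hr) -gsumD //.
  by apply: eq_gsum => k; rewrite -EFinD natr1.
rewrite -(fineK fin) mule0 add0e -EFinD -EFinM => -[] h.
congr EFin; move: (fine _) h => m h.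
by apply: (canRL (mulfK _)); [rewrite subr_eq0 gt_eqF | lra].
Qed.

(** Optional stopping for the walk of drift -mu killed below zero: mu times its mean lifetime is
    bounded by its height plus the mean overshoot, and survival of [L] steps accounts for a lifetime
    of at least [L]. *)
Lemma walk_time x y L d : (0 < y)%R -> (y < x)%R -> (x < 1)%R ->
  (x / (1 - x) - y / (1 - y))%:E * ((L%:R : R)%:E * walk y x L d) <= ((1 - x)^-1 + d%:R)%:E.
Proof.
move=> y0 yx x1.
have x0 : (0 < x)%R by rewrite (lt_trans y0).
have y1 : (y < 1)%R by rewrite (lt_trans yx).
have hx : (0 <= x < 1)%R by rewrite x1 ltW.
have hy : (0 <= y < 1)%R by rewrite y1 ltW.
set mu := (_ - _)%R.
have mu0 : (0 <= mu)%R.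
  have -> : mu = ((x - y) / ((1 - x) * (1 - y)))%R.
    by rewrite /mu; field; rewrite !subr_eq0 !gt_eqF.
  by rewrite divr_ge0 // ?mulr_ge0 // subr_ge0 ltW.
have C0 : (0 <= (1 - x)^-1)%R by rewrite invr_ge0 subr_ge0 ltW.
(* By lack of memory the jump that kills the walk ends at -(1 + Geom x), of mean -(1 - x)^-1. With
   this shift the linear function averages to zero at the killing time, whence the simple form of
   [trunc]. *)
pose g d : \bar R := ((1 - x)^-1 + d%:R)%:E.
have g0 k : 0 <= g k by rewrite lee_fin addr_ge0.
have trunc w : gsum x (fun k => if (k <= w)%N then g (w - k)%N else 0) = (w.+1%:R)%:E.
  elim: w => [|w IH].
    by rewrite gsum_trunc0 // /g -EFinM addr0 mulfV // subr_eq0 gt_eqF.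
  rewrite gsum_trunc // IH /g -!EFinM -EFinD; congr EFin.
  rewrite mulrDr mulfV ?subr_eq0 ?gt_eqF //.
  by rewrite -[w.+2%:R]natr1; ring.
elim: L d => [|L IH] d; first by rewrite mul0e mule0 lee_fin addr_ge0.
have w0 d' : 0 <= walk y x L d' by exact: walk_ge0.
have w1 : walk y x L.+1 d <= 1 by exact: walk_le1.
have LE : (L.+1%:R : R)%:E * walk y x L.+1 d <= 1 + wstep y x (fun d => (L%:R : R)%:E * walk y x L d) d.
  rewrite wstepZl // -natr1 EFinD ge0_muleDl // ?lee_fin // mul1e addeC leeD //.
apply: (@le_trans _ _ (mu%:E + wstep y x g d)).
  apply: (@le_trans _ _ (mu%:E * (1 + wstep y x (fun d => (L%:R : R)%:E * walk y x L d) d))).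
    by apply: lee_wpmul2l; rewrite ?lee_fin.
  have ww : 0 <= wstep y x (fun d => (L%:R : R)%:E * walk y x L d) d.
    by apply: wstep_ge0 => // d'; rewrite mule_ge0 ?lee_fin.
  rewrite ge0_muleDr // mule1 leeD2l // -wstepZl //; last by move=> d'; rewrite mule_ge0 ?lee_fin.
  exact: le_wstep.
rewrite /wstep.
have -> : gsum y (fun k => gsum x (fun k' => if (k' <= d + k)%N then g (d + k - k')%N else 0)) =
    gsum y (fun k => (d.+1%:R : R)%:E + (k%:R : R)%:E).
  by apply: eq_gsum => k; rewrite trunc -EFinD -natrD addSn.
rewrite gsumD //; try by move=> k; rewrite lee_fin.
rewrite gsum_cst ?lee_fin // gsum_mean // -!EFinD lee_fin le_eqVlt; apply/orP; left; apply/eqP.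
rewrite /mu -natr1; field; by rewrite !subr_eq0 !gt_eqF.
Qed.

(* Exchanging the two parameters reverses the drift; the density is the
   exponential martingale [(x / y) ^ S], and geometric overshoots are memoryless. *)
Lemma walk_swap x y L d : (0 < y)%R -> (y < x)%R -> (x < 1)%R ->
  (x / y * ((1 - y) / (1 - x)))%:E * walk x y L d + ((y / x) ^+ d)%:E <=
  (x / y * ((1 - y) / (1 - x)))%:E + ((y / x) ^+ d)%:E * walk y x L d.
Proof.
move=> y0 yx x1.
have x0 : (0 < x)%R by rewrite (lt_trans y0).
have y1 : (y < 1)%R by rewrite (lt_trans yx).
have hx : (0 <= x < 1)%R by rewrite x1 ltW.
have hy : (0 <= y < 1)%R by rewrite y1 ltW.
have x1' : (0 < 1 - x)%R by rewrite subr_gt0.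
have y1' : (0 < 1 - y)%R by rewrite subr_gt0.
set C := (x / y * _)%R; set r := (y / x)%R.
have C0 : (0 <= C)%R by rewrite mulr_ge0 // divr_ge0 // ltW.
have r0 : (0 < r)%R by rewrite divr_gt0.
have rk0 k : (0 <= r ^+ k)%R by rewrite exprn_ge0 // ltW.
have xr : (x * r = y)%R by rewrite /r mulrC divfK // gt_eqF.
have yr : (y * r^-1 = x)%R by rewrite /r; field; rewrite !gt_eqF.
pose T (f : nat -> \bar R) w : \bar R :=
  gsum y (fun k => if (k <= w)%N then f (w - k)%N else 0).
have one0 (k : nat) : 0 <= (1 : \bar R) by rewrite lee_fin.
have trunc1 w : T (fun=> 1) w = (1 - y ^+ w.+1)%:E.
  rewrite /T; elim: w => [|w IH].
    by rewrite (@gsum_trunc0 y (fun=> 1)) // mule1 expr1.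
  rewrite (@gsum_trunc y (fun=> 1)) // IH mule1 -EFinM -EFinD; congr EFin.
  by rewrite [in RHS]exprS; ring.
have truncr w : T (fun k => (r ^+ k)%:E) w =
    ((1 - y) / (1 - x) * (r ^+ w - x * y ^+ w))%:E.
  rewrite /T; elim: w => [|w IH].
    rewrite (@gsum_trunc0 y (fun k => (r ^+ k)%:E)) ?expr0 //.
    by rewrite mule1 mulr1; congr EFin; field; rewrite gt_eqF.
  rewrite (@gsum_trunc y (fun k => (r ^+ k)%:E)) // IH -EFinM -EFinM -EFinD; congr EFin.
  transitivity ((1 - y) / (1 - x) * ((1 - x) * (r * r ^+ w) + (x * r) * r ^+ w - x * (y * y ^+ w)))%R.
    by rewrite xr exprS; field; rewrite gt_eqF.
  by rewrite !exprS; ring.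
elim: L d => [|L IH] d; first by rewrite /= !mule1.
have w0 d' : 0 <= walk x y L d' by exact: walk_ge0.
have w0' d' : 0 <= walk y x L d' by exact: walk_ge0.
have T0 f w : (forall k, 0 <= f k) -> 0 <= T f w.
  by move=> f0; apply: gsum_ge0 => // k; case: ifP.
have TD f g w : (forall k, 0 <= f k) -> (forall k, 0 <= g k) ->
    T (fun k => f k + g k) w = T f w + T g w.
  move=> f0 g0; rewrite /T -gsumD //; try by move=> k; case: ifP.
  by apply: eq_gsum => k; case: ifP; rewrite ?adde0.
have TZ c f w : (0 <= c)%R -> (forall k, 0 <= f k) ->
    T (fun k => c%:E * f k) w = c%:E * T f w.
  move=> c0 f0; rewrite /T -gsumZl //; last by move=> k; case: ifP.
  by apply: eq_gsum => k; case: ifP; rewrite ?mule0.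
have Tle f g w : (forall k, f k <= g k) -> T f w <= T g w.
  by move=> fg; apply: le_gsum => // k; case: ifP.
have rwalk0 k : 0 <= (r ^+ k)%:E * walk y x L k by rewrite mule_ge0 ?lee_fin.
have step w : C%:E * T (walk x y L) w + ((1 - y) / (1 - x) * r ^+ w)%:E <=
    C%:E + T (fun k => (r ^+ k)%:E * walk y x L k) w.
  have : T (fun k => C%:E * walk x y L k + (r ^+ k)%:E) w <=
         T (fun k => C%:E * 1 + (r ^+ k)%:E * walk y x L k) w.
    by apply: Tle => k; rewrite mule1.
  rewrite !TD ?TZ //; try by move=> k; rewrite ?mule_ge0 ?lee_fin.
  rewrite trunc1 truncr => h.
  have := leeD2r (C * y ^+ w.+1)%:E h.
  rewrite -addeA -EFinD -EFinM addeAC -EFinD.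
  have -> : ((1 - y) / (1 - x) * (r ^+ w - x * y ^+ w) + C * y ^+ w.+1 =
             (1 - y) / (1 - x) * r ^+ w)%R.
    by rewrite /C exprS; field; rewrite !gt_eqF.
  by have -> : (C * (1 - y ^+ w.+1) + C * y ^+ w.+1 = C)%R by ring.
have eL : walk x y L.+1 d = gsum x (fun k => T (walk x y L) (d + k)%N) by [].
have eR : walk y x L.+1 d = gsum y (fun k => gsum x (fun k' =>
   if (k' <= d + k)%N then walk y x L (d + k - k')%N else 0)) by [].
have e1 : gsum x (fun k => ((1 - y) / (1 - x) * r ^+ (d + k))%:E) = (r ^+ d)%:E.
  transitivity (gsum x (fun k => ((1 - y) / (1 - x) * r ^+ d)%:E * (r ^+ k)%:E)).
    by apply: eq_gsum => k; rewrite -EFinM exprD mulrA.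
  have c0 : (0 <= (1 - y) / (1 - x) * r ^+ d)%R by rewrite mulr_ge0 // divr_ge0 // ltW.
  rewrite gsumZl //.
  rewrite gsum_mgf ?xr // ?(ltW r0) // -EFinM; congr EFin.
  by field; rewrite !gt_eqF.
have e2 k : T (fun k => (r ^+ k)%:E * walk y x L k) (d + k)%N =
    (r ^+ d * ((1 - y) / (1 - x)))%:E * ((r ^+ k)%:E * gsum x (fun k' =>
      if (k' <= d + k)%N then walk y x L (d + k - k')%N else 0)).
  have ri0 : (0 <= r^-1)%R by rewrite invr_ge0 ltW.
  have p0 k' : 0 <= (if (k' <= d + k)%N then walk y x L (d + k - k')%N else 0) by case: ifP.
  have := @gsum_tilt _ y r^-1 (fun k' => if (k' <= d + k)%N then walk y x L (d + k - k')%N else 0)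
    hy ri0; rewrite yr => /(_ x1 p0) h.
  transitivity ((r ^+ (d + k))%:E * gsum y (fun k' => (r^-1 ^+ k')%:E *
      if (k' <= d + k)%N then walk y x L (d + k - k')%N else 0)).
    rewrite -gsumZl //; last first.
      by move=> k'; rewrite mule_ge0 // lee_fin exprn_ge0.
    apply: eq_gsum => k'; case: ifP => hk; last by rewrite !mule0.
    rewrite muleA -EFinM; congr (_%:E * _).
    rewrite -[in RHS](subnK hk) exprD -mulrA -exprMn mulfV ?gt_eqF //.
    by rewrite expr1n mulr1.
  rewrite h !muleA -!EFinM; congr (_%:E * _).
  by rewrite exprD; ring.
have e3 : gsum x (fun k => T (fun k => (r ^+ k)%:E * walk y x L k) (d + k)%N) =
    (r ^+ d)%:E * walk y x L.+1 d.
  have p0 k : 0 <= gsum x (fun k' =>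
      if (k' <= d + k)%N then walk y x L (d + k - k')%N else 0).
    by apply: gsum_ge0 => // k'; case: ifP.
  have c0 : (0 <= r ^+ d * ((1 - y) / (1 - x)))%R by rewrite mulr_ge0 // divr_ge0 // ltW.
  rewrite (eq_gsum _ e2) gsumZl //; last by move=> k; rewrite mule_ge0 ?lee_fin.
  rewrite gsum_tilt ?xr // ?(ltW r0) // eR muleA -EFinM; congr (_%:E * _).
  by field; rewrite !gt_eqF.
have s0 k : 0 <= T (walk x y L) k by apply: T0.
have s1 k : 0 <= T (fun k => (r ^+ k)%:E * walk y x L k) k by apply: T0.
rewrite eL -e1 -gsumZl // -gsumD //; last 2 first.
- by move=> k; rewrite mule_ge0.
- by move=> k; rewrite lee_fin mulr_ge0 // divr_ge0 // ltW.
rewrite e1 -e3.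
apply: (@le_trans _ _ (gsum x (fun k => C%:E + T (fun k => (r ^+ k)%:E * walk y x L k) (d + k)%N))).
  by apply: le_gsum => // k; exact: step.
by rewrite gsumD // gsum_cst.
Qed.

(** At d = 0, [walk_swap] bounds survival with upward drift by C - 1, which is the first term, plus
    survival of the reversed walk, which [walk_time] controls. *)
Lemma walk_bound x y L : (0 < y)%R -> (y < x)%R -> (x < 1)%R -> (0 < L)%N ->
  walk x y L 0 <= ((x - y) / (y * (1 - x)) + (L%:R * (x - y))^-1)%:E.
Proof.
move=> y0 yx x1 L0.
have x0 : (0 < x)%R by rewrite (lt_trans y0).
have y1 : (y < 1)%R by rewrite (lt_trans yx).
have hx : (0 <= x < 1)%R by rewrite x1 ltW.
have hy : (0 <= y < 1)%R by rewrite y1 ltW.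
have x1' : (0 < 1 - x)%R by rewrite subr_gt0.
have y1' : (0 < 1 - y)%R by rewrite subr_gt0.
have xy0 : (0 < x - y)%R by rewrite subr_gt0.
have LR : (0 < L%:R :> R)%R by rewrite ltr0n.
have fin u v : (0 <= u < 1)%R -> (0 <= v < 1)%R -> walk u v L 0 = (fine (walk u v L 0))%:E.
  move=> hu hv; rewrite fineK // ge0_fin_numE ?walk_ge0 //.
  by rewrite (le_lt_trans (walk_le1 L 0%N hu hv)) // ltry.
have := walk_time L 0 y0 yx x1; have := walk_swap L 0 y0 yx x1.
have := walk_ge0 L 0 hx hy.
rewrite (fin x y) // (fin y x) //; move: (fine _) (fine _) => v u.
rewrite -!EFinM -!EFinD !lee_fin !expr0 !mul1r addr0 => u0 h1 h2.
have hv : (v <= (L%:R * (x - y))^-1)%R.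
  have LLy : (0 < L%:R * (x - y) :> R)%R by rewrite mulr_gt0.
  rewrite -[leRHS]mul1r ler_pdivlMr //.
  have e : (x / (1 - x) - y / (1 - y) = (x - y) / ((1 - x) * (1 - y)))%R.
    by field; rewrite !gt_eqF.
  move: h2; rewrite e -[X in (_ <= X)%R]mul1r ler_pdivlMr // => h2.
  apply: (@le_trans _ _ ((x - y) / ((1 - x) * (1 - y)) * (L%:R * v) * (1 - x) * (1 - y)))%R.
    by rewrite le_eqVlt; apply/orP; left; apply/eqP; field; rewrite !gt_eqF.
  apply: (@le_trans _ _ (1 * (1 - y)))%R; first by rewrite ler_pM2r.
  by rewrite mul1r gerBl ltW.
have hC : (1 <= x / y * ((1 - y) / (1 - x)))%R.
  rewrite mulf_div ler_pdivlMr ?mulr_gt0 // mul1r; nra.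
apply: (@le_trans _ _ (x / y * ((1 - y) / (1 - x)) * u))%R; first by rewrite ler_peMl.
have -> : ((x - y) / (y * (1 - x)) = x / y * ((1 - y) / (1 - x)) - 1)%R.
  by field; rewrite !gt_eqF.
by lra.
Qed.

(** The base of the exponential moment is the square root [t] of the ratio of the parameters: it
    tilts both x and x t^2 to x t. *)
Lemma walk_chernoff x t L d : (0 < x)%R -> (1 < t)%R -> (x * t ^+ 2 < 1)%R ->
  walk x (x * t ^+ 2) L d <= (t ^+ d * (1 - x * (t - 1) ^+ 2 / (1 - x * t) ^+ 2) ^+ L)%:E.
Proof.
move=> x0 t1 xt; have t0 : (0 < t)%R by rewrite (lt_trans _ t1).
have xt1 : (x * t < 1)%R.
  by rewrite (le_lt_trans _ xt) // ler_pM2l // ler_eXnr // ltW.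
have x1 : (x < 1)%R by rewrite (le_lt_trans _ xt1) // ler_peMr // ltW.
have hx : (0 <= x < 1)%R by rewrite x1 ltW.
have hy : (0 <= x * t ^+ 2 < 1)%R by rewrite xt mulr_ge0 // ?exprn_ge0 // ltW.
have x1' : (0 < 1 - x)%R by rewrite subr_gt0.
have xt1' : (0 < 1 - x * t)%R by rewrite subr_gt0.
have y1' : (0 < 1 - x * t ^+ 2)%R by rewrite subr_gt0.
set r := (1 - _ / _)%R.
have re : (r = (1 - x) / (1 - x * t) * ((1 - x * t ^+ 2) / (1 - x * t)))%R.
  by rewrite /r; field; rewrite gt_eqF.
have r0 : (0 <= r)%R by rewrite re mulr_ge0 // divr_ge0 // ltW.
have tk0 (k : nat) : (0 <= t ^+ k)%R by rewrite exprn_ge0 // ltW.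
have ti0 (k : nat) : (0 <= t^-1 ^+ k)%R by rewrite exprn_ge0 // invr_ge0 ltW.
elim: L d => [|L IH] d; first by rewrite expr0 mulr1 lee_fin exprn_ege1 // ltW.
apply: (@le_trans _ _ (gsum x (fun k => gsum (x * t ^+ 2) (fun k' =>
   (t ^+ d * r ^+ L * t ^+ k)%:E * (t^-1 ^+ k')%:E)))).
  apply: le_gsum => // k; apply: le_gsum => // k'.
  case: ifP => hk; last by rewrite -EFinM lee_fin !mulr_ge0 // exprn_ge0.
  apply: (le_trans (IH _)); rewrite -EFinM lee_fin.
  have e : (t ^+ (d + k - k') = t ^+ d * t ^+ k * t^-1 ^+ k')%R.
    rewrite -exprD -[in RHS](subnK hk) exprD -mulrA -exprMn mulfV ?gt_eqF //.
    by rewrite expr1n mulr1.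
  by rewrite e le_eqVlt; apply/orP; left; apply/eqP; ring.
have yti : (x * t ^+ 2 * t^-1 = x * t)%R by field; rewrite gt_eqF.
have ti : (0 <= t^-1)%R by rewrite invr_ge0 ltW.
have rL0 : (0 <= r ^+ L)%R by rewrite exprn_ge0.
rewrite (eq_gsum _ (g := fun k => ((t ^+ d * r ^+ L * ((1 - x * t ^+ 2) / (1 - x * t)))%:E *
   (t ^+ k)%:E))); last first.
  move=> k; have c0 : (0 <= t ^+ d * r ^+ L * t ^+ k)%R by rewrite !mulr_ge0.
  by rewrite gsumZl // gsum_mgf ?yti // -!EFinM; congr EFin; ring.
have c0 : (0 <= t ^+ d * r ^+ L * ((1 - x * t ^+ 2) / (1 - x * t)))%R.
  by rewrite !mulr_ge0 // ?invr_ge0 ltW.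
rewrite gsumZl //.
rewrite gsum_mgf ?(ltW t0) // -EFinM lee_fin le_eqVlt; apply/orP; left; apply/eqP.
by rewrite [in RHS]exprS; move: (r ^+ L)%R => rL; rewrite re; ring.
Qed.

End Walk.

(** * The walk as a comparison of two sequences *)

Definition below (d L : nat) (a b : nat -> nat) : bool :=
  all (fun k => \sum_(l < k) b l <= d + \sum_(l < k) a l)%N (iota 0 L.+1).

Lemma belowP d L (a b : nat -> nat) :
  reflect (forall k, (k <= L)%N -> (\sum_(l < k) b l <= d + \sum_(l < k) a l)%N) (below d L a b).
Proof.
apply: (iffP allP) => h k hk; apply: h; first by rewrite mem_iota.
by move: hk; rewrite mem_iota add0n ltnS.
Qed.

Lemma below_le d L (a b a' b' : nat -> nat) : (forall l, (l < L)%N -> (a l <= a' l)%N) ->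
  (forall l, (l < L)%N -> (b' l <= b l)%N) -> below d L a b -> below d L a' b'.
Proof.
move=> ha hb /belowP h; apply/belowP => k kL.
apply: (@leq_trans (\sum_(l < k) b l)).
  by apply: leq_sum => l _; apply: hb; rewrite (leq_trans (ltn_ord l)).
apply: (leq_trans (h k kL)); rewrite leq_add2l.
by apply: leq_sum => l _; apply: ha; rewrite (leq_trans (ltn_ord l)).
Qed.

Definition ncons (k : nat) (a : nat -> nat) (l : nat) : nat := if l is l'.+1 then a l' else k.

Lemma below_cons d L k k' (a b : nat -> nat) :
  below d L.+1 (ncons k a) (ncons k' b) = (k' <= d + k)%N && below (d + k - k') L a b.
Proof.
have e (c : nat -> nat) j i : (\sum_(l < i.+1) ncons j c l = j + \sum_(l < i) c l)%N.
  by rewrite big_ord_recl.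
apply/belowP/andP => [h|[hk /belowP h] [|i] iL].
- have hk : (k' <= d + k)%N by have := h 1%N isT; rewrite !e !big_ord0; lia.
  by split=> //; apply/belowP => i iL; have := h i.+1 iL; rewrite !e; lia.
- by rewrite !big_ord0.
- by have := h i iL; rewrite !e; lia.
Qed.

Section WalkExpectation.
Context {R : realType}.
Implicit Types (x y : R).

Lemma expect_shiftS r (l : seq nat) (F : (nat -> nat) -> \bar R) om :
  expect (fun=> r) (map S l) F om =
  expect (fun=> r) l (fun a => F (ncons (om 0%N) a)) (om \o S).
Proof.
elim: l om => [|i l IH] om.
  by congr F; apply/funext => -[|j].
by rewrite map_cons !expect_cons; apply: eq_gsum => k; rewrite IH upd_neq.
Qed.

Lemma expect_iidS r L (F : (nat -> nat) -> \bar R) :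
  expect_iid r L.+1 F = gsum r (fun k => expect_iid r L (fun a => F (ncons k a))).
Proof.
rewrite /expect_iid /= -(addn0 1%N) iotaDl expect_cons; apply: eq_gsum => k.
by rewrite (eq_map add1n) expect_shiftS upd_at.
Qed.

Lemma expect_gsum {K : eqType} (par : K -> R) r l (F : (K -> nat) -> nat -> \bar R) om :
  (forall u, (0 <= par u < 1)%R) -> (0 <= r < 1)%R -> (forall a k, 0 <= F a k) ->
  expect par l (fun a => gsum r (F a)) om = gsum r (fun k => expect par l (F^~ k) om).
Proof.
move=> hp hr F0; elim: l om => // u l IH om; rewrite expect_cons.
rewrite (eq_gsum _ (fun k => IH _)) gsum_swap // => a b.
by apply: expect_ge0.
Qed.

Lemma expect_expect {K K' : eqType} (par : K -> R) (par' : K' -> R) l l'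
    (F : (K -> nat) -> (K' -> nat) -> \bar R) om om' :
  (forall u, (0 <= par u < 1)%R) -> (forall u, (0 <= par' u < 1)%R) ->
  (forall a b, 0 <= F a b) ->
  expect par l (fun a => expect par' l' (F a) om') om =
  expect par' l' (fun b => expect par l (F^~ b) om) om'.
Proof.
move=> hp hp' F0; elim: l' om' => // u l' IH om'.
rewrite [RHS]expect_cons.
transitivity (expect par l (fun a => gsum (par' u) (fun k => expect par' l' (F a) (upd om' u k))) om) => //.
rewrite expect_gsum // => [|a k]; last by apply: expect_ge0.
by apply: eq_gsum => k; rewrite IH.
Qed.

(** Summing out the first terms of both sequences reproduces [wstep]; the initial height [d] absorbs
    them and lets the induction close. *)
Lemma expect_below x y L d : (0 <= x < 1)%R -> (0 <= y < 1)%R ->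
  expect_iid x L (fun a => expect_iid y L (fun b => ind (below d L a b))) = walk x y L d :> \bar R.
Proof.
move=> hx hy; elim: L d => [|L IH] d.
  rewrite /expect_iid /= /expect /= /below /=.
  by rewrite !big_ord0.
have i0 c a b : 0 <= ind (below c L a b) :> \bar R by case/andP: (@ind01 R (below c L a b)).
have i0' c k k' a b : 0 <= ind (below c L.+1 (ncons k a) (ncons k' b)) :> \bar R.
  by case/andP: (@ind01 R (below c L.+1 (ncons k a) (ncons k' b))).
rewrite expect_iidS; apply: eq_gsum => k.
transitivity (expect_iid x L (fun a => gsum y (fun k' =>
    expect_iid y L (fun b => ind (below d L.+1 (ncons k a) (ncons k' b)))))) => [|].
  by congr expect; apply/funext => a; rewrite expect_iidS.
rewrite /expect_iid expect_gsum // => [|a k']; last by apply: expect_ge0.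
apply: eq_gsum => k'; case: ifP => hk.
  apply: (etrans _ (IH (d + k - k')%N)).
  congr expect; apply/funext => a; congr expect; apply/funext => b.
  by rewrite below_cons hk.
rewrite (_ : (fun a => _) = fun=> 0).
  by rewrite expect_indep.
apply/funext => a; rewrite (_ : (fun b => _) = fun=> 0); first by rewrite expect_indep.
by apply/funext => b; rewrite below_cons hk.
Qed.

End WalkExpectation.

(** * Bulk increments against i.i.d. geometric variables *)

Definition ptincr (h : nat) (om : pt -> nat) (i : nat) : nat :=
  dincr (lpp (zerox (zeroy om)) h) i.

Lemma ptincr_upd_axis h om u k i : (u.1 == 0%N) || (u.2 == 0%N) ->
  ptincr h (upd om u k) i = ptincr h om i.
Proof.
move=> hu; rewrite /ptincr.
have -> // : zerox (zeroy (upd om u k)) = zerox (zeroy om).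
apply/funext => -[a b]; rewrite /zerox /zeroy /upd /=.
case: eqP => // b0; case: eqP => // a0; case: eqP => // e.
by move: hu; rewrite -e /=; case: eqP => //; case: eqP.
Qed.

Lemma ptincr_upd_far h om u k i : (i.+1 < u.1)%N ->
  ptincr h (upd om u k) i = ptincr h om i.
Proof.
move=> hu; have e j a b : (j <= i.+1)%N -> (a <= j)%N ->
    zerox (zeroy (upd om u k)) (a, b) = zerox (zeroy om) (a, b).
  move=> ji aj; rewrite /zerox /zeroy /upd /=.
  case: eqP => // _; case: eqP => // _; case: eqP => // eab.
  by move: hu; rewrite -eab /=; lia.
by rewrite /ptincr /dincr; congr (_ - _)%N; apply: lpp_local => a b ha hb; apply: e ha.
Qed.

Section Model.
Context {R : realType}.
Implicit Types (x y q : R) (om : pt -> nat) (F : (nat -> nat) -> \bar R).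

(* Probabilities that the stationary geodesic exits through the vertical ([errS]), respectively
   the horizontal ([errW]) axis. *)
Definition errS (q x : R) (m h : nat) (om : pt -> nat) : \bar R :=
  expect (bpar x (q / x) q) (box m h)
      (fun om => ind (lpp (zeroy om) h m <= lpp (zerox om) h m)%N) om.

Definition errW (q x : R) (m h : nat) (om : pt -> nat) : \bar R :=
  expect (bpar x (q / x) q) (box m h)
      (fun om => ind (lpp (zerox om) h m <= lpp (zeroy om) h m)%N) om.

(** A functional that ignores the axes has the same expectation whatever ratios are put there, so
    boundary weights can be attached at will. *)
Lemma model_bpar q x y n M h (Fm : (pt -> nat) -> \bar R) :
  (0 <= q < 1)%R -> (0 <= x < 1)%R -> (0 <= y < 1)%R -> (M <= n)%N ->
  (forall om, 0 <= Fm om) ->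
  (forall u, (u.1 == 0%N) || (u.2 == 0%N) -> const_in u Fm) ->
  (forall u, (M < u.1)%N -> const_in u Fm) ->
  expect (fun=> q) (box n h) Fm = expect (bpar x y q) (box M h) Fm.
Proof.
move=> hq hx hy Mn F0 Fax Ffar; have hp := bpar_ratio hx hy hq.
rewrite (@expect_shrink _ (fun=> q) M h n) //.
apply: expect_par_const => // u _; rewrite /bpar.
case: ifP => u2; first by right; apply: Fax; rewrite u2 orbT.
by case: ifP => u1; [right; apply: Fax; rewrite u1|left].
Qed.

Lemma stat_ratio q x : (0 < q)%R -> (q < x)%R -> (x < 1)%R ->
  [/\ (0 <= q < 1)%R, (0 <= x < 1)%R, (0 <= q / x < 1)%R & (x * (q / x) = q)%R].
Proof.
move=> q0 qx x1; have x0 : (0 < x)%R by rewrite (lt_trans q0).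
split; first by rewrite (ltW q0) (lt_trans qx).
- by rewrite (ltW x0).
- by rewrite divr_ge0 ?ltW // ltr_pdivrMr // mul1r.
- by field; rewrite gt_eqF.
Qed.

Lemma model_left q x n h c L F om : (0 < q)%R -> (q < x)%R -> (x < 1)%R ->
  (L <= c <= n)%N -> mono_upto L F -> (forall a, 0 <= F a <= 1) ->
  expect (fun=> q) (box n.+1 h) (fun om => F (fun l => ptincr h om (c - l))) om <=
  expect_iid x L F + errS q x (c - L).+1 h om.
Proof.
move=> q0 qx x1 /andP[Lc cn] mF F01.
have [hq hx hy e] := stat_ratio q0 qx x1.
have F0 a : 0 <= F a by case/andP: (F01 a).
rewrite (@model_bpar q x (q / x) n.+1 c.+1) //; last 2 first.
- by move=> u hu om' k; congr F; apply/funext => l; rewrite ptincr_upd_axis.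
- by move=> u hu om' k; congr F; apply/funext => l; rewrite ptincr_upd_far //; lia.
have := @left_increments R x (q / x) x (q / x) c h L c.+1 F _ (lexx x) x1 hy hy erefl Lc
  (ltnSn c) mF F01 om.
rewrite /errS e => h0; apply: le_trans (h0 _); last by case/andP: hx.
apply: le_expect; first exact: bpar_ratio.
by move=> om'; apply: mF => l lL; exact: dincr_T_le_H.
Qed.

Lemma model_right q x n h c L F om : (0 < q)%R -> (q < x)%R -> (x < 1)%R ->
  (c + L <= n)%N -> anti_upto L F -> (forall a, 0 <= F a <= 1) ->
  expect (fun=> q) (box n.+1 h) (fun om => F (fun l => ptincr h om (c + l).+1)) om <=
  expect_iid x L F + errW q x (c + L).+1 h om.
Proof.
move=> q0 qx x1 cn aF F01.
have [hq hx hy e] := stat_ratio q0 qx x1.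
have F0 a : 0 <= F a by case/andP: (F01 a).
have lF := anti_local aF.
rewrite (@model_bpar q x (q / x) n.+1 (c + L).+1) //; last 2 first.
- by move=> u hu om' k; congr F; apply/funext => l; rewrite ptincr_upd_axis.
- by move=> u hu om' k; apply: lF => l lL; rewrite ptincr_upd_far //; lia.
have := @joint_increments R x (q / x) c h 0 L (fun=> 1) F hx hy (leq0n _) _ aF _ F01 om.
rewrite e => h0; apply: le_trans (le_trans (h0 _ _) _).
- by rewrite le_eqVlt; apply/orP; left; apply/eqP; apply: eq_expect => w; rewrite mul1e.
- by [].
- by move=> _; rewrite lexx andbT.
- rewrite expect_indep //; last exact: bpar_ratio.
  by rewrite mul1e.
Qed.

(** The right side wants a vertical exit and uses the lower ratio [xW]; the left side wants a
    horizontal one and is raised to [xS]. The drift between the two ratios is the price for making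
    both exits likely. *)
Lemma model_joint q xS xW n h c L1 L2 F1 F2 om :
  (0 < q)%R -> (q < xW)%R -> (xW <= xS)%R -> (xS < 1)%R ->
  (L1 <= c)%N -> (c + L2 <= n)%N -> mono_upto L1 F1 -> anti_upto L2 F2 ->
  (forall a, 0 <= F1 a <= 1) -> (forall a, 0 <= F2 a <= 1) ->
  expect (fun=> q) (box n.+1 h) (fun om => F1 (fun l => ptincr h om (c - l)) *
     F2 (fun l => ptincr h om (c + l).+1)) om <=
  expect_iid xS L1 F1 * expect_iid xW L2 F2 +
  (errS q xS (c - L1).+1 h om + errW q xW (c + L2).+1 h om).
Proof.
move=> q0 qW WS S1 L1c cn mF1 aF2 F101 F201.
have W1 := le_lt_trans WS S1; have qS := lt_le_trans qW WS.
have [hq hW hWy eW] := stat_ratio q0 qW W1.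
have [_ hS hSy eS] := stat_ratio q0 qS S1.
have F10 a : 0 <= F1 a by case/andP: (F101 a).
have F20 a : 0 <= F2 a by case/andP: (F201 a).
have lF1 := mono_local mF1; have lF2 := anti_local aF2.
rewrite (@model_bpar q xW (q / xW) n.+1 (c + L2).+1) //; last 3 first.
- by move=> om'; rewrite mule_ge0.
- move=> u hu om' k; apply: congr2; [apply: lF1|apply: lF2] => l lL;
  by rewrite ptincr_upd_axis.
- move=> u hu om' k; apply: congr2; [apply: lF1|apply: lF2] => l lL;
  apply: ptincr_upd_far; move: u.1 hu => u1 hu; clear -hu lL L1c; lia.
have := @joint_increments R xW (q / xW) c h L1 L2 F1 F2 hW hWy L1c mF1 aF2 F101 F201 om.
rewrite eW => h0; apply: (le_trans h0).
have W0 : (0 <= xW)%R by case/andP: hW.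
have := @left_increments R xW (q / xW) xS (q / xS) c h L1 (c + L2).+1 F1 W0 WS S1 hWy hSy _ L1c
  _ mF1 F101 om.
rewrite eW eS => /(_ erefl) h1.
have cM : (c < (c + L2).+1)%N by rewrite ltnS leq_addr.
have := h1 cM; rewrite -/(errS q xS _ h om) => {}h1.
have E0 : 0 <= expect_iid xW L2 F2 by apply: expect_ge0.
have E1 : expect_iid xW L2 F2 <= 1 by apply: expect_le1 => // a; case/andP: (F201 a).
have S0 : 0 <= errS q xS (c - L1).+1 h om.
  apply: expect_ge0; first by apply: bpar_ratio.
  by move=> w; case/andP: (@ind01 R (lpp (zeroy w) h (c - L1).+1 <= lpp (zerox w) h (c - L1).+1)%N).
have ES0 : 0 <= expect_iid xS L1 F1 by apply: expect_ge0.
rewrite addeA leeD2r //.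
apply: (@le_trans _ _ ((expect_iid xS L1 F1 + errS q xS (c - L1).+1 h om) * expect_iid xW L2 F2)).
  by apply: lee_wpmul2r.
by rewrite ge0_muleDl // leeD2l // -[leRHS]mule1 lee_wpmul2l.
Qed.

End Model.

(** * Geodesics through an edge *)

Section Geodesics.
Local Open Scope nat_scope.

(** The shift makes room for the axes, empty here and filled with boundary weights in the
    comparisons. It also brings in the weight at the origin, which [lpp] leaves out. *)
Definition shift_env (om : pt -> nat) : pt -> nat :=
  fun u => if (u.1 == 0) || (u.2 == 0) then 0 else om (u.1.-1, u.2.-1).

Definition passage (om : pt -> nat) (i j : nat) : nat := lpp (shift_env om) j.+1 i.+1.

Lemma shift_env_axis om j : lpp (shift_env om) j 0 = 0 /\ lpp (shift_env om) 0 j = 0.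
Proof.
by split; elim: j => // j IH; rewrite ?lppS0 ?lpp0S IH /shift_env.
Qed.

Lemma passage_le om i j i' j' : dstep (i, j) (i', j') ->
  om (i', j') + passage om i j <= passage om i' j'.
Proof.
move=> /orP[] /eqP[-> ->] /=; rewrite [leqRHS]lppSS {2}/shift_env /=.
  by rewrite leq_add2l leq_maxl.
by rewrite leq_add2l leq_maxr.
Qed.

Lemma passage00 om : passage om 0 0 = om (0, 0).
Proof.
rewrite /passage lppSS.
by have [-> _] := shift_env_axis om 1; have [_ ->] := shift_env_axis om 1; rewrite addn0.
Qed.

Lemma passageS om i j : 0 < i + j -> exists i' j', [/\ dstep (i', j') (i, j),
  i' <= i, j' <= j, i' + j' < i + j & passage om i j = om (i, j) + passage om i' j'].
Proof.
move=> ij.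
have e : passage om i j = om (i, j) + maxn (lpp (shift_env om) j.+1 i) (lpp (shift_env om) j i.+1).
  by rewrite /passage lppSS.
case: (leqP (lpp (shift_env om) j.+1 i) (lpp (shift_env om) j i.+1)) => h.
- case: j ij e h => [|j] ij e h.
    case: i ij e h => // i _ e h; exists i, 0; split; rewrite ?addn0 //.
      by rewrite /dstep eqxx.
    rewrite e; congr addn; have [_ z] := shift_env_axis om i.+2.
    by rewrite /passage; lia.
  exists i, j; split; rewrite ?addnS //; first by rewrite /dstep /= eqxx orbT.
  by rewrite e /passage; lia.
- case: i ij e h => [|i] ij e h; first by have [z _] := shift_env_axis om j.+1; rewrite z in h.
  exists i, j; split; rewrite ?addSn //; first by rewrite /dstep /= eqxx.
  by rewrite e /passage; lia.
Qed.

Lemma pweight_cons om u x s : pweight om u (x :: s) = om u + pweight om x s.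
Proof. by rewrite /pweight big_cons. Qed.

Lemma pweight_cat om u s x t : pweight om u (s ++ x :: t) = pweight om u s + pweight om x t.
Proof. by rewrite /pweight -cat_cons big_cat. Qed.

Lemma pweight_nil om u : pweight om u [::] = om u.
Proof. by rewrite /pweight big_seq1. Qed.

Lemma pweight_rcons om u s x : pweight om u (rcons s x) = pweight om u s + om x.
Proof. by rewrite -cats1 pweight_cat pweight_nil. Qed.

Lemma dstep_le (x y : pt) : dstep x y -> (x.1 <= y.1) && (x.2 <= y.2).
Proof. by case: x y => a b [c d] /orP[] /eqP[-> ->] /=; lia. Qed.

Lemma dpath_le (s : seq pt) (u : pt) : path dstep u s -> (u.1 <= (last u s).1) && (u.2 <= (last u s).2).
Proof.
elim: s u => [|x s IH] u /=; first by rewrite !leqnn.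
by move=> /andP[/dstep_le/andP[h1 h2] /IH/andP[h3 h4]]; rewrite (leq_trans h1) ?(leq_trans h2).
Qed.

Lemma passage_ub om (s : seq pt) : path dstep (0, 0) s ->
  pweight om (0, 0) s <= passage om (last (0, 0) s).1 (last (0, 0) s).2.
Proof.
elim/last_ind: s => [|s x IH]; first by rewrite pweight_nil passage00.
rewrite rcons_path last_rcons pweight_rcons => /andP[/IH h1 h2].
move: (last _ s) h1 h2 => [a b] h1; case: x => c d /(passage_le om) h2.
by rewrite addnC (leq_trans _ h2) // leq_add2l.
Qed.

Lemma passage_path om i j : exists s, dpath (0, 0) (i, j) s /\ pweight om (0, 0) s = passage om i j.
Proof.
have [k] := ubnP (i + j); elim: k i j => // k IH i j ijk.
have [/eqP|ij] := posnP (i + j).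
  rewrite addn_eq0 => /andP[/eqP -> /eqP ->]; exists [::].
  by rewrite pweight_nil passage00.
have [i' [j' [st _ _ lt e]]] := passageS om ij.
have [|s [/andP[ps /eqP ls] ws]] := IH i' j'; first exact: leq_trans lt _.
exists (rcons s (i, j)); rewrite /dpath rcons_path last_rcons ps ls st eqxx.
by rewrite pweight_rcons ws e addnC.
Qed.

Definition rotate (n : nat) (om : pt -> nat) : pt -> nat := fun u => om (n - u.1, n - u.2).

Lemma rotate_ub om n (s : seq pt) u : path dstep u s -> last u s = (n, n) ->
  pweight om u s <= passage (rotate n om) (n - u.1) (n - u.2).
Proof.
elim: s u => [|x s IH] u /=.
  by move=> _ ->; rewrite pweight_nil subnn passage00 /rotate /= subn0.
move=> /andP[ux ps] ls; have := dpath_le ps; rewrite ls => /andP[/= x1 x2].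
rewrite pweight_cons; apply: (@leq_trans (om u + passage (rotate n om) (n - x.1) (n - x.2))).
  by rewrite leq_add2l IH.
have /andP[ux1 ux2] := dstep_le ux.
have -> : om u = rotate n om (n - u.1, n - u.2).
  by rewrite /rotate /= !subKn ?(leq_trans ux1) ?(leq_trans ux2) //; case: (u).
apply: passage_le; case: u x ux x1 x2 {ps ls ux1 ux2} => a b [c d] /orP[] /eqP[-> ->] /= h1 h2;
  rewrite /dstep /=; apply/orP; [left|right]; apply/eqP; congr pair; lia.
Qed.

Lemma rotate_path om n i j : i <= n -> j <= n ->
  exists s, dpath (i, j) (n, n) s /\ pweight om (i, j) s = passage (rotate n om) (n - i) (n - j).
Proof.
have [k] := ubnP ((n - i) + (n - j)); elim: k i j => // k IH i j ijk iln jn.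
have [/eqP|ij] := posnP ((n - i) + (n - j)).
  rewrite addn_eq0 => /andP[/eqP i0 /eqP j0]; exists [::].
  have -> : i = n by lia.
  have -> : j = n by lia.
  by rewrite /dpath /= eqxx pweight_nil subnn passage00 /rotate /= subn0.
have [i' [j' [st li lj lt e]]] := passageS (rotate n om) ij.
have a1 : n - (n - i') + (n - (n - j')) < k by lia.
have [s [/andP[ps /eqP ls] ws]] := IH _ _ a1 (leq_subr _ _) (leq_subr _ _).
exists ((n - i', n - j') :: s); rewrite /dpath /= ps ls eqxx andbT.
have e1 : n - (n - i') = i' by lia.
have e2 : n - (n - j') = j' by lia.
rewrite e1 e2 in ws.
split; last first.
  by rewrite pweight_cons ws e; congr addn; rewrite /rotate /= !subKn.
rewrite andbT; move: st => /orP[] /eqP[h1 h2]; rewrite /dstep /=; apply/orP; [left|right];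
  apply/eqP; congr pair; lia.
Qed.

(* The edge from [(c, r)] to [(c, r + 1)] maximises the passage time among all the edges
   joining row [r] to row [r + 1]. *)
Definition best_up (n : nat) (om : pt -> nat) (c r : nat) : bool :=
  all (fun i => passage om i r + passage (rotate n om) (n - i) (n - r.+1) <=
    passage om c r + passage (rotate n om) (n - c) (n - r.+1)) (iota 0 n.+1).

(** For every column [i], an optimal path to (i, r) followed by an optimal path from (i, r + 1)
    competes with the geodesic. *)
Lemma geodesic_up om n (c r : nat) s x t : geodesic om (0, 0) (n, n) (s ++ x :: t) ->
  last (0, 0) s = (c, r) -> x = (c, r.+1) -> r < n /\ best_up n om c r.
Proof.
move=> [/andP[]]; rewrite cat_path last_cat /= => /andP[ps /andP[_ pt]] /eqP lt hmax ls ex.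
have := dpath_le pt; rewrite lt ex => /andP[/= cn rn]; split => //.
apply/allP => i; rewrite mem_iota add0n ltnS => /andP[_ iln].
have [s1 [/andP[ps1 /eqP ls1] ws1]] := passage_path om i r.
have [s2 [/andP[ps2 /eqP ls2] ws2]] := rotate_path om iln rn.
have hd : dpath (0, 0) (n, n) (s1 ++ (i, r.+1) :: s2).
  by rewrite /dpath cat_path last_cat /= ps1 ls1 ps2 ls2 eqxx /dstep /= eqxx orbT.
have := hmax _ hd; rewrite !pweight_cat ws1 ws2 => h; apply: (leq_trans h).
apply: leq_add; first by have := passage_ub om ps; rewrite ls.
by have := rotate_ub om pt lt; rewrite ex.
Qed.

Lemma dpath_transpose u v s : dpath u v s -> dpath (transpose u) (transpose v) (map transpose s).
Proof.
move=> /andP[ps /eqP <-]; apply/andP; split; last by rewrite last_map.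
elim: s u ps => //= x s IH u /andP[ux ps]; rewrite IH // andbT.
case: u x ux {ps IH} => a b [c d] /orP[] /eqP[-> ->]; rewrite /dstep /transpose /= eqxx //.
by rewrite orbT.
Qed.

Lemma pweight_transpose om u s :
  pweight (om \o transpose) (transpose u) (map transpose s) = pweight om u s.
Proof.
rewrite /pweight -map_cons big_map; apply: eq_bigr => x _.
by rewrite /= transposeK.
Qed.

Lemma geodesic_transpose om n s : geodesic om (0, 0) (n, n) s ->
  geodesic (om \o transpose) (0, 0) (n, n) (map transpose s).
Proof.
move=> [ds hmax]; split; first exact: (dpath_transpose ds).
move=> s' ds'; rewrite -[(0, 0)]/(transpose (0, 0)) pweight_transpose.
have -> : s' = map transpose (map transpose s').
  by rewrite -map_comp map_id_in // => x _; exact: transposeK.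
by rewrite pweight_transpose; apply: hmax; exact: (dpath_transpose ds').
Qed.

Lemma in_geod_edge om n c r : in_geod om (0, 0) (n, n) (c, r) -> (c, r) != (n, n) ->
  (r < n /\ best_up n om c r) \/ (c < n /\ best_up n (om \o transpose) r c).
Proof.
move=> [s [gs ins]] ne.
case/splitPl: ins gs => p1 [|x p2] lp gs.
  case: gs => /andP[_]; rewrite cats0 lp => /eqP e.
  by rewrite e eqxx in ne.
have /andP[pp _] := gs.1; move: pp; rewrite cat_path lp /= => /andP[_ /andP[/orP[]/eqP ex _]].
  right; have := geodesic_transpose gs; rewrite map_cat /= => gs'.
  apply: (geodesic_up gs'); last by rewrite ex.
  by rewrite -[(0, 0)]/(transpose (0, 0)) last_map lp.
by left; apply: (geodesic_up gs).
Qed.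

Lemma telescope_left f c k : (forall i, f i <= f i.+1) -> k <= c ->
  \sum_(l < k) dincr f (c - l) = f c.+1 - f (c - k).+1.
Proof.
move=> fm; elim: k => [|k IH] kc; first by rewrite big_ord0 subn0 subnn.
have fm2 i j : i <= j -> f i <= f j.
  by move/subnK <-; elim: (j - i) => // m IHm; rewrite addSn (leq_trans IHm).
rewrite big_ord_recr /= IH 1?ltnW // /dincr.
have -> : (c - k.+1).+1 = c - k by lia.
by have := fm2 (c - k) (c - k).+1 (leqnSn _); have := fm2 (c - k).+1 c.+1; lia.
Qed.

Lemma telescope_right f c k : (forall i, f i <= f i.+1) ->
  \sum_(l < k) dincr f (c + l).+1 = f (c + k).+1 - f c.+1.
Proof.
move=> fm; elim: k => [|k IH]; first by rewrite big_ord0 addn0 subnn.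
have fm2 i j : i <= j -> f i <= f j.
  by move/subnK <-; elim: (j - i) => // m IHm; rewrite addSn (leq_trans IHm).
rewrite big_ord_recr /= IH /dincr addnS.
by have := fm (c + k).+1; have := fm2 c.+1 (c + k).+1; lia.
Qed.

End Geodesics.

(** * One-sided events at a best edge *)

Lemma shift_env_zero om : zerox (zeroy (shift_env om)) = shift_env om.
Proof.
apply/funext => -[a b]; rewrite /zerox /zeroy /shift_env /=.
by case: (b == 0%N); case: (a == 0%N).
Qed.

Section BestUp.
Local Open Scope nat_scope.

(** Comparing the edges in columns c and c - k gives the k-th partial sum inequality. After
    [shift_env], row r has index r + 1, and row r + 1 seen from (n, n) has index n - r. *)
Lemma best_up_left n om c r L : r < n -> best_up n om c r -> L <= c -> c <= n ->
  below 0 L (fun l => ptincr r.+1 (shift_env om) (c - l))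
    (fun l => ptincr (n - r) (shift_env (rotate n om)) (n - c + l).+1).
Proof.
move=> rn /allP hb Lc cn; apply/belowP => k kL.
have er : (n - r.+1).+1 = n - r by lia.
rewrite /ptincr !shift_env_zero add0n.
rewrite (telescope_right _ _ (lpp_leh _ _)) (telescope_left (lpp_leh _ _)) ?(leq_trans kL) //.
have := hb (c - k); rewrite mem_iota /passage er.
have -> : n - (c - k) = n - c + k by lia.
have cn' : 0 <= c - k < 0 + n.+1 by lia.
move=> /(_ cn').
have fm (f : nat -> nat) : (forall i, f i <= f i.+1) -> forall i j, i <= j -> f i <= f j.
  move=> h i j /subnK <-; elim: (j - i) => // m IHm; rewrite addSn (leq_trans IHm) //.
have := fm _ (lpp_leh (shift_env om) r.+1) (c - k).+1 c.+1.
have := fm _ (lpp_leh (shift_env (rotate n om)) (n - r)) (n - c).+1 (n - c + k).+1.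
lia.
Qed.

Lemma best_up_right n om c r L : r < n -> best_up n om c r -> c <= n -> L <= n - c ->
  below 0 L (fun l => ptincr (n - r) (shift_env (rotate n om)) (n - c - l))
    (fun l => ptincr r.+1 (shift_env om) (c + l).+1).
Proof.
move=> rn /allP hb cn Lc; apply/belowP => k kL.
have er : (n - r.+1).+1 = n - r by lia.
rewrite /ptincr !shift_env_zero add0n.
rewrite (telescope_right _ _ (lpp_leh _ _)) (telescope_left (lpp_leh _ _)) ?(leq_trans kL) //.
have := hb (c + k); rewrite mem_iota /passage er.
have -> : n - (c + k) = n - c - k by lia.
have cn' : 0 <= c + k < 0 + n.+1 by lia.
move=> /(_ cn').
have fm (f : nat -> nat) : (forall i, f i <= f i.+1) -> forall i j, i <= j -> f i <= f j.
  move=> h i j /subnK <-; elim: (j - i) => // m IHm; rewrite addSn (leq_trans IHm) //.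
have := fm _ (lpp_leh (shift_env om) r.+1) c.+1 (c + k).+1.
have := fm _ (lpp_leh (shift_env (rotate n om)) (n - r)) (n - c - k).+1 (n - c).+1.
lia.
Qed.

End BestUp.

Lemma ptincr_local h a b i :
  (forall u, (0 < u.1 <= i.+1)%N -> (0 < u.2 <= h)%N -> a u = b u) -> ptincr h a i = ptincr h b i.
Proof.
move=> ab; rewrite /ptincr /dincr.
have e j : (j <= i.+1)%N -> lpp (zerox (zeroy a)) h j = lpp (zerox (zeroy b)) h j.
  move=> ji; apply: lpp_local => c d cj dh; rewrite /zerox /zeroy /=.
  case: eqP => // d0; case: eqP => // c0; apply: ab => /=; lia.
by rewrite !e.
Qed.

(** * From the law on the box to two independent halves *)

Section Measure.
Context {R : realType}.

Lemma ge0_esumZl (T : choiceType) (S : set T) (c : R) (a : T -> \bar R) : (0 <= c)%R ->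
  (forall i, 0 <= a i) -> \esum_(i in S) (c%:E * a i) = c%:E * \esum_(i in S) a i.
Proof.
move=> c0 a0; rewrite /esum -ereal_supZl //; last first.
  by apply/set0P; exists 0; exists set0; [exact: fsets_set0|rewrite fsbig_set0].
congr ereal_sup; rewrite image_comp /=; apply: eq_imagel => A _ /=.
by rewrite ge0_mule_fsumr.
Qed.

(** Iterated sums become one sum over configurations, the form in which [geom_prob] is defined. *)
Lemma expect_esum (T : finType) (r : R) (l : seq T) (F : (T -> nat) -> \bar R) om :
  (0 <= r < 1)%R -> (forall a, 0 <= F a) -> uniq l ->
  expect (fun=> r) l F om =
  \esum_(w in [set w : {ffun T -> nat} | forall x, x \notin l -> w x = om x])
     ((\prod_(x <- l) ((1 - r) * r ^+ w x))%:E * F w).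
Proof.
move=> hr F0; have w0 k : (0 <= (1 - r) * r ^+ k)%R by rewrite -lee_fin gweight_ge0.
elim: l om => [|x l IH] om /=.
  move=> _; rewrite (_ : [set _ | _] = [set [ffun x => om x]]); last first.
    apply/seteqP; split => [w h|_ -> y _]; last by rewrite ffunE.
    by apply/ffunP => y; rewrite ffunE; apply: h.
  rewrite esum_set1 ?big_nil ?mul1e //.
  by rewrite /expect /=; congr F; apply/funext => y; rewrite ffunE.
move=> /andP[xl ul]; rewrite expect_cons /gsum.
pose J k := [set w : {ffun T -> nat} | forall y, y \notin l -> w y = upd om x k y].
pose a (w : {ffun T -> nat}) := (\prod_(y <- x :: l) ((1 - r) * r ^+ w y))%:E * F w.
have a0 w : 0 <= a w by rewrite mule_ge0 // lee_fin prodr_ge0.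
transitivity (\esum_(k in [set: nat]) \esum_(w in J k) a w).
  apply: eq_esum => k _; rewrite IH //.
  rewrite -ge0_esumZl ?w0 // => [|w]; last by rewrite mule_ge0 // lee_fin prodr_ge0.
  apply: eq_esum => w Jw; rewrite muleA -EFinM /a big_cons.
  by have -> : w x = k by rewrite (Jw x xl) upd_at.
rewrite -esum_bigcupT //; last first.
  by move=> k k' _ _ [w [Jw Jw']]; have := Jw x xl; rewrite (Jw' x xl) !upd_at.
congr esum; apply/seteqP; split => [w [k _ Jw] y|w hw].
  by rewrite inE negb_or => /andP[yx yl]; rewrite (Jw y yl) upd_neq.
exists (w x) => // y yl; rewrite /upd; case: eqP => [->//|/eqP yx].
by apply: hw; rewrite inE negb_or yx.
Qed.

Lemma perm_box_ord n : perm_eq (map (fun x : 'I_n.+1 * 'I_n.+1 => (val x.1, val x.2) : pt)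
  (enum {: 'I_n.+1 * 'I_n.+1})) (box n n).
Proof.
apply: uniq_perm; rewrite ?uniq_box //.
  by rewrite map_inj_uniq ?enum_uniq // => -[a b] [c d] [/val_inj -> /val_inj ->].
move=> [a b]; rewrite mem_box /=; apply/mapP/andP => [[[i j] _ [-> ->]]|[ha hb]].
  by rewrite -ltnS ltn_ord -ltnS ltn_ord.
exists (Ordinal (m := a) (n := n.+1) ha, Ordinal (m := b) (n := n.+1) hb) => //.
by rewrite mem_enum.
Qed.

Lemma geom_prob_expect (p : R) n (E : config n -> Prop) (B : (pt -> nat) -> bool) :
  (0 < p)%R -> (p < 1)%R -> (forall w, E w -> B (env w)) ->
  (forall a b, (forall u, (u.1 <= n)%N -> (u.2 <= n)%N -> a u = b u) -> B a = B b) ->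
  geom_prob p E <= expect (fun=> 1 - p)%R (box n n) (fun om => ind (B om)) (fun=> 0%N).
Proof.
move=> p0 p1 EB locB.
have hr : (0 <= 1 - p < 1)%R by rewrite subr_ge0 ltW //= gtrBl.
pose h (x : 'I_n.+1 * 'I_n.+1) : pt := (val x.1, val x.2).
pose F (f : 'I_n.+1 * 'I_n.+1 -> nat) : \bar R := ind (B (env (finfun f))).
have i0 b : 0 <= ind b :> \bar R by case/andP: (@ind01 R b).
have F0 a : 0 <= F a by exact: i0.
have hinj : {in predT &, injective h} by move=> [a b] [c d] _ _ [/val_inj -> /val_inj ->].
rewrite (@expect_perm _ _ (fun=> 1 - p)%R (fun=> hr) _ (map h (enum {: 'I_n.+1 * 'I_n.+1}))) //; last first.
  by rewrite perm_sym perm_box_ord.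
have -> : (fun om => ind (B om)) = (fun om => F (om \o h)) :> ((pt -> nat) -> \bar R).
  apply/funext => om; rewrite /F; congr ind; apply: locB => -[a b] /= an bn.
  by rewrite /env ffunE /h /= !inordK.
rewrite (@expect_rename _ _ _ h (fun=> 1 - p)%R predT) //; last first.
  by move=> a b ab; congr F; apply/funext => x; exact: ab.
rewrite expect_esum ?enum_uniq // /geom_prob.
rewrite [X in _ <= esum X _](_ : _ = setT); last first.
  by apply/seteqP; split => // w _ x; rewrite mem_enum.
rewrite [leLHS]esum_mkcond.
have pr0 (w : config n) : (0 <= \prod_x (p * (1 - p) ^+ w x))%R.
  by apply: prodr_ge0 => x _; rewrite mulr_ge0 ?exprn_ge0 ?subr_ge0 // ltW.
apply: le_esum => w _.
have -> : (\prod_(x <- enum {: 'I_n.+1 * 'I_n.+1}) ((1 - (1 - p)) * (1 - p) ^+ w x) =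
          \prod_x (p * (1 - p) ^+ w x))%R.
  by rewrite big_enum; apply: eq_bigr => x _; rewrite opprB addrC subrK.
have -> : F w = ind (B (env w)).
  by rewrite /F; congr ind; congr B; apply/funext => u; rewrite /env ffunE.
case: ifP => [/set_mem /= /EB ->|_]; first by rewrite /ind mule1.
by rewrite mule_ge0 // lee_fin.
Qed.

Lemma expect_agree {K : eqType} (par : K -> R) l (F G : (K -> nat) -> \bar R) om0 :
  (forall om, (forall u, u \notin l -> om u = om0 u) -> F om = G om) ->
  expect par l F om0 = expect par l G om0.
Proof.
elim: l om0 => [|x l IH] om0 h; first exact: h.
rewrite !expect_cons; apply: eq_gsum => k; apply: IH => om hom; apply: h => u.
by rewrite inE negb_or => /andP[ux ul]; rewrite hom // upd_neq.
Qed.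

Definition bulk (n h : nat) : seq pt := [seq u <- box n h | (0 < u.1)%N && (0 < u.2)%N].

Lemma mem_bulk n h u : (u \in bulk n h) = (0 < u.1 <= n)%N && (0 < u.2 <= h)%N.
Proof. by rewrite mem_filter mem_box; case: u => a b /=; apply/idP/idP; lia. Qed.

Lemma uniq_bulk n h : uniq (bulk n h).
Proof. exact/filter_uniq/uniq_box. Qed.

Lemma expect_bulk (q : R) n h (F : (pt -> nat) -> \bar R) : (0 <= q < 1)%R ->
  (forall om, 0 <= F om) ->
  (forall u, (u.1 == 0%N) || (u.2 == 0%N) -> const_in u F) ->
  expect (fun=> q) (box n h) F = expect (fun=> q) (bulk n h) F.
Proof.
move=> hq F0 hF; apply: expect_filter => // u _ hu; apply: hF.
by move: hu; rewrite negb_and -!leqNgt !leqn0.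
Qed.

(** [unshift] and [unrotate] tell where the shifted environment, respectively the rotated and
    shifted one, reads its bulk weights. Cut at row [r], the two images partition the box, see
    [perm_box_rows]. *)
Definition unshift (u : pt) : pt := (u.1.-1, u.2.-1).
Definition unrotate (n : nat) (u : pt) : pt := (n - u.1.-1, n - u.2.-1)%N.

Lemma unshift_inj n h : {in mem (bulk n h) &, injective unshift}.
Proof.
move=> [a b] [c d]; rewrite /= !mem_bulk /= => h1 h2 [] e1 e2.
by congr pair; lia.
Qed.

Lemma unrotate_inj n h : (h <= n)%N -> {in mem (bulk n.+1 h) &, injective (unrotate n)}.
Proof.
move=> hn [a b] [c d]; rewrite /= !mem_bulk /= => h1 h2 [] e1 e2.
by congr pair; lia.
Qed.

Lemma perm_box_rows n r : (r < n)%N ->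
  perm_eq (box n n) (map unshift (bulk n.+1 r.+1) ++ map (unrotate n) (bulk n.+1 (n - r))).
Proof.
move=> rn; apply: uniq_perm; first exact: uniq_box.
  rewrite cat_uniq !map_inj_in_uniq ?uniq_bulk ?andbT /=; last 2 first.
  - exact: unrotate_inj (leq_subr _ _).
  - exact: unshift_inj.
  apply/hasPn => u /mapP[[a b]]; rewrite mem_bulk /= => h1 ->.
  by apply/mapP => -[[c d]]; rewrite mem_bulk /= => h2 [] e1 e2; lia.
move=> [a b]; rewrite mem_box mem_cat /=; apply/andP/orP => [[an bn]|].
  case: (leqP b r) => br; [left|right]; apply/mapP.
    by exists (a.+1, b.+1) => //; rewrite mem_bulk /=; lia.
  exists ((n - a).+1, (n - b).+1); first by rewrite mem_bulk /=; lia.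
  by rewrite /unrotate /=; congr pair; lia.
by case=> /mapP[[c d]]; rewrite mem_bulk /= => h [-> ->]; lia.
Qed.

Lemma split_rows (q : R) n r (Psi : (nat -> nat) -> (nat -> nat) -> \bar R) :
  (0 <= q < 1)%R -> (r < n)%N -> (forall f g, 0 <= Psi f g) ->
  (forall f f' g g', (forall i, (i <= n)%N -> f i = f' i) ->
     (forall i, (i <= n)%N -> g i = g' i) -> Psi f g = Psi f' g') ->
  expect (fun=> q) (box n n) (fun om =>
    Psi (ptincr r.+1 (shift_env om)) (ptincr (n - r) (shift_env (rotate n om)))) (fun=> 0%N) =
  expect (fun=> q) (box n.+1 r.+1) (fun a => expect (fun=> q) (box n.+1 (n - r)) (fun b =>
    Psi (ptincr r.+1 a) (ptincr (n - r) b)) (fun=> 0%N)) (fun=> 0%N).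
Proof.
move=> hq rn P0 locP.
have hp (u : pt) : (0 <= q < 1)%R by [].
have ptA a i : (i <= n)%N -> ptincr r.+1 (shift_env a) i = ptincr r.+1 (a \o unshift) i.
  move=> iN; apply: ptincr_local => -[c d] /= hc hd.
  by rewrite /shift_env /= ifF // ; lia.
have ptB a i : (i <= n)%N ->
    ptincr (n - r) (shift_env (rotate n a)) i = ptincr (n - r) (a \o unrotate n) i.
  move=> iN; apply: ptincr_local => -[c d] /= hc hd.
  by rewrite /shift_env /= ifF // ; lia.
have Bloc f : forall b b', {in mem (bulk n.+1 (n - r)), b =1 b'} ->
    Psi f (ptincr (n - r) b) = Psi f (ptincr (n - r) b').
  move=> b b' bb; apply: locP => // i iN; apply: ptincr_local => -[c d] /= h1 h2.
  by apply: bb; rewrite /= mem_bulk /=; lia.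
have IB := @unrotate_inj n (n - r) (leq_subr r n).
have Binner f om0 : expect (fun=> q) (map (unrotate n) (bulk n.+1 (n - r)))
    (fun om => Psi f (ptincr (n - r) (om \o unrotate n))) om0 =
    expect (fun=> q) (box n.+1 (n - r)) (fun b => Psi f (ptincr (n - r) b)) (fun=> 0%N).
  rewrite (@expect_rename _ _ _ (unrotate n) (fun=> q) (mem (bulk n.+1 (n - r)))
    (bulk n.+1 (n - r)) (fun b => Psi f (ptincr (n - r) b)) _ IB (Bloc f)) //.
  rewrite expect_bulk //; last first.
    move=> u hu om k; apply: locP => // i iN; exact: ptincr_upd_axis.
  by apply: expect_local (Bloc f) _ => u /= ->.
rewrite (expect_perm hp _ (perm_box_rows rn)) // expect_cat.
pose G (a : pt -> nat) := expect (fun=> q) (box n.+1 (n - r)) (fun b =>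
    Psi (ptincr r.+1 a) (ptincr (n - r) b)) (fun=> 0%N).
have locG : forall a a', {in mem (bulk n.+1 r.+1), a =1 a'} -> G a = G a'.
  move=> a a' aa; apply: eq_expect => b; apply: locP => // i iN; apply: ptincr_local => -[c d] /= h1 h2.
  by apply: aa; rewrite /= mem_bulk /=; lia.
transitivity (expect (fun=> q) (map unshift (bulk n.+1 r.+1)) (fun om => G (om \o unshift)) (fun=> 0%N)).
  apply: eq_expect => om0; rewrite /G -(Binner _ om0).
  apply: expect_agree => om hom; apply: locP => i iN; last exact: ptB.
  rewrite ptA //; apply: ptincr_local => -[c d] /= hc hd.
  apply: hom; apply/mapP => -[[c' d']]; rewrite mem_bulk /= => h [] e1 e2; lia.
have G0 a : 0 <= G a by apply: expect_ge0.
rewrite (@expect_rename _ _ _ unshift (fun=> q) (mem (bulk n.+1 r.+1)) (bulk n.+1 r.+1) G _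
  (@unshift_inj n.+1 r.+1) locG) //.
rewrite -[RHS]/(expect (fun=> q) (box n.+1 r.+1) G (fun=> 0%N)) (@expect_bulk q _ _ G) //; last first.
  by move=> u hu om k; apply: eq_expect => b; apply: locP => // i iN; exact: ptincr_upd_axis.
Qed.

End Measure.

Lemma window_right n c l L : (c <= n)%N -> (L <= c)%N -> (l < L)%N -> ((n - c + l).+1 <= n)%N.
Proof. by lia. Qed.

Lemma window_right' n c l L : (L <= n - c)%N -> (l < L)%N -> ((c + l).+1 <= n)%N.
Proof. by lia. Qed.

Lemma below_ext d L (a b a' b' : nat -> nat) : (forall l, (l < L)%N -> a l = a' l) ->
  (forall l, (l < L)%N -> b l = b' l) -> below d L a b = below d L a' b'.
Proof.
by move=> ha hb; apply/idP/idP; apply: below_le => l lL; rewrite ?ha ?hb.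
Qed.

(** * Bounds for one upward edge *)

Section UpBounds.
Context {R : realType}.
Implicit Types (q x : R).

(* For [r < n] this bounds the probability that some geodesic uses the edge from [(c, r)] to
   [(c, r + 1)], see [in_geod_edge]. *)
Definition prob_up (q : R) (n c r : nat) : \bar R :=
  expect (fun=> q) (box n n) (fun om => ind (best_up n om c r)) (fun=> 0%N).

Lemma ind_le (a b : bool) : (a -> b) -> ind a <= ind b :> \bar R.
Proof. by case: a b => [] [] // h; rewrite lee_fin ?ler01 //; have := h isT. Qed.

Lemma ind_ge0 (b : bool) : 0 <= ind b :> \bar R.
Proof. by case/andP: (@ind01 R b). Qed.

Lemma ind_le1 (b : bool) : ind b <= 1 :> \bar R.
Proof. by case/andP: (@ind01 R b). Qed.

Lemma ind_andb (a b : bool) : ind (a && b) = ind a * ind b :> \bar R.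
Proof. by rewrite /ind -EFinM; case: a b => [] []; rewrite /= ?mulr1 ?mulr0. Qed.

Lemma expect_addc {K : eqType} (par : K -> R) l (F : (K -> nat) -> \bar R) c om :
  (forall u, (0 <= par u < 1)%R) -> (forall a, 0 <= F a) -> 0 <= c ->
  expect par l (fun a => F a + c) om = expect par l F om + c.
Proof. by move=> hp F0 c0; rewrite expectD // (expect_indep hp (F := fun=> c)). Qed.

Lemma errS_ge0 q x m h om : (0 < q)%R -> (q < x)%R -> (x < 1)%R -> 0 <= errS q x m h om.
Proof.
move=> q0 qx x1; have [hq hx hy _] := stat_ratio q0 qx x1.
by apply: expect_ge0; [exact: bpar_ratio|move=> w; exact: ind_ge0].
Qed.

Lemma errW_ge0 q x m h om : (0 < q)%R -> (q < x)%R -> (x < 1)%R -> 0 <= errW q x m h om.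
Proof.
move=> q0 qx x1; have [hq hx hy _] := stat_ratio q0 qx x1.
by apply: expect_ge0; [exact: bpar_ratio|move=> w; exact: ind_ge0].
Qed.

Lemma expect_iid01 r L (F : (nat -> nat) -> \bar R) : (0 <= r < 1)%R ->
  (forall a, 0 <= F a <= 1) -> 0 <= expect_iid r L F <= 1.
Proof.
move=> hr F01; apply/andP; split.
  by apply: expect_ge0 => // a; case/andP: (F01 a).
by apply: expect_le1 => // a; case/andP: (F01 a).
Qed.

Lemma below_mono L b : mono_upto L (fun a => ind (below 0 L a b) : \bar R).
Proof. by move=> a a' aa; apply: ind_le; apply: below_le. Qed.

Lemma below_anti L a : anti_upto L (fun b => ind (below 0 L a b) : \bar R).
Proof. by move=> b b' bb; apply: ind_le; apply: below_le. Qed.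

(** [A] refers to the half below the edge and [B] to the rotated half above it. Left increments of
    [A] are dominated by ratio [xA], and right increments of [B] dominate ratio [xB], up to one exit
    error each. *)
Lemma up_left q xA xB n c r L : (0 < q)%R -> (q < xA)%R -> (xA < 1)%R ->
  (q < xB)%R -> (xB < 1)%R -> (r < n)%N -> (c <= n)%N -> (L <= c)%N ->
  prob_up q n c r <= walk xA xB L 0 +
    (errS q xA (c - L).+1 r.+1 (fun=> 0%N) + errW q xB (n - c + L).+1 (n - r) (fun=> 0%N)).
Proof.
move=> q0 qA A1 qB B1 rn cn Lc.
have [hq hA _ _] := stat_ratio q0 qA A1; have [_ hB _ _] := stat_ratio q0 qB B1.
pose Psi (f g : nat -> nat) : \bar R :=
  ind (below 0 L (fun l => f (c - l)%N) (fun l => g (n - c + l).+1)).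
apply: (@le_trans _ _ (expect (fun=> q) (box n n) (fun om =>
    Psi (ptincr r.+1 (shift_env om)) (ptincr (n - r) (shift_env (rotate n om)))) (fun=> 0%N))).
  by apply: le_expect => // om; apply: ind_le => h; exact: best_up_left.
rewrite split_rows //; [|by move=> f g; exact: ind_ge0|]; last first.
  move=> f f' g g' ff gg; congr ind; apply: below_ext => l lL.
    by apply: ff; rewrite (leq_trans (leq_subr _ _)).
  by apply: gg; exact: window_right lL.
have e0 := errW_ge0 (n - c + L).+1 (n - r) (fun=> 0%N) q0 qB B1.
pose G (a : nat -> nat) := expect_iid xB L (fun b => ind (below 0 L a b) : \bar R).
have G01 a : 0 <= G a <= 1 by apply: expect_iid01 => // b; exact: ind01.
apply: (@le_trans _ _ (expect (fun=> q) (box n.+1 r.+1) (fun a =>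
    G (fun l => ptincr r.+1 a (c - l)) + errW q xB (n - c + L).+1 (n - r) (fun=> 0%N)) (fun=> 0%N))).
  apply: le_expect => // a.
  have h0 : (n - c + L <= n)%N by rewrite -leq_subRL ?leq_subr // subKn.
  exact: (@model_right R q xB n (n - r) (n - c) L _ (fun=> 0%N) q0 qB B1 h0
    (below_anti _) (fun b => ind01 _)).
rewrite expect_addc //; last by move=> a; case/andP: (G01 (fun l => ptincr r.+1 a (c - l))).
rewrite addeA leeD2r // -expect_below //.
have h0 : (L <= c <= n)%N by rewrite Lc.
have mG : mono_upto L G by move=> a a' aa; apply: le_expect => // b; exact: below_mono.
exact: (@model_left R q xA n r.+1 c L G (fun=> 0%N) q0 qA A1 h0
  mG G01).
Qed.

Lemma up_right q xA xB n c r L : (0 < q)%R -> (q < xA)%R -> (xA < 1)%R ->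
  (q < xB)%R -> (xB < 1)%R -> (r < n)%N -> (c <= n)%N -> (L <= n - c)%N ->
  prob_up q n c r <= walk xB xA L 0 +
    (errW q xA (c + L).+1 r.+1 (fun=> 0%N) + errS q xB (n - c - L).+1 (n - r) (fun=> 0%N)).
Proof.
move=> q0 qA A1 qB B1 rn cn Lc.
have [hq hA _ _] := stat_ratio q0 qA A1; have [_ hB _ _] := stat_ratio q0 qB B1.
pose Psi (f g : nat -> nat) : \bar R :=
  ind (below 0 L (fun l => g (n - c - l)%N) (fun l => f (c + l).+1)).
apply: (@le_trans _ _ (expect (fun=> q) (box n n) (fun om =>
    Psi (ptincr r.+1 (shift_env om)) (ptincr (n - r) (shift_env (rotate n om)))) (fun=> 0%N))).
  by apply: le_expect => // om; apply: ind_le => h; exact: best_up_right.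
rewrite split_rows //; [|by move=> f g; exact: ind_ge0|]; last first.
  move=> f f' g g' ff gg; congr ind; apply: below_ext => l lL.
    by apply: gg; rewrite (leq_trans (leq_subr _ _)) // leq_subr.
  by apply: ff; exact: window_right' lL.
have e0 := errS_ge0 (n - c - L).+1 (n - r) (fun=> 0%N) q0 qB B1.
pose G (a : nat -> nat) := expect_iid xB L (fun b => ind (below 0 L b a) : \bar R).
have G01 a : 0 <= G a <= 1 by apply: expect_iid01 => // b; exact: ind01.
apply: (@le_trans _ _ (expect (fun=> q) (box n.+1 r.+1) (fun a =>
    G (fun l => ptincr r.+1 a (c + l).+1) + errS q xB (n - c - L).+1 (n - r) (fun=> 0%N)) (fun=> 0%N))).
  apply: le_expect => // a.
  have h0 : (L <= n - c <= n)%N by rewrite Lc leq_subr.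
  exact: (@model_left R q xB n (n - r) (n - c) L _ (fun=> 0%N) q0 qB B1 h0
    (below_mono _) (fun b => ind01 _)).
rewrite expect_addc //; last by move=> a; case/andP: (G01 (fun l => ptincr r.+1 a (c + l).+1)).
rewrite addeA leeD2r // -expect_below //.
rewrite [X in _ <= X + _](_ : _ = expect_iid xA L G); last first.
  by rewrite /G /expect_iid [LHS]expect_expect // => a b; exact: ind_ge0.
have h0 : (c + L <= n)%N by rewrite -leq_subRL.
have aG : anti_upto L G by move=> a a' aa; apply: le_expect => // b; exact: below_anti.
exact: (@model_right R q xA n r.+1 c L G (fun=> 0%N) q0 qA A1 h0
  aG G01).
Qed.

(** [model_joint] is applied to the upper half with the lower one frozen. What remains is again a
    product of a monotone functional of left increments and an antitone one of right increments, so
    it applies once more to the lower half. *)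
Lemma up_joint q xS xW n c r L : (0 < q)%R -> (q < xW)%R -> (xW <= xS)%R -> (xS < 1)%R ->
  (r < n)%N -> (c <= n)%N -> (L <= c)%N -> (L <= n - c)%N ->
  prob_up q n c r <= walk xS xW L 0 * walk xS xW L 0 +
    ((errS q xS (c - L).+1 r.+1 (fun=> 0%N) + errW q xW (c + L).+1 r.+1 (fun=> 0%N)) +
     (errS q xS (n - c - L).+1 (n - r) (fun=> 0%N) +
      errW q xW (n - c + L).+1 (n - r) (fun=> 0%N))).
Proof.
move=> q0 qW WS S1 rn cn Lc Lc'.
have W1 := le_lt_trans WS S1; have qS := lt_le_trans qW WS.
have [hq hS _ _] := stat_ratio q0 qS S1; have [_ hW _ _] := stat_ratio q0 qW W1.
pose Psi (f g : nat -> nat) : \bar R :=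
  ind (below 0 L (fun l => g (n - c - l)%N) (fun l => f (c + l).+1)) *
  ind (below 0 L (fun l => f (c - l)%N) (fun l => g (n - c + l).+1)).
have Psi0 f g : 0 <= Psi f g by rewrite mule_ge0 ?ind_ge0.
apply: (@le_trans _ _ (expect (fun=> q) (box n n) (fun om =>
    Psi (ptincr r.+1 (shift_env om)) (ptincr (n - r) (shift_env (rotate n om)))) (fun=> 0%N))).
  apply: le_expect => // om; rewrite /Psi -ind_andb; apply: ind_le => h.
  by apply/andP; split; [exact: best_up_right|exact: best_up_left].
rewrite split_rows //; last first.
  move=> f f' g g' ff gg; apply: (congr2 (fun a b : \bar R => a * b));
    apply: (congr1 ind); apply: below_ext => l lL.
  - by apply: gg; rewrite (leq_trans (leq_subr _ _)) // leq_subr.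
  - by apply: ff; exact: window_right' lL.
  - by apply: ff; rewrite (leq_trans (leq_subr _ _)).
  - by apply: gg; exact: window_right lL.
set eA := (errS _ _ _ r.+1 _ + _); set eB := (errS _ _ _ (n - r) _ + _).
have eA0 : 0 <= eA.
  by rewrite /eA; apply: adde_ge0; [exact: errS_ge0|exact: errW_ge0].
have eB0 : 0 <= eB.
  by rewrite /eB; apply: adde_ge0; [exact: errS_ge0|exact: errW_ge0].
pose G1 (a : nat -> nat) := expect_iid xW L (fun b => ind (below 0 L a b) : \bar R).
pose G2 (a : nat -> nat) := expect_iid xS L (fun b => ind (below 0 L b a) : \bar R).
have G101 a : 0 <= G1 a <= 1 by apply: expect_iid01 => // b; exact: ind01.
have G201 a : 0 <= G2 a <= 1 by apply: expect_iid01 => // b; exact: ind01.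
pose PA (a : pt -> nat) := G1 (fun l => ptincr r.+1 a (c - l)) * G2 (fun l => ptincr r.+1 a (c + l).+1).
have PA0 a : 0 <= PA a.
  rewrite /PA mule_ge0 //; first by case/andP: (G101 (fun l => ptincr r.+1 a (c - l))).
  by case/andP: (G201 (fun l => ptincr r.+1 a (c + l).+1)).
apply: (@le_trans _ _ (expect (fun=> q) (box n.+1 r.+1) (fun a => PA a + eB) (fun=> 0%N))).
  apply: le_expect => // a; rewrite /PA muleC.
  have h0 : (n - c + L <= n)%N by rewrite -leq_subRL ?leq_subr // subKn.
  exact: (@model_joint R q xS xW n (n - r) (n - c) L L _ _ (fun=> 0%N) q0 qW WS S1 Lc' h0
    (below_mono _) (below_anti _) (fun b => ind01 _) (fun b => ind01 _)).
rewrite expect_addc // [leRHS]addeA leeD2r //.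
have -> : walk xS xW L 0 * walk xS xW L 0 = expect_iid xS L G1 * expect_iid xW L G2.
  congr (_ * _); first by rewrite -expect_below.
  rewrite -expect_below // /G2 /expect_iid [RHS]expect_expect //.
  by move=> a b; exact: ind_ge0.
have h0 : (c + L <= n)%N by rewrite -leq_subRL.
have mG : mono_upto L G1 by move=> a a' aa; apply: le_expect => // b; exact: below_mono.
have aG : anti_upto L G2 by move=> a a' aa; apply: le_expect => // b; exact: below_anti.
exact: (@model_joint R q xS xW n r.+1 c L L G1 G2 (fun=> 0%N) q0 qW WS S1 Lc h0
  mG aG
  G101 G201).
Qed.

End UpBounds.

(** * Exponents of the exit estimates *)

Section Exponents.
Local Open Scope ring_scope.
Context {R : realType}.
Implicit Types (s k a b : R).

(** With t = 1 + k, the ratios s t^2 and s / t^2 make [gphi] exceed [gpsi] by a factor of at least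
    t^2. The aspect ratio may consume one factor t; the other leaves a gap of order k b, and [tgap]
    contributes k^2. *)
Lemma good_exponent s k a b : 0 < s -> 0 < k <= 1 -> s * (1 + k) ^+ 2 < 1 -> 0 <= a -> 0 <= b ->
  a <= b * (1 + k) ->
  tgap (1 + k) / 2 * (a * gpsi (1 + k) (s / (1 + k) ^+ 2) - b * gphi (1 + k) (s * (1 + k) ^+ 2))
  <= - (s / 4 * k ^+ 3 * b).
Proof.
move=> s0 /andP[k0 k1] st a0 b0 ab.
set t := 1 + k; have t1 : 1 < t by rewrite /t; lra.
have t0 : 0 < t by lra. have t2 : t <= 2 by rewrite /t; lra.
have tt : t <= t ^+ 2 by rewrite ler_eXnr // ltW.
have s1t : s * t < 1 by apply: le_lt_trans st; rewrite ler_pM2l.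
have s1 : s < 1 by apply: le_lt_trans s1t; rewrite ler_pMr // ltW.
have epsi : gpsi t (s / t ^+ 2) = s / t / ((1 - s) * (1 - s / t ^+ 2)).
  rewrite /gpsi; have -> : s / t ^+ 2 * t ^+ 2 = s by rewrite divfK // expf_neq0 // gt_eqF.
  by congr (_ / _); field; rewrite gt_eqF.
have ephi : gphi t (s * t ^+ 2) = s * t / (1 - s * t) ^+ 2.
  by rewrite /gphi; have -> : s * t ^+ 2 / t = s * t by field; rewrite gt_eqF.
pose p0 := s / t / (1 - s) ^+ 2.
have d1 : 0 < (1 - s) ^+ 2 by rewrite exprn_gt0 // subr_gt0.
have st0 : 0 < s / t by rewrite divr_gt0.
have p00 : 0 < p0 by rewrite divr_gt0.
have le1 : gpsi t (s / t ^+ 2) <= p0.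
  rewrite epsi /p0 ler_pM2l // lef_pV2 ?posrE //.
    rewrite expr2 ler_pM2l ?subr_gt0 // lerB //.
    by rewrite ler_pdivrMr ?exprn_gt0 // ler_peMr ?exprn_ege1 ?ltW.
  rewrite mulr_gt0 ?subr_gt0 // ltr_pdivrMr ?exprn_gt0 // mul1r (lt_le_trans s1) //.
  by rewrite exprn_ege1 // ltW.
have le2 : p0 * t ^+ 2 <= gphi t (s * t ^+ 2).
  have -> : p0 * t ^+ 2 = s * t / (1 - s) ^+ 2.
    by rewrite /p0; field; rewrite subr_eq0 !gt_eqF.
  rewrite ephi ler_pM2l ?mulr_gt0 // lef_pV2 ?posrE ?exprn_gt0 ?subr_gt0 //.
  by rewrite lerXn2r ?nnegrE ?subr_ge0 ?(ltW s1) ?(ltW s1t) // lerB // ler_peMr // ltW.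
have h1 : a * gpsi t (s / t ^+ 2) - b * gphi t (s * t ^+ 2) <= - (b * k * s).
  apply: (@le_trans _ _ (b * t * p0 - b * (p0 * t ^+ 2))).
    have st2 : 0 <= 1 - s / t ^+ 2.
      rewrite subr_ge0 ler_pdivrMr ?exprn_gt0 // mul1r (le_trans (ltW s1)) //.
      by rewrite exprn_ege1 // ltW.
    have psi0 : 0 <= gpsi t (s / t ^+ 2).
      by rewrite epsi divr_ge0 ?(ltW st0) // mulr_ge0 // subr_ge0 ltW.
    have A : a * gpsi t (s / t ^+ 2) <= b * t * p0 by apply: ler_pM.
    apply: lerB A _; apply: ler_wpM2l le2; exact: b0.
  have -> : b * t * p0 - b * (p0 * t ^+ 2) = - (b * k * (s / (1 - s) ^+ 2)).
    by rewrite /p0 /t; field; rewrite !gt_eqF // ?subr_gt0.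
  rewrite lerN2 ler_wpM2l ?mulr_ge0 ?(ltW k0) // ler_pdivlMr // ler_piMr ?(ltW s0) //.
  by rewrite exprn_ile1 // ?subr_ge0 ?(ltW s1) // gerBl ltW.
have g0 : k ^+ 2 / 4 <= tgap t / 2.
  rewrite /tgap; have -> : t - 1 = k by rewrite /t; ring.
  have : k ^+ 2 / 2 <= k ^+ 2 / t.
    by rewrite ler_wpM2l ?sqr_ge0 // lef_pV2 ?posrE.
  lra.
apply: (@le_trans _ _ (tgap t / 2 * - (b * k * s))).
  by apply: ler_wpM2l h1; apply: le_trans g0; rewrite divr_ge0 ?sqr_ge0.
rewrite mulrN lerN2; apply: (@le_trans _ _ (k ^+ 2 / 4 * (b * k * s))).
  by rewrite le_eqVlt; apply/orP; left; apply/eqP; field.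
by rewrite ler_wpM2r // !mulr_ge0 // ltW.
Qed.

(** A convex function lies below its chord on [0, 1]; the induction uses the exact slope 2^n - 1. *)
Lemma expr_le_linear k n : 0 <= k <= 1 -> (1 + k) ^+ n <= 1 + 2 ^+ n * k.
Proof.
move=> /andP[k0 k1].
suff h : (1 + k) ^+ n <= 1 + (2 ^+ n - 1) * k by apply: le_trans h _; lra.
elim: n => [|n IH]; first by rewrite !expr0 subrr mul0r addr0.
rewrite exprS; apply: (@le_trans _ _ ((1 + k) * (1 + (2 ^+ n - 1) * k))).
  by rewrite ler_wpM2l // addr_ge0.
rewrite exprS.
have : 1 <= 2 ^+ n :> R by rewrite exprn_ege1 // ler1n.
move: (2 ^+ n) => z z1.
have : 0 <= (z - 1) * k * (1 - k) by rewrite !mulr_ge0 ?subr_ge0.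
by lra.
Qed.

(** Slope in k of the loss in [steep_ratio]. The powers of 2 linearise t^10 and t^11; [D] turns the
    difference u - w of that proof into a ratio, using w at least (1 - s) / 2, and [E] accounts for
    squaring it. *)
Definition steepC s : R := 
  let D := 2 ^+ 12 / (1 - s) in let E := 2 * D + D ^+ 2 in 2 ^+ 10 + E + 2 ^+ 10 * E.

(** The bound on k has 128 = 2 * 2^6, which keeps s t^6 below the midpoint of s and 1 and hence the
    denominators away from 0. *)
Lemma steep_ratio s k : 0 < s < 1 -> 0 < k <= (1 - s) / 128%:R ->
  s * (1 + k) ^+ 6 <= (1 + s) / 2 /\
  gpsi (1 + k) (s * (1 + k) ^+ 4) <= gphi (1 + k) (s / (1 + k) ^+ 4) * (1 + steepC s * k).
Proof.
move=> /andP[s0 s1] /andP[k0 kle].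
have k1 : k <= 1 by lra.
have kk : 0 <= k <= 1 by rewrite k1 ltW.
set t := 1 + k; have t1 : 1 < t by rewrite /t; lra.
have t0 : 0 < t by lra.
have st6 : s * t ^+ 6 <= (1 + s) / 2.
  have h : t ^+ 6 <= 1 + 2 ^+ 6 * k by have := expr_le_linear 6 kk.
  apply: (@le_trans _ _ (s * (1 + 2 ^+ 6 * k))); first by rewrite ler_pM2l.
  nra.
split => //.
pose u := 1 - s / t ^+ 5; pose w := 1 - s * t ^+ 6.
have t50 : 0 < t ^+ 5 by rewrite exprn_gt0.
have w0 : (1 - s) / 2 <= w by rewrite /w; lra.
have wp : 0 < w by lra.
have t46 : t ^+ 4 <= t ^+ 6 by rewrite ler_eXn2l // ltW.
have w4 : w <= 1 - s * t ^+ 4 by rewrite /w lerB // ler_pM2l.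
have st5 : s / t ^+ 5 < 1 by rewrite ltr_pdivrMr // mul1r (lt_le_trans s1) // exprn_ege1 // ltW.
have u0 : 0 < u by rewrite /u; lra.
have uw : u - w <= 2 ^+ 11 * k.
  have -> : u - w = s / t ^+ 5 * (t ^+ 11 - 1).
    by rewrite /u /w; field; rewrite gt_eqF.
  have h : t ^+ 11 - 1 <= 2 ^+ 11 * k by have := expr_le_linear 11 kk; rewrite -/t; lra.
  apply: le_trans h; apply: ler_piMl; last exact: ltW.
  by rewrite subr_ge0 exprn_ege1 // ltW.
pose D := 2 ^+ 12 / (1 - s).
have D0 : 0 < D by rewrite divr_gt0 // subr_gt0.
have uw2 : u <= w * (1 + D * k).
  have : 2 ^+ 11 * k <= w * (D * k).
    apply: (@le_trans _ _ ((1 - s) / 2 * (D * k))).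
      rewrite le_eqVlt; apply/orP; left; apply/eqP; rewrite /D; field.
      by rewrite subr_eq0 gt_eqF.
    by rewrite ler_wpM2r // mulr_ge0 // ltW.
  lra.
pose E := 2 * D + D ^+ 2.
have uw3 : u ^+ 2 <= w ^+ 2 * (1 + E * k).
  apply: (@le_trans _ _ ((w * (1 + D * k)) ^+ 2)).
    by rewrite lerXn2r // ?nnegrE ?ltW // mulr_gt0 // addr_gt0 // mulr_gt0.
  rewrite exprMn ler_wpM2l ?sqr_ge0 // /E.
  have : D ^+ 2 * k ^+ 2 <= D ^+ 2 * k.
    by rewrite ler_wpM2l ?sqr_ge0 // expr2 ler_piMl // ltW.
  have -> : (1 + D * k) ^+ 2 = 1 + 2 * D * k + D ^+ 2 * k ^+ 2 by ring.
  lra.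
have E0 : 0 <= E by rewrite addr_ge0 ?sqr_ge0 // mulr_ge0 // ltW.
have t10 : t ^+ 10 <= 1 + 2 ^+ 10 * k by have := expr_le_linear 10 kk.
have tE : t ^+ 10 * (1 + E * k) <= 1 + steepC s * k.
  apply: (@le_trans _ _ ((1 + 2 ^+ 10 * k) * (1 + E * k))).
    by rewrite ler_wpM2r // addr_ge0 // mulr_ge0 // ltW.
  rewrite /steepC -/D -/E.
  have : E * k ^+ 2 <= E * k by rewrite ler_wpM2l // expr2 ler_piMl // ltW.
  move=> h; have -> : (1 + 2 ^+ 10 * k) * (1 + E * k) =
     1 + 2 ^+ 10 * k + E * k + 2 ^+ 10 * (E * k ^+ 2) by ring.
  lra.
have -> : gpsi t (s * t ^+ 4) = s * t ^+ 5 / (w * (1 - s * t ^+ 4)).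
  by rewrite /gpsi /w; congr (_ / ((1 - _) * _)); ring.
have -> : gphi t (s / t ^+ 4) = s / t ^+ 5 / u ^+ 2.
  have -> : s / t ^+ 5 = s / t ^+ 4 / t by field; rewrite gt_eqF.
  by rewrite /gphi /u; have -> : s / t ^+ 5 = s / t ^+ 4 / t by field; rewrite gt_eqF.
apply: (@le_trans _ _ (s * t ^+ 5 / w ^+ 2)).
  rewrite ler_pM2l ?mulr_gt0 // lef_pV2 ?posrE ?mulr_gt0 ?exprn_gt0 //; last by lra.
  by rewrite expr2 ler_pM2l.
apply: (@le_trans _ _ (s / t ^+ 5 / u ^+ 2 * (t ^+ 10 * (1 + E * k)))); last first.
  by rewrite ler_wpM2l // divr_ge0 ?sqr_ge0 // divr_ge0 // ltW.
have -> : s / t ^+ 5 / u ^+ 2 * (t ^+ 10 * (1 + E * k)) = s * t ^+ 5 * ((1 + E * k) / u ^+ 2).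
  by field; rewrite !gt_eqF.
rewrite ler_pM2l ?mulr_gt0 // ler_pdivlMr ?exprn_gt0 // mulrC ler_pdivrMr ?exprn_gt0 //.
by rewrite mulrC.
Qed.

(** Here the ratios lean towards the wrong exit; the resulting loss 1 + C k is paid for by a
    rectangle that is elongated the right way. In the rate, 128 = 4 * 32 combines k^2 / 4 with t^5
    at most 32. *)
Lemma steep_exponent s k a b : 0 < s < 1 -> 0 < k <= (1 - s) / 128%:R -> 0 <= a -> 0 <= b ->
  a * (1 + steepC s * k) + k * b <= b ->
  tgap (1 + k) / 2 * (a * gpsi (1 + k) (s * (1 + k) ^+ 4) - b * gphi (1 + k) (s / (1 + k) ^+ 4))
  <= - (s / 128%:R * k ^+ 3 * b).
Proof.
move=> hs hk a0 b0 hab; have [st6 ratio] := steep_ratio hs hk.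
have /andP[s0 s1] := hs; have /andP[k0 kle] := hk.
have k1 : k <= 1 by lra.
set t := 1 + k in st6 ratio *; have t1 : 1 < t by rewrite /t; lra.
have t0 : 0 < t by lra.
have t2 : t <= 2 by rewrite /t; lra.
set phi := gphi t _ in ratio *; set psi := gpsi t _ in ratio *.
have st5 : s / t ^+ 5 < 1.
  by rewrite ltr_pdivrMr ?exprn_gt0 // mul1r (lt_le_trans s1) // exprn_ege1 // ltW.
have phis : s / 32%:R <= phi.
  have e : s / t ^+ 4 / t = s / t ^+ 5 by field; rewrite gt_eqF.
  rewrite /phi /gphi e; apply: (@le_trans _ _ (s / t ^+ 5)).
    rewrite ler_pM2l // lef_pV2 ?posrE ?exprn_gt0 //.
    have -> : 32%:R = 2 ^+ 5 :> R by rewrite -natrX.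
    by rewrite lerXn2r // nnegrE ltW.
  have z0 : 0 < s / t ^+ 5 by rewrite divr_gt0 // exprn_gt0.
  rewrite ler_pdivlMr ?exprn_gt0 ?subr_gt0 // ler_piMr ?(ltW z0) //.
  by rewrite exprn_ile1 // ?subr_ge0 ?(ltW st5) // gerBl ltW.
have phi0 : 0 <= phi by apply: le_trans phis; rewrite divr_ge0 // ltW.
have h1 : a * psi - b * phi <= - (s / 32%:R * (k * b)).
  apply: (@le_trans _ _ (a * (phi * (1 + steepC s * k)) - b * phi)).
    by rewrite lerB // ler_wpM2l.
  apply: (@le_trans _ _ (- (phi * (k * b)))).
    have : phi * (a * (1 + steepC s * k) + k * b) <= phi * b by rewrite ler_wpM2l.
    move: (1 + steepC s * k) => z; lra.
  by rewrite lerN2 ler_wpM2r // mulr_ge0 // ltW.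
have g0 : k ^+ 2 / 4 <= tgap t / 2.
  rewrite /tgap; have -> : t - 1 = k by rewrite /t; ring.
  have : k ^+ 2 / 2 <= k ^+ 2 / t.
    by rewrite ler_wpM2l ?sqr_ge0 // lef_pV2 ?posrE.
  lra.
apply: (@le_trans _ _ (tgap t / 2 * - (s / 32%:R * (k * b)))).
  by apply: ler_wpM2l h1; apply: le_trans g0; rewrite divr_ge0 ?sqr_ge0.
rewrite mulrN lerN2; apply: (@le_trans _ _ (k ^+ 2 / 4 * (s / 32%:R * (k * b)))).
  by rewrite le_eqVlt; apply/orP; left; apply/eqP; field.
by rewrite ler_wpM2r // !mulr_ge0 // ?invr_ge0 // ltW.
Qed.

End Exponents.

(** * Exit and walk errors for the chosen ratios *)

Section ErrorBounds.
Context {R : realType}.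
Implicit Types (s k q x y t tau : R).

Lemma errS_exit q x y tau m h om : (1 < tau)%R -> (0 < x < 1)%R -> (0 < y)%R ->
  (y * tau ^+ 2 < 1)%R -> (q = x * y)%R ->
  errS q x m h om <= (expR (tgap tau / 2 * (h%:R * gpsi tau y - m%:R * gphi tau x)))%:E.
Proof.
move=> t1 hx y0 yt qE; rewrite /errS.
have /andP[x0 _] := hx.
have -> : (q / x = y)%R by rewrite qE mulrAC mulfV ?mul1r // gt_eqF.
by rewrite qE; exact: exit_V.
Qed.

Lemma errW_exit q x y tau m h om : (1 < tau)%R -> (0 < x)%R -> (0 < y < 1)%R ->
  (x * tau ^+ 2 < 1)%R -> (q = x * y)%R ->
  errW q x m h om <= (expR (tgap tau / 2 * (m%:R * gpsi tau x - h%:R * gphi tau y)))%:E.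
Proof.
move=> t1 x0 hy xt qE; rewrite /errW.
have -> : (q / x = y)%R by rewrite qE mulrAC mulfV ?mul1r // gt_eqF.
by rewrite qE; exact: exit_H.
Qed.

Lemma errS_good s k m h om : (0 < s)%R -> (0 < k <= 1)%R -> (s * (1 + k) ^+ 2 < 1)%R ->
  (h%:R <= m%:R * (1 + k))%R ->
  errS (s ^+ 2) (s * (1 + k) ^+ 2) m h om <= (expR (- (s / 4 * k ^+ 3 * m%:R)))%:E.
Proof.
move=> s0 hk st hm; have /andP[k0 k1] := hk.
have t0 : (0 < 1 + k)%R by rewrite addr_gt0.
have t20 : (0 < (1 + k) ^+ 2)%R by rewrite exprn_gt0.
have s1 : (s < 1)%R.
  by apply: le_lt_trans st; rewrite ler_pMr // exprn_ege1 // lerDl ltW.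
apply: le_trans (@errS_exit _ _ (s / (1 + k) ^+ 2) (1 + k) m h om _ _ _ _ _) _.
- by rewrite ltrDl.
- by rewrite st mulr_gt0.
- by rewrite divr_gt0.
- by rewrite divfK // gt_eqF.
- by field; rewrite gt_eqF.
by rewrite lee_fin ler_expR; apply: good_exponent.
Qed.

Lemma errW_good s k m h om : (0 < s)%R -> (0 < k <= 1)%R -> (s * (1 + k) ^+ 2 < 1)%R ->
  (m%:R <= h%:R * (1 + k))%R ->
  errW (s ^+ 2) (s / (1 + k) ^+ 2) m h om <= (expR (- (s / 4 * k ^+ 3 * h%:R)))%:E.
Proof.
move=> s0 hk st hm; have /andP[k0 k1] := hk.
have t0 : (0 < 1 + k)%R by rewrite addr_gt0.
have t20 : (0 < (1 + k) ^+ 2)%R by rewrite exprn_gt0.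
have s1 : (s < 1)%R.
  by apply: le_lt_trans st; rewrite ler_pMr // exprn_ege1 // lerDl ltW.
apply: le_trans (@errW_exit _ _ (s * (1 + k) ^+ 2) (1 + k) m h om _ _ _ _ _) _.
- by rewrite ltrDl.
- by rewrite divr_gt0.
- by rewrite st mulr_gt0.
- by rewrite divfK // gt_eqF.
- by field; rewrite gt_eqF.
by rewrite lee_fin ler_expR; apply: good_exponent.
Qed.

Lemma steep_facts s k : (0 < s < 1)%R -> (0 < k <= (1 - s) / 128%:R)%R ->
  [/\ (0 < 1 + k <= 2)%R, (k <= 1)%R, (s * (1 + k) ^+ 6 < 1)%R,
      (s * (1 + k) ^+ 4 < 1)%R & (0 < s / (1 + k) ^+ 4 < 1)%R].
Proof.
move=> hs hk; have [st6 _] := steep_ratio hs hk.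
have /andP[s0 s1] := hs; have /andP[k0 kle] := hk.
have k1 : (k <= 1)%R by lra.
have t1 : (1 <= 1 + k)%R by lra.
have t40 : (0 < (1 + k) ^+ 4)%R by rewrite exprn_gt0 // addr_gt0.
have h6 : (s * (1 + k) ^+ 6 < 1)%R by lra.
split => //; first by apply/andP; split; lra.
  by apply: le_lt_trans h6; rewrite ler_pM2l // ler_weXn2l.
rewrite divr_gt0 //= ltr_pdivrMr // mul1r (lt_le_trans s1) // exprn_ege1 //.
Qed.

Lemma errS_steep s k m h om : (0 < s < 1)%R -> (0 < k <= (1 - s) / 128%:R)%R ->
  (h%:R * (1 + steepC s * k) + k * m%:R <= m%:R)%R ->
  errS (s ^+ 2) (s / (1 + k) ^+ 4) m h om <= (expR (- (s / 128%:R * k ^+ 3 * m%:R)))%:E.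
Proof.
move=> hs hk hm; have [/andP[t0 _] k1 h6 h4 h4'] := steep_facts hs hk.
have /andP[s0 s1] := hs; have /andP[k0 _] := hk.
have t40 : (0 < (1 + k) ^+ 4)%R by rewrite exprn_gt0.
apply: le_trans (@errS_exit _ _ (s * (1 + k) ^+ 4) (1 + k) m h om _ _ _ _ _) _.
- by rewrite ltrDl.
- by [].
- by rewrite mulr_gt0.
- by rewrite -mulrA -exprD.
- by field; rewrite gt_eqF.
by rewrite lee_fin ler_expR; apply: steep_exponent.
Qed.

Lemma errW_steep s k m h om : (0 < s < 1)%R -> (0 < k <= (1 - s) / 128%:R)%R ->
  (m%:R * (1 + steepC s * k) + k * h%:R <= h%:R)%R ->
  errW (s ^+ 2) (s * (1 + k) ^+ 4) m h om <= (expR (- (s / 128%:R * k ^+ 3 * h%:R)))%:E.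
Proof.
move=> hs hk hm; have [/andP[t0 _] k1 h6 h4 h4'] := steep_facts hs hk.
have /andP[s0 s1] := hs; have /andP[k0 _] := hk.
have t40 : (0 < (1 + k) ^+ 4)%R by rewrite exprn_gt0.
apply: le_trans (@errW_exit _ _ (s / (1 + k) ^+ 4) (1 + k) m h om _ _ _ _ _) _.
- by rewrite ltrDl.
- by rewrite mulr_gt0.
- by [].
- by rewrite -mulrA -exprD.
- by field; rewrite gt_eqF.
by rewrite lee_fin ler_expR; apply: steep_exponent.
Qed.

Lemma walk_exp x t L : (0 < x)%R -> (1 < t)%R -> (x * t ^+ 2 < 1)%R ->
  walk x (x * t ^+ 2) L 0 <= (expR (- (x * (t - 1) ^+ 2 * L%:R)))%:E.
Proof.
move=> x0 t1 xt; apply: (le_trans (walk_chernoff L 0 x0 t1 xt)).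
rewrite expr0 mul1r lee_fin.
have t0 : (0 < t)%R by rewrite (lt_trans _ t1).
have xt1 : (x * t < 1)%R.
  by rewrite (le_lt_trans _ xt) // ler_pM2l // ler_eXnr // ltW.
have z0 : (0 < x * t)%R by rewrite mulr_gt0.
have d0 : (0 < (1 - x * t) ^+ 2)%R by rewrite exprn_gt0 // subr_gt0.
have d1 : ((1 - x * t) ^+ 2 <= 1)%R.
  by rewrite exprn_ile1 // ?subr_ge0 ?(ltW xt1) // gerBl ltW.
have x1 : (x < 1)%R by rewrite (le_lt_trans _ xt1) // ler_peMr // ltW.
have a0 : (0 <= 1 - x * (t - 1) ^+ 2 / (1 - x * t) ^+ 2)%R.
  have -> : (1 - x * (t - 1) ^+ 2 / (1 - x * t) ^+ 2 =
             (1 - x) * (1 - x * t ^+ 2) / (1 - x * t) ^+ 2)%R.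
    by field; rewrite subr_eq0 gt_eqF.
  by rewrite divr_ge0 ?(ltW d0) // mulr_ge0 // subr_ge0 ltW.
apply: (@le_trans _ _ (expR (- (x * (t - 1) ^+ 2)) ^+ L))%R; last first.
  by rewrite -expRM_natl le_eqVlt; apply/orP; left; apply/eqP; congr expR; ring.
rewrite lerXn2r ?nnegrE ?expR_ge0 //; apply: le_trans (expR_ge1Dx _).
rewrite lerD2l lerN2 ler_pdivlMr //; apply: ler_piMr => //.
by rewrite mulr_ge0 ?sqr_ge0 // ltW.
Qed.

End ErrorBounds.

(** * Cubic decay away from the diagonal *)

Section CubicDecay.
Context {R : realType}.
Implicit Types (s eps : R).

Lemma expR_le3 (x y z E : R) (a b c : \bar R) : a <= (expR x)%:E -> b <= (expR y)%:E ->
  c <= (expR z)%:E -> (x <= E)%R -> (y <= E)%R -> (z <= E)%R -> a + (b + c) <= (3 * expR E)%:E.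
Proof.
move=> ha hb hc xE yE zE.
have -> : (3 * expR E = expR E + (expR E + expR E))%R by ring.
rewrite !EFinD leeD // ?leeD //.
- by apply: le_trans ha _; rewrite lee_fin ler_expR.
- by apply: le_trans hb _; rewrite lee_fin ler_expR.
- by apply: le_trans hc _; rewrite lee_fin ler_expR.
Qed.

Lemma steepC_gt0 s : (0 < s < 1)%R -> (0 < steepC s)%R.
Proof.
move=> /andP[s0 s1]; rewrite /steepC; set D := (_ / _)%R.
have D0 : (0 < D)%R by rewrite divr_gt0 ?subr_gt0 // exprn_gt0.
have c0 : (0 < 2 ^+ 10 :> R)%R by rewrite exprn_gt0.
have E0 : (0 < 2 * D + D ^+ 2)%R by rewrite addr_gt0 // ?exprn_gt0 // mulr_gt0.
by rewrite !addr_gt0 // mulr_gt0.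
Qed.

Lemma ratios_in s k : (0 < s < 1)%R -> (0 < k <= (1 - s) / 128%:R)%R ->
  [/\ (s ^+ 2 < s / (1 + k) ^+ 4)%R, (s / (1 + k) ^+ 4 <= s / (1 + k) ^+ 2)%R,
      (s / (1 + k) ^+ 2 < s * (1 + k) ^+ 2)%R, (s * (1 + k) ^+ 2 <= s * (1 + k) ^+ 4)%R
    & (s * (1 + k) ^+ 4 < 1)%R].
Proof.
move=> hs hk; have [/andP[t0 t2] k1 h6 h4 _] := steep_facts hs hk.
have /andP[s0 s1] := hs; have /andP[k0 _] := hk.
have t1 : (1 <= 1 + k)%R by rewrite lerDl ltW.
have t1' : (1 < 1 + k)%R by rewrite ltrDl.
have t20 : (0 < (1 + k) ^+ 2)%R by rewrite exprn_gt0.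
have t40 : (0 < (1 + k) ^+ 4)%R by rewrite exprn_gt0.
have t24 : ((1 + k) ^+ 2 <= (1 + k) ^+ 4)%R by rewrite ler_weXn2l.
split => //.
- by rewrite ltr_pdivlMr // expr2 -mulrA -[ltRHS]mulr1 ltr_pM2l.
- by rewrite ler_pM2l // lef_pV2.
- rewrite ltr_pdivrMr // -mulrA -[ltLHS]mulr1 ltr_pM2l // -exprD.
  by rewrite exprn_egt1.
- by rewrite ler_pM2l.
Qed.

(** Above the diagonal the lower rectangle is tall: its exit is vertical even with the large x-axis
    ratio s t^4, where t = 1 + kap, while the upper half tolerates s t^2. The walk to the right of
    [c] thus has a relative drift of order kap against survival. *)
Lemma part_one_lt s eps n c r : (0 < s < 1)%R -> (0 < eps)%R ->
  (eps <= (1 - s) / 128%:R)%R -> (eps * (2 * steepC s + 4) <= 1)%R ->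
  (c < r)%N -> (r < n)%N -> (c + r <= n)%N ->
  let k := (r%:R - c%:R : R)%R in let N := ((c + r)%:R : R)%R in
  let kap := (eps * k / N)%R in
  (4 <= kap ^+ 3 * N)%R ->
  prob_up (s ^+ 2) n c r <= (3 * expR (- (s / 512%:R * (kap ^+ 3 * N))))%:E.
Proof.
move=> hs e0 e1 e2 cr rn crn k N kap hbig.
have kE : k = (r%:R - c%:R)%R by [].
have kapE : kap = (eps * k / N)%R by [].
have NE : N = (c%:R + r%:R)%R by rewrite /N natrD.
have Nn : (N <= n%:R)%R by rewrite /N ler_nat.
clearbody kap k N.
have /andP[s0 s1] := hs.
have C0 := steepC_gt0 hs; set C := steepC s in e2 C0.
have cr' : (c%:R + 1 <= r%:R :> R)%R by rewrite natr1 ler_nat.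
have c0 : (0 <= c%:R :> R)%R by [].
have rn' : (r%:R + 1 <= n%:R :> R)%R by rewrite natr1 ler_nat.
have N0 : (0 < N)%R by lra.
have k0 : (0 < k)%R by lra.
have kN : (k <= N)%R by lra.
have kapN : (kap * N = eps * k)%R by rewrite kapE divfK // gt_eqF.
have kap0 : (0 < kap)%R by rewrite kapE divr_gt0 // mulr_gt0.
have kape : (kap <= eps)%R.
  by rewrite kapE ler_pdivrMr // ler_pM2l.
have hk : (0 < kap <= (1 - s) / 128%:R)%R by rewrite kap0 (le_trans kape).
have [tt k1 h6 h4 _] := steep_facts hs hk.
have [q1 q2 q3 q4 q5] := ratios_in hs hk.
have k1' : (0 < kap <= 1)%R by rewrite kap0 k1.
have e4 : (eps <= 1 / 4)%R by lra.
have hL0 : (0 <= eps * k)%R by rewrite mulr_ge0 // ltW.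
(* Since eps k = kap N, this makes kap^2 L of order kap^3 N. The assumption 4 <= kap^3 N makes eps k
   at least 4, so rounding loses at most a quarter. *)
pose L := Num.truncn (eps * k)%R.
have /andP[L1 L2] := truncn_itv hL0; rewrite -/L -natr1 in L1 L2.
have kap3 : (kap ^+ 3 * N <= eps * k)%R.
  by rewrite -kapN ler_pM2r // -[leRHS]expr1 ler_wiXn2l // ltW.
have epsk : (eps * k <= k / 4)%R by have := ler_wpM2r (ltW k0) e4; lra.
have cn : (c <= n)%N := leq_trans (ltnW cr) (ltnW rn).
have Lnc : (L <= n - c)%N.
  rewrite -(ler_nat R) natrB //; lra.
have kapk3 : (0 <= kap ^+ 3)%R by rewrite exprn_ge0 // ltW.
have q0 : (0 < s ^+ 2)%R by rewrite exprn_gt0.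
have qB : (s ^+ 2 < s * (1 + kap) ^+ 2)%R by rewrite (lt_trans _ q3) // (lt_le_trans q1).
have B1 : (s * (1 + kap) ^+ 2 < 1)%R := le_lt_trans q4 h4.
have qA : (s ^+ 2 < s * (1 + kap) ^+ 4)%R := lt_le_trans qB q4.
have U := @up_right R _ _ _ n c r L q0 qA h4 qB B1 rn cn Lnc.
refine (le_trans U _).
have sx2 : (s * (1 + kap) ^+ 4 = s * (1 + kap) ^+ 2 * (1 + kap) ^+ 2)%R.
  by rewrite -mulrA -exprD.
have t1 : (1 < 1 + kap)%R by rewrite ltrDl.
have t20 : (1 <= (1 + kap) ^+ 2)%R by rewrite exprn_ege1 // ltW.
have hW := @walk_exp R (s * (1 + kap) ^+ 2) (1 + kap) L.
rewrite -sx2 in hW.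
have sx0 : (0 < s * (1 + kap) ^+ 2)%R by rewrite mulr_gt0 // (lt_le_trans _ t20).
have {}hW := hW sx0 t1 h4.
have hA := @errW_steep R s kap (c + L).+1 r.+1 (fun=> 0%N) hs hk.
have hB := @errS_good R s kap (n - c - L).+1 (n - r) (fun=> 0%N) s0 k1'.
apply: (expR_le3 hW (hA _) (hB _ _)).
(* The gap k between r and c pays for the L extra columns, for the slope C kap and for the margin
   kap (r + 1), all of order eps k; this is the role of the bound on eps (2 C + 4). *)
- rewrite -/C -!natr1 natrD.
  have h1 : (kap * (r%:R + 1) <= 2 * (eps * k))%R.
    rewrite -kapN mulrCA ler_pM2l //; lra.
  have h2 : ((c%:R + L%:R + 1) * (C * kap) <= C * (2 * (eps * k)))%R.
    apply: (@le_trans _ _ ((r%:R + 1) * (C * kap)))%R.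
      rewrite ler_wpM2r ?mulr_ge0 ?(ltW C0) ?(ltW kap0) //; lra.
    by rewrite mulrC -mulrA ler_pM2l.
  have h3 : (eps * k * (2 * C + 4) <= k)%R.
    by rewrite mulrAC ler_piMl // ltW.
  lra.
- exact: le_lt_trans q4 h4.
- rewrite (natrB _ (ltnW rn)).
  rewrite -natr1 natrB // natrB // mulrDr mulr1.
  have : (0 <= (n%:R - c%:R - L%:R + 1) * kap)%R.
    rewrite mulr_ge0 ?(ltW kap0) //; lra.
  lra.
- have -> : (1 + kap - 1 = kap)%R by ring.
  rewrite lerN2.
  have h1 : (kap ^+ 3 * N * (3 / 4) <= kap ^+ 2 * L%:R)%R.
    have -> : (kap ^+ 3 * N * (3 / 4) = kap ^+ 2 * (kap * N * (3 / 4)))%R by ring.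
    rewrite ler_wpM2l ?sqr_ge0 // kapN; lra.
  have h2 : (s * (kap ^+ 2 * L%:R) <= s * (1 + kap) ^+ 2 * (kap ^+ 2 * L%:R))%R.
    apply: ler_wpM2r; first by rewrite mulr_ge0 ?sqr_ge0.
    by rewrite ler_peMr // ltW.
  have h3 : (s * (kap ^+ 3 * N * (3 / 4)) <= s * (kap ^+ 2 * L%:R))%R by rewrite ler_pM2l.
  have h4' : (0 <= s * (kap ^+ 3 * N))%R by rewrite !mulr_ge0 // ltW.
  lra.
(* This error fixes the rate: 512 = 4 * 128, as r + 1 is at least N / 4. *)
- rewrite lerN2 -[r.+1%:R]natr1.
  have : (s * kap ^+ 3 * (N / 4) <= s * kap ^+ 3 * (r%:R + 1))%R.
    rewrite ler_wpM2l ?mulr_ge0 // ?ltW //; lra.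
  have h4' : (0 <= s * (kap ^+ 3 * N))%R by rewrite !mulr_ge0 // ltW.
  lra.
- rewrite lerN2 -[(n - c - L).+1%:R]natr1 natrB // natrB //.
  have : (s * kap ^+ 3 * (N / 4) <= s * kap ^+ 3 * (n%:R - c%:R - L%:R + 1))%R.
    rewrite ler_wpM2l ?mulr_ge0 // ?ltW //; lra.
  have h4' : (0 <= s * (kap ^+ 3 * N))%R by rewrite !mulr_ge0 // ltW.
  lra.
Qed.

(** Below the diagonal the lower rectangle is wide, its exit is horizontal even with the small ratio
    s / t^4, and the comparison goes to the left of [c]. *)
Lemma part_one_gt s eps n c r : (0 < s < 1)%R -> (0 < eps)%R ->
  (eps <= (1 - s) / 128%:R)%R -> (eps * (2 * steepC s + 4) <= 1)%R ->
  (r < c)%N -> (c <= n)%N -> (c + r <= n)%N ->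
  let k := (c%:R - r%:R : R)%R in let N := ((c + r)%:R : R)%R in
  let kap := (eps * k / N)%R in
  (4 <= kap ^+ 3 * N)%R ->
  prob_up (s ^+ 2) n c r <= (3 * expR (- (s / 512%:R * (kap ^+ 3 * N))))%:E.
Proof.
move=> hs e0 e1 e2 rc cn crn k N kap hbig.
have kE : k = (c%:R - r%:R)%R by [].
have kapE : kap = (eps * k / N)%R by [].
have NE : N = (c%:R + r%:R)%R by rewrite /N natrD.
have Nn : (N <= n%:R)%R by rewrite /N ler_nat.
clearbody kap k N.
have /andP[s0 s1] := hs.
have C0 := steepC_gt0 hs; set C := steepC s in e2 C0.
have rn : (r < n)%N := leq_trans rc cn.
have rc' : (r%:R + 1 <= c%:R :> R)%R by rewrite natr1 ler_nat.
have r0 : (0 <= r%:R :> R)%R by [].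
have cn' : (c%:R <= n%:R :> R)%R by rewrite ler_nat.
have N0 : (0 < N)%R by lra.
have k0 : (0 < k)%R by lra.
have kN : (k <= N)%R by lra.
have kapN : (kap * N = eps * k)%R by rewrite kapE divfK // gt_eqF.
have kap0 : (0 < kap)%R by rewrite kapE divr_gt0 // mulr_gt0.
have kape : (kap <= eps)%R.
  by rewrite kapE ler_pdivrMr // ler_pM2l.
have hk : (0 < kap <= (1 - s) / 128%:R)%R by rewrite kap0 (le_trans kape).
have [/andP[tt0 tt2] k1 h6 h4 h4'] := steep_facts hs hk.
have [q1 q2 q3 q4 q5] := ratios_in hs hk.
have k1' : (0 < kap <= 1)%R by rewrite kap0 k1.
have e4 : (eps <= 1 / 4)%R by lra.
have hL0 : (0 <= eps * k)%R by rewrite mulr_ge0 // ltW.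
pose L := Num.truncn (eps * k)%R.
have /andP[L1 L2] := truncn_itv hL0; rewrite -/L -natr1 in L1 L2.
have kap3 : (kap ^+ 3 * N <= eps * k)%R.
  by rewrite -kapN ler_pM2r // -[leRHS]expr1 ler_wiXn2l // ltW.
have epsk : (eps * k <= k / 4)%R by have := ler_wpM2r (ltW k0) e4; lra.
have Lc : (L <= c)%N by rewrite -(ler_nat R); lra.
have kapk3 : (0 <= kap ^+ 3)%R by rewrite exprn_ge0 // ltW.
have q0 : (0 < s ^+ 2)%R by rewrite exprn_gt0.
have B1 : (s / (1 + kap) ^+ 2 < 1)%R by rewrite (lt_trans q3) // (le_lt_trans q4).
have qB : (s ^+ 2 < s / (1 + kap) ^+ 2)%R := lt_le_trans q1 q2.
have A1 : (s / (1 + kap) ^+ 4 < 1)%R := le_lt_trans q2 B1.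
have U := @up_left R _ _ _ n c r L q0 q1 A1 qB B1 rn cn Lc.
refine (le_trans U _).
have t1 : (1 < 1 + kap)%R by rewrite ltrDl.
have t40 : (0 < (1 + kap) ^+ 4)%R by rewrite exprn_gt0.
have sx2 : (s / (1 + kap) ^+ 2 = s / (1 + kap) ^+ 4 * (1 + kap) ^+ 2)%R.
  by field; rewrite gt_eqF.
have hW := @walk_exp R (s / (1 + kap) ^+ 4) (1 + kap) L.
rewrite -sx2 in hW.
have sx0 : (0 < s / (1 + kap) ^+ 4)%R by rewrite divr_gt0.
have {}hW := hW sx0 t1 B1.
have hA := @errS_steep R s kap (c - L).+1 r.+1 (fun=> 0%N) hs hk.
have hB := @errW_good R s kap (n - c + L).+1 (n - r) (fun=> 0%N) s0 k1' (le_lt_trans q4 h4).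
have sx16 : (s / 16%:R <= s / (1 + kap) ^+ 4)%R.
  rewrite ler_pM2l // lef_pV2 ?posrE //.
  have -> : (16%:R = 2 ^+ 4 :> R)%R by rewrite -natrX.
  by rewrite lerXn2r // nnegrE ltW.
have h40 : (0 <= s * (kap ^+ 3 * N))%R by rewrite !mulr_ge0 // ltW.
apply: (expR_le3 hW (hA _) (hB _)).
- rewrite -/C -[r.+1%:R]natr1 -[(c - L).+1%:R]natr1 natrB //.
  have h1 : (kap * (c%:R + 1) <= 2 * (eps * k))%R.
    rewrite -kapN mulrCA ler_pM2l //; lra.
  have h2 : ((r%:R + 1) * (C * kap) <= C * (2 * (eps * k)))%R.
    apply: (@le_trans _ _ ((c%:R + 1) * (C * kap)))%R.
      rewrite ler_wpM2r ?mulr_ge0 ?(ltW C0) ?(ltW kap0) //; lra.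
    by rewrite mulrC -mulrA ler_pM2l.
  have h3 : (eps * k * (2 * C + 4) <= k)%R.
    by rewrite mulrAC ler_piMl // ltW.
  have h5 : (kap * (c%:R - L%:R + 1) <= kap * (c%:R + 1))%R.
    have L0 : (0 <= L%:R :> R)%R by [].
    rewrite ler_pM2l //; lra.
  lra.
- rewrite (natrB _ (ltnW rn)) -[(n - c + L).+1%:R]natr1 natrD natrB // mulrDr mulr1.
  have : (0 <= (n%:R - r%:R) * kap)%R.
    rewrite mulr_ge0 ?(ltW kap0) //; lra.
  lra.
- have -> : (1 + kap - 1 = kap)%R by ring.
  rewrite lerN2.
  have h1 : (kap ^+ 3 * N * (3 / 4) <= kap ^+ 2 * L%:R)%R.
    have -> : (kap ^+ 3 * N * (3 / 4) = kap ^+ 2 * (kap * N * (3 / 4)))%R by ring.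
    rewrite ler_wpM2l ?sqr_ge0 // kapN; lra.
  have h2 : (s / 16%:R * (kap ^+ 2 * L%:R) <= s / (1 + kap) ^+ 4 * (kap ^+ 2 * L%:R))%R.
    by apply: ler_wpM2r; first by rewrite mulr_ge0 ?sqr_ge0.
  have h3 : (s * (kap ^+ 3 * N * (3 / 4)) <= s * (kap ^+ 2 * L%:R))%R by rewrite ler_pM2l.
  rewrite -[leRHS]mulrA; lra.
- rewrite lerN2 -[(c - L).+1%:R]natr1 natrB //.
  have : (s * kap ^+ 3 * (N / 4) <= s * kap ^+ 3 * (c%:R - L%:R + 1))%R.
    rewrite ler_wpM2l ?mulr_ge0 // ?ltW //; lra.
  lra.
- rewrite lerN2 (natrB _ (ltnW rn)).
  have : (s * kap ^+ 3 * (N / 4) <= s * kap ^+ 3 * (n%:R - r%:R))%R.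
    rewrite ler_wpM2l ?mulr_ge0 // ?ltW //; lra.
  lra.
Qed.

Lemma prob_up_le1 q n c r : (0 <= q < 1)%R -> prob_up q n c r <= 1 :> \bar R.
Proof. by move=> hq; apply: expect_le1 => // om; exact: ind_le1. Qed.

Lemma cube_ratio (e k N : R) : N != 0%R ->
  ((e * k / N) ^+ 3 * N = e ^+ 3 * (k ^+ 3 / N ^+ 2))%R.
Proof. by move=> N0; field. Qed.

Lemma part_one_up s : (0 < s < 1)%R -> exists c0 C0 : R, [/\ (0 < c0)%R, (0 < C0)%R &
  forall n c r : nat, (c <= n)%N -> (r < n)%N -> (c + r <= n)%N -> (0 < c + r)%N ->
  prob_up (s ^+ 2) n c r <=
    (C0 * expR (- c0 * (`|r%:R - c%:R| ^+ 3 / (c + r)%:R ^+ 2)))%:E].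
Proof.
move=> hs; have /andP[s0 s1] := hs; have Cp := steepC_gt0 hs.
pose eps := ((1 - s) / 128%:R / (2 * steepC s + 4))%R.
have d0 : (0 < 2 * steepC s + 4)%R by rewrite addr_gt0 // mulr_gt0.
have e0 : (0 < eps)%R by rewrite !divr_gt0 // subr_gt0.
have e2 : (eps * (2 * steepC s + 4) <= 1)%R by rewrite /eps divfK ?gt_eqF //; lra.
have e1 : (eps <= (1 - s) / 128%:R)%R.
  by rewrite /eps ler_pdivrMr // ler_peMr ?divr_ge0 ?subr_ge0 ?(ltW s1) //; lra.
have [z zE] : exists z : R, z = (s / 512%:R)%R by eexists.
have z0 : (0 < z)%R by rewrite zE divr_gt0 // ltr0n.
have hq : (0 <= s ^+ 2 < 1)%R by rewrite exprn_ge0 ?(ltW s0) // exprn_ilt1 // ltW.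
(* The term [expR (z * 4)] makes the bound exceed 1 when kap^3 N is below 4. *)
exists (z * eps ^+ 3)%R, (3 + expR (z * 4))%R; split.
- by rewrite mulr_gt0 // exprn_gt0.
- by apply: addr_gt0; [exact: ltr0n|exact: expR_gt0].
move=> n c r cn rn crn cr0.
set N := ((c + r)%:R)%R; have N0 : (0 < N)%R by rewrite ltr0n.
set k := `|_|%R; have k0 : (0 <= k)%R by exact: normr_ge0.
pose kap := (eps * k / N)%R.
have ek : (kap ^+ 3 * N = eps ^+ 3 * (k ^+ 3 / N ^+ 2))%R.
  by apply: cube_ratio; rewrite gt_eqF.
have -> : (- (z * eps ^+ 3) * (k ^+ 3 / N ^+ 2) = - (z * (kap ^+ 3 * N)))%R.
  by rewrite ek mulNr -mulrA.
have [big|small] := leP 4%R (kap ^+ 3 * N)%R; last first.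
  apply: (le_trans (prob_up_le1 n c r hq)); rewrite lee_fin.
  apply: (@le_trans _ _ (expR (z * 4) * expR (- (z * (kap ^+ 3 * N)))))%R.
    rewrite -expRD -[leLHS]expR0 ler_expR -mulrBr mulr_ge0 ?(ltW z0) // subr_ge0 ltW //.
  by rewrite ler_wpM2r ?expR_ge0 // lerDr.
apply: (@le_trans _ _ (3 * expR (- (z * (kap ^+ 3 * N))))%:E); last first.
  by rewrite lee_fin ler_wpM2r ?expR_ge0 // lerDl expR_ge0.
have [cr|rc|e] := ltngtP c r.
- have kE : k = (r%:R - c%:R)%R by rewrite /k ger0_norm // subr_ge0 ler_nat ltnW.
  rewrite /kap kE /N in big *; rewrite zE; exact: part_one_lt.
- have kE : k = (c%:R - r%:R)%R by rewrite /k distrC ger0_norm // subr_ge0 ler_nat ltnW.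
  rewrite /kap kE /N in big *; rewrite zE; exact: part_one_gt.
- exfalso; move: big; rewrite /kap /k e subrr normr0 mulr0 mul0r expr0n /= mul0r.
  by rewrite leNgt ltr0n.
Qed.

End CubicDecay.

(** * Two-sided estimate near the diagonal *)

Section NearDiagonal.
Context {R : realType}.
Implicit Types (s k : R).

(** The first term of [walk_bound] has the order of the relative drift k; the second is at most of
    order 1 / (L k), hence of order k once L k^2 is at least 1. *)
Lemma walk_near s k L : (0 < s < 1)%R -> (0 < k <= (1 - s) / 128%:R)%R -> (0 < L)%N ->
  (1 <= L%:R * k ^+ 2)%R ->
  walk (s * (1 + k) ^+ 2) (s / (1 + k) ^+ 2) L 0 <= ((32%:R / (1 - s) + s^-1) * k)%:E.
Proof.
move=> hs hk L0 hL; have /andP[s0 s1] := hs; have /andP[k0 _] := hk.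
have [/andP[t0 t2] k1 h6 h4 _] := steep_facts hs hk.
have [q1 q2 q3 q4 q5] := ratios_in hs hk.
have [st6 _] := steep_ratio hs hk.
set t := (1 + k)%R in t0 t2 h6 h4 q1 q2 q3 q4 q5 st6 *.
have t1 : (1 <= t)%R by rewrite /t lerDl ltW.
have t20 : (0 < t ^+ 2)%R by rewrite exprn_gt0.
have y0 : (0 < s / t ^+ 2)%R by rewrite divr_gt0.
have x1 : (s * t ^+ 2 < 1)%R := le_lt_trans q4 h4.
have x2 : ((1 - s) / 2 <= 1 - s * t ^+ 2)%R.
  have : (s * t ^+ 2 <= s * t ^+ 6)%R by rewrite ler_pM2l // ler_weXn2l.
  lra.
apply: (le_trans (walk_bound y0 q3 x1 L0)); rewrite lee_fin.
have -> : ((32%:R / (1 - s) + s^-1) * k = 32%:R / (1 - s) * k + s^-1 * k)%R by ring.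
have x1' : (0 < 1 - s * t ^+ 2)%R by rewrite subr_gt0.
have s1' : (0 < 1 - s)%R by rewrite subr_gt0.
apply: lerD.
- have -> : ((s * t ^+ 2 - s / t ^+ 2) / (s / t ^+ 2 * (1 - s * t ^+ 2)) =
             (t ^+ 4 - 1) / (1 - s * t ^+ 2))%R.
    by field; rewrite !gt_eqF.
  have h : (t ^+ 4 - 1 <= 2 ^+ 4 * k)%R.
    have kk : (0 <= k <= 1)%R by rewrite k1 ltW.
    by have := expr_le_linear 4 kk; rewrite -/t; lra.
  rewrite ler_pdivrMr //; apply: (le_trans h).
  apply: (@le_trans _ _ (32%:R / (1 - s) * k * ((1 - s) / 2)))%R.
    have -> : (32%:R / (1 - s) * k * ((1 - s) / 2) = 16%:R * k)%R by field; rewrite gt_eqF.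
    by rewrite ler_pM2r // -natrX.
  by rewrite ler_wpM2l // mulr_ge0 ?(ltW k0) // divr_ge0 // ltW.
- have d0 : (0 < s * t ^+ 2 - s / t ^+ 2)%R by rewrite subr_gt0.
  have LR : (0 < L%:R :> R)%R by rewrite ltr0n.
  have h : (s * k <= s * t ^+ 2 - s / t ^+ 2)%R.
    have h1 : (s / t ^+ 2 <= s)%R by rewrite ler_pdivrMr // ler_peMr ?(ltW s0) // exprn_ege1.
    have h2 : (s * (1 + k) <= s * t ^+ 2)%R by rewrite ler_pM2l // -/t ler_eXnr.
    lra.
  rewrite invf_ple ?posrE ?mulr_gt0 ?invr_gt0 // invfM invrK.
  apply: (@le_trans _ _ (L%:R * (s * k)))%R; last by rewrite ler_pM2l.
  rewrite mulrC -ler_pdivlMl ?invr_gt0 // invrK.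
  have -> : (k * (L%:R * (s * k)) = s * (L%:R * k ^+ 2))%R by ring.
  by rewrite ler_peMr // ltW.
Qed.

(** Both |r - c| and L + 1 are at most k N / 16, so the four rectangles have sides of length at
    least N / 4 and the aspect ratio 1 + k allowed by [errS_good] and [errW_good]. *)
Lemma part_two_near s k n c r : (0 < s < 1)%R -> (0 < k <= (1 - s) / 128%:R)%R ->
  (c <= n)%N -> (r < n)%N -> (c + r <= n)%N ->
  let N := ((c + r)%:R : R)%R in
  (2 ^+ 6 <= k ^+ 3 * N)%R -> (`|r%:R - c%:R| <= k * N / 16%:R)%R ->
  prob_up (s ^+ 2) n c r <=
  (((32%:R / (1 - s) + s^-1) * k) ^+ 2 + 4 * expR (- (s / 16%:R * (k ^+ 3 * N))))%:E.
Proof.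
move=> hs hk cn rn crn N hbig; rewrite ler_norml => /andP[d1 d2].
have NE : N = (c%:R + r%:R)%R by rewrite /N natrD.
have Nn : (N <= n%:R)%R by rewrite /N ler_nat.
clearbody N.
have /andP[s0 s1] := hs; have /andP[k0 kle] := hk.
have [/andP[t0 t2] k1 h6 h4 _] := steep_facts hs hk.
have [q1 q2 q3 q4 q5] := ratios_in hs hk.
have w0 : (0 <= k ^- 2)%R by rewrite invr_ge0 exprn_ge0 // ltW.
have k20 : (0 < k ^+ 2)%R by rewrite exprn_gt0.
(* Just above k^-2, as [walk_near] asks; k^3 N at least 2^6 keeps it small against k N. *)
pose L := (Num.truncn (k ^- 2)%R).+1.
have /andP[L1 L2] := truncn_itv w0; rewrite -/L in L2.
have {}L1 : (L%:R <= k ^- 2 + 1 :> R)%R by rewrite /L -natr1 lerD2r.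
have N0 : (0 < N)%R.
  rewrite ltNge; apply/negP => Nle.
  have : (k ^+ 3 * N <= 0)%R by rewrite mulr_ge0_le0 // exprn_ge0 // ltW.
  by apply/negP; rewrite -ltNge (lt_le_trans _ hbig) // exprn_gt0.
have kNbig : (2 ^+ 6 <= k * N)%R.
  by apply: (le_trans hbig); rewrite ler_pM2r // -[leRHS]expr1 ler_wiXn2l // ltW.
have wk : (k ^- 2 <= k * N / 2 ^+ 6)%R.
  rewrite ler_pdivlMr ?exprn_gt0 // mulrC ler_pdivrMr //.
  have -> : (k * N * k ^+ 2 = k ^+ 3 * N)%R by ring.
  exact: hbig.
have L0 : (0 < L)%N by [].
clearbody L.
have L3 : (L%:R + 1 <= k * N / 16%:R)%R.
  have e6 : (2 ^+ 6 = 64%:R :> R)%R by rewrite -natrX.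
  rewrite e6 in wk kNbig; move: (k * N)%R (k ^- 2)%R wk kNbig L1 => a b wk kNbig L1; lra.
have L4 : (1 <= L%:R * k ^+ 2)%R.
  by rewrite -ler_pdivrMr // mul1r ltW.
have kN : (k * N <= N)%R by rewrite ler_piMl // ltW.
have c0 : (0 <= c%:R :> R)%R by [].
have rn' : (r%:R + 1 <= n%:R :> R)%R by rewrite natr1 ler_nat.
have Lc : (L <= c)%N by rewrite -(ler_nat R); lra.
have Lnc : (L <= n - c)%N by rewrite -(ler_nat R) natrB //; lra.
have q0 : (0 < s ^+ 2)%R by rewrite exprn_gt0.
have qW : (s ^+ 2 < s / (1 + k) ^+ 2)%R := lt_le_trans q1 q2.
have S1 : (s * (1 + k) ^+ 2 < 1)%R := le_lt_trans q4 h4.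
have U := @up_joint R _ _ _ n c r L q0 qW (ltW q3) S1 rn cn Lc Lnc.
refine (le_trans U _).
have k1' : (0 < k <= 1)%R by rewrite k0.
have W := walk_near hs hk L0 L4.
have hx : (0 <= s * (1 + k) ^+ 2 < 1)%R.
  by rewrite S1 mulr_ge0 ?exprn_ge0 // ltW.
have hy : (0 <= s / (1 + k) ^+ 2 < 1)%R.
  by rewrite (lt_trans q3) // andbT divr_ge0 ?exprn_ge0 // ltW.
have W0 := walk_ge0 L 0 hx hy.
have kap3 : (0 <= s * k ^+ 3)%R by rewrite mulr_ge0 ?exprn_ge0 // ltW.
have eN (a : R) : (N / 4 <= a)%R -> (expR (- (s / 4 * k ^+ 3 * a)))%:E <=
    (expR (- (s / 16%:R * (k ^+ 3 * N))))%:E.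
  move=> ha; rewrite lee_fin ler_expR lerN2.
  have : (s * k ^+ 3 * (N / 4) <= s * k ^+ 3 * a)%R by rewrite ler_wpM2l.
  lra.
have mk (a b : R) : (N / 4 <= b)%R -> (a <= b + k * N / 4)%R -> (a <= b * (1 + k))%R.
  move=> hb ha; apply: (le_trans ha); rewrite mulrDr mulr1 lerD2l.
  have : (k * (N / 4) <= k * b)%R by rewrite ler_pM2l.
  lra.
have kN0 : (0 <= k * N)%R by rewrite mulr_ge0 // ltW.
rewrite EFinD; apply: leeD.
  rewrite expr2 EFinM; apply: lee_pmul => //.
have -> : (4 * expR (- (s / 16%:R * (k ^+ 3 * N))) =
  (expR (- (s / 16%:R * (k ^+ 3 * N))) + expR (- (s / 16%:R * (k ^+ 3 * N)))) +
  (expR (- (s / 16%:R * (k ^+ 3 * N))) + expR (- (s / 16%:R * (k ^+ 3 * N)))))%R by ring.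
rewrite !EFinD; apply: leeD; apply: leeD.
- apply: (le_trans (errS_good _ s0 k1' S1 _) (eN _ _)).
    rewrite -[(c - L).+1%:R]natr1 -[r.+1%:R]natr1 natrB //; apply: mk; lra.
  rewrite -[(c - L).+1%:R]natr1 natrB //; lra.
- apply: (le_trans (errW_good _ s0 k1' S1 _) (eN _ _)).
    rewrite -[(c + L).+1%:R]natr1 -[r.+1%:R]natr1 natrD; apply: mk; lra.
  rewrite -[r.+1%:R]natr1; lra.
- apply: (le_trans (errS_good _ s0 k1' S1 _) (eN _ _)).
    rewrite -[(n - c - L).+1%:R]natr1 (natrB _ (ltnW rn)) natrB // natrB //; apply: mk; lra.
  rewrite -[(n - c - L).+1%:R]natr1 natrB // natrB //; lra.
- apply: (le_trans (errW_good _ s0 k1' S1 _) (eN _ _)).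
    rewrite -[(n - c + L).+1%:R]natr1 natrD (natrB _ (ltnW rn)) natrB //; apply: mk; lra.
  rewrite (natrB _ (ltnW rn)); lra.
Qed.

End NearDiagonal.

(** * The bound of order two thirds *)

Section PowerDecay.
Context {R : realType}.
Implicit Types (s k : R).

(** [l] is the cube root of ln N / N, so the target is l^2; an error 1 / N is at most l^3 / ln 2 and
    is absorbed since l is at most 1. *)
Lemma log_ratio (N : R) : (2 <= N)%R -> exists l : R,
  [/\ (0 < l)%R, (l ^+ 3 * N = ln N)%R, ((ln N / N) `^ (2%:R / 3%:R) = l ^+ 2)%R
    & (expR (- ln N) <= l ^+ 2 / ln 2)%R].
Proof.
move=> N2; have N0 : (0 < N)%R := lt_le_trans (ltr0Sn R 1) N2.
have ln2 : (0 < ln 2 :> R)%R by rewrite ln_gt0 // ltr1n.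
have lnN : (ln 2 <= ln N)%R by rewrite ler_ln ?posrE.
have lnN0 : (0 < ln N)%R := lt_le_trans ln2 lnN.
set x := (ln N / N)%R; have x0 : (0 < x)%R by rewrite divr_gt0.
have x1 : (x <= 1)%R by rewrite ler_pdivrMr // mul1r ltW // ln_sublinear.
exists (x `^ (3%:R^-1))%R.
have l3 : ((x `^ (3%:R^-1)) ^+ 3 = x)%R.
  by rewrite -powR_mulrn ?powR_ge0 // -powRrM mulVf ?powRr1 ?ltW // pnatr_eq0.
have l0 : (0 < x `^ (3%:R^-1))%R by rewrite powR_gt0.
split => //.
- by rewrite l3 /x divfK // gt_eqF.
- by rewrite mulrC powRrM powR_mulrn ?powR_ge0.
have l1 : (x `^ (3%:R^-1) <= 1)%R.
  by rewrite -(@expr_le1 _ 3) ?l3 // ltW.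
rewrite expRN lnK ?posrE // ler_pdivlMr //.
apply: (@le_trans _ _ x).
  by rewrite /x mulrC ler_wpM2r // invr_ge0 ltW.
by rewrite -[leLHS]l3 ler_wiXn2l // ltW.
Qed.

Lemma far_ratio (a b k N : R) : N != 0%R -> a != 0%R ->
  ((k * N / a) ^+ 3 * (b / N ^+ 2) = b / a ^+ 3 * (k ^+ 3 * N))%R.
Proof. by move=> N0 a0; field; rewrite N0 a0. Qed.

Lemma part_two_up s : (0 < s < 1)%R -> exists C : R, (0 < C)%R /\
  forall n c r : nat, (c <= n)%N -> (r < n)%N -> (c + r <= n)%N -> (2 <= c + r)%N ->
  prob_up (s ^+ 2) n c r <= (C * (ln (c + r)%:R / (c + r)%:R) `^ (2%:R / 3%:R))%:E.
Proof.
move=> hs; have /andP[s0 s1] := hs.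
have [c0 [C0 [c0p C0p far]]] := part_one_up hs.
have ln2 : (0 < ln 2 :> R)%R by rewrite ln_gt0 // ltr1n.
have [z zE] : exists z : R, z = (16%:R ^+ 3)%R by eexists.
have [y yE] : exists y : R, y = (2 ^+ 6)%R by eexists.
have [w wE] : exists w : R, w = ((1 - s) / 128%:R)%R by eexists.
have z0 : (0 < z)%R by rewrite zE exprn_gt0 // ltr0n.
have y0 : (0 < y)%R by rewrite yE exprn_gt0 // ltr0n.
have w0 : (0 < w)%R by rewrite wE divr_gt0 ?subr_gt0 // ltr0n.
(* With k = K l one has k^3 N = K^3 ln N. The summands ensure in turn that K is at least 1, that k^3
   N is at least 2^6, that the exit errors are at most 1 / N, and that so is the exponential of (i)
   far from the diagonal. *)
pose K := (1 + y / ln 2 + 16%:R / s + z / c0)%R.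
have a1 : (0 < y / ln 2)%R by rewrite divr_gt0.
have a2 : (0 < 16%:R / s)%R by rewrite divr_gt0 // ltr0n.
have a3 : (0 < z / c0)%R by rewrite divr_gt0.
have K1 : (1 <= K)%R by rewrite /K; lra.
have Ky : (y / ln 2 <= K)%R by rewrite /K; lra.
have Ks : (16%:R / s <= K)%R by rewrite /K; lra.
have Kz : (z / c0 <= K)%R by rewrite /K; lra.
clearbody K.
have K0 : (0 < K)%R by rewrite (lt_le_trans _ K1).
have K3 : (K <= K ^+ 3)%R by rewrite ler_eXnr.
pose D := (32%:R / (1 - s) + s^-1)%R.
(* The first square makes the bound trivial when k exceeds [w], the second is the main term near the
   diagonal, and the last summand collects the errors of order 1 / N. *)
pose C := ((K / w) ^+ 2 + (D * K) ^+ 2 + (C0 + 4) / ln 2)%R.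
have b1 : (0 <= (K / w) ^+ 2)%R by exact: sqr_ge0.
have b2 : (0 <= (D * K) ^+ 2)%R by exact: sqr_ge0.
have b3 : (0 < (C0 + 4) / ln 2)%R by rewrite divr_gt0 // addr_gt0.
exists C; split; first by rewrite /C; lra.
have hq : (0 <= s ^+ 2 < 1)%R by rewrite exprn_ge0 ?(ltW s0) // exprn_ilt1 // ltW.
move=> n c r cn rn crn cr2.
have near := @part_two_near R s _ n c r hs _ cn rn crn.
have {}far := far n c r cn rn crn (ltnW cr2).
set N := ((c + r)%:R)%R in far near *.
have N2 : (2 <= N)%R by rewrite /N ler_nat.
have N0 : (0 < N)%R := lt_le_trans (ltr0Sn R 1) N2.
have [l [l0 l3 -> hE]] := log_ratio N2.
have l2 : (0 <= l ^+ 2)%R by exact: sqr_ge0.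
have lnN : (ln 2 <= ln N)%R by rewrite ler_ln ?posrE.
have lnN0 : (0 < ln N)%R := lt_le_trans ln2 lnN.
pose k := (K * l)%R.
have k0 : (0 < k)%R by rewrite mulr_gt0.
have k3 : (k ^+ 3 * N = K ^+ 3 * ln N)%R by rewrite /k exprMn -mulrA l3.
have CE : (C * l ^+ 2 = (K / w * l) ^+ 2 + (D * k) ^+ 2 + (C0 + 4) * (l ^+ 2 / ln 2))%R.
  by rewrite /C /k; field; rewrite !gt_eqF.
have d1 : (0 <= (K / w * l) ^+ 2)%R by exact: sqr_ge0.
have d2 : (0 <= (D * k) ^+ 2)%R by exact: sqr_ge0.
have d3 : (0 <= l ^+ 2 / ln 2)%R by rewrite divr_ge0 // ltW.
have [kw|wk] := leP k w; last first.
  apply: (le_trans (prob_up_le1 n c r hq)); rewrite lee_fin CE.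
  apply: (@le_trans _ _ ((K / w * l) ^+ 2)%R).
    rewrite exprn_ege1 // mulrAC -/k ler_pdivlMr // mul1r ltW //.
  by rewrite -addrA lerDl addr_ge0 // mulr_ge0 // addr_ge0 // ltW.
have [nr|fr] := leP (`|r%:R - c%:R|)%R (k * N / 16%:R)%R.
  have hk : (0 < k <= (1 - s) / 128%:R)%R by rewrite k0 -wE.
  have h6 : (2 ^+ 6 <= k ^+ 3 * N)%R.
    rewrite k3 -yE; apply: (@le_trans _ _ (K * ln 2))%R.
      by rewrite -ler_pdivrMr.
    by rewrite ler_pM // ltW.
  apply: (le_trans (near _ hk h6 nr)); rewrite lee_fin CE -/D.
  apply: (@le_trans _ _ ((D * k) ^+ 2 + 4 * (l ^+ 2 / ln 2)))%R.
    rewrite lerD2l ler_pM2l //; apply: le_trans hE.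
    rewrite ler_expR lerN2 k3 mulrA ler_peMl ?(ltW lnN0) //.
    rewrite mulrC -ler_pdivrMr ?divr_gt0 ?ltr0n // mul1r invf_div.
    exact: le_trans Ks K3.
  have : (0 <= C0 * (l ^+ 2 / ln 2))%R by rewrite mulr_ge0 // ltW.
  lra.
(* At distance more than k N / 16 from the diagonal, the exponent in (i) is at least (c0 / 16^3) k^3
   N. *)
apply: (le_trans far); rewrite lee_fin CE.
apply: (@le_trans _ _ (C0 * (l ^+ 2 / ln 2)))%R; last by lra.
rewrite ler_pM2l //; apply: le_trans hE; rewrite ler_expR mulNr lerN2.
have h3 : ((k * N / 16%:R) ^+ 3 <= `|r%:R - c%:R| ^+ 3)%R.
  by rewrite lerXn2r ?nnegrE ?(ltW fr) // divr_ge0 // mulr_ge0 // ltW.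
have -> : (c0 * (`|r%:R - c%:R| ^+ 3 / N ^+ 2) = `|r%:R - c%:R| ^+ 3 * (c0 / N ^+ 2))%R by ring.
apply: (@le_trans _ _ ((k * N / 16%:R) ^+ 3 * (c0 / N ^+ 2)))%R; last first.
  by rewrite ler_wpM2r // divr_ge0 ?sqr_ge0 // ltW.
have -> : ((k * N / 16%:R) ^+ 3 * (c0 / N ^+ 2) = c0 / z * (k ^+ 3 * N))%R.
  by rewrite zE far_ratio ?gt_eqF // ltr0n.
rewrite k3 mulrA ler_peMl ?(ltW lnN0) //.
rewrite mulrC -ler_pdivrMr ?divr_gt0 // mul1r invf_div.
exact: le_trans Kz K3.
Qed.

End PowerDecay.

(** * From edges to vertices *)

Section Conclusion.
Context {R : realType}.

Lemma passage_local a b i j : (forall u, (u.1 <= i)%N -> (u.2 <= j)%N -> a u = b u) ->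
  passage a i j = passage b i j.
Proof.
move=> ab; apply: lpp_local => x y xi yj; rewrite /shift_env /=.
case: ifP => // _; apply: ab => /=; first by case: x xi.
by case: y yj.
Qed.

Lemma best_up_local n a b c r : (c <= n)%N -> (r < n)%N ->
  (forall u, (u.1 <= n)%N -> (u.2 <= n)%N -> a u = b u) -> best_up n a c r = best_up n b c r.
Proof.
move=> cn rn ab.
have e1 i : (i <= n)%N -> passage a i r = passage b i r.
  move=> iln; apply: passage_local => u u1 u2; apply: ab; first exact: leq_trans iln.
  by rewrite (leq_trans u2) // ltnW.
have e2 i : passage (rotate n a) (n - i) (n - r.+1) = passage (rotate n b) (n - i) (n - r.+1).
  by apply: passage_local => u _ _; apply: ab; exact: leq_subr.
apply: eq_in_all => i; rewrite mem_iota add0n ltnS => /andP[_ iln].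
by rewrite !e1 // !e2.
Qed.

(** Union bound over the two edges leaving the vertex; the tests keep the edges that stay in the
    box, and c + r <= n with 0 < n excludes the endpoint (n, n). *)
Lemma geom_prob_geod (p : R) n c r : (0 < p)%R -> (p < 1)%R -> (0 < n)%N -> (c + r <= n)%N ->
  geom_prob p (fun w : config n => in_geod (env w) (0%N, 0%N) (n, n) (c, r)) <=
  (if (r < n)%N then prob_up (1 - p)%R n c r else 0) +
  (if (c < n)%N then prob_up (1 - p)%R n r c else 0).
Proof.
move=> p0 p1 n0 crn.
have cn : (c <= n)%N := leq_trans (leq_addr _ _) crn.
have rn : (r <= n)%N := leq_trans (leq_addl _ _) crn.
have hq : (0 <= 1 - p < 1)%R by rewrite subr_ge0 ltW //= gtrBl.
pose B (om : pt -> nat) :=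
  ((r < n)%N && best_up n om c r) || ((c < n)%N && best_up n (om \o transpose) r c).
have BE (w : config n) : in_geod (env w) (0%N, 0%N) (n, n) (c, r) -> B (env w).
  move=> h; have ne : (c, r) != (n, n).
    apply/eqP => -[e1 e2]; move: crn; rewrite e1 e2.
    by rewrite -{3}[n]addn0 leq_add2l leqNgt n0.
  by case: (in_geod_edge h ne) => -[h1 h2]; rewrite /B h1 h2 // orbT.
apply: (le_trans (geom_prob_expect p0 p1 BE _)).
  move=> a b ab; rewrite /B; congr (_ || _).
    by case: (ltnP r n) => //= h; exact: best_up_local.
  case: (ltnP c n) => //= h; apply: best_up_local => // -[x y] /= hx hy.
  exact: ab.
apply: (@le_trans _ _ (expect (fun=> 1 - p)%R (box n n) (fun om : pt -> nat =>
    ind ((r < n)%N && best_up n om c r) +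
    ind ((c < n)%N && best_up n (om \o transpose) r c)) (fun=> 0%N))).
  apply: le_expect => // om; rewrite /B /ind -EFinD lee_fin -natrD ler_nat.
  by case: (_ && _); case: (_ && _).
rewrite expectD //; try by move=> om; exact: ind_ge0.
apply: leeD.
  case: ifP => h; first by rewrite le_refl.
  by rewrite (expect_indep _ (F := fun=> 0)).
case: ifP => h; last by rewrite (expect_indep _ (F := fun=> 0)).
rewrite expect_transpose //; last by move=> om; exact: ind_ge0.
Qed.

Lemma up_to_geod (s B : R) n c r : (0 < s < 1)%R -> (0 < n)%N -> (c + r <= n)%N -> (0 <= B)%R ->
  ((r < n)%N -> prob_up (s ^+ 2) n c r <= B%:E) ->
  ((c < n)%N -> prob_up (s ^+ 2) n r c <= B%:E) ->
  geom_prob (1 - s ^+ 2)%R (fun w : config n => in_geod (env w) (0%N, 0%N) (n, n) (c, r)) <=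
  (2 * B)%:E.
Proof.
move=> /andP[s0 s1] n0 crn B0 h1 h2.
have p0 : (0 < 1 - s ^+ 2)%R by rewrite subr_gt0 exprn_ilt1 // ltW.
have p1 : (1 - s ^+ 2 < 1)%R by rewrite gtrBl exprn_gt0.
apply: (le_trans (geom_prob_geod p0 p1 n0 crn)); rewrite subKr.
have -> : (2 * B = B + B)%R by ring.
rewrite EFinD; apply: leeD; case: ifP => h; rewrite ?lee_fin //.
  exact: h1.
exact: h2.
Qed.

End Conclusion.

Local Close Scope ereal_scope.

Theorem theorem1p3 (R : realType) (p : R) (hp0 : 0 < p) (hp1 : p < 1) :
  exists c C : R, 0 < c /\ 0 < C /\
  forall n : nat, (1 <= n)%N ->
  forall v1 v2 : nat, (v1 <= n)%N -> (v2 <= n)%N -> (v1 + v2 <= n)%N ->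
  ((v1, v2) != (0%N, 0%N) ->
     (geom_prob p (fun w : config n => in_geod (env w) (0%N, 0%N) (n, n) (v1, v2))
      <= (C * expR (- c * (`|(v2%:R - v1%:R : R)| ^+ 3 / ((v1 + v2)%:R) ^+ 2)))%:E)%E)
  /\
  ((2 <= v1 + v2)%N ->
     (geom_prob p (fun w : config n => in_geod (env w) (0%N, 0%N) (n, n) (v1, v2))
      <= (C * (ln ((v1 + v2)%:R : R) / (v1 + v2)%:R) `^ (2%:R / 3%:R))%:E)%E).
Proof.
pose s := Num.sqrt (1 - p).
have s2 : s ^+ 2 = 1 - p by rewrite sqr_sqrtr // subr_ge0 ltW.
have s0 : 0 < s by rewrite sqrtr_gt0 subr_gt0.
have s1 : s < 1 by rewrite -(@expr_lt1 _ 2) ?(ltW s0) // s2 gtrBl.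
have hs : (0 < s < 1)%R by rewrite s0.
have pE : p = 1 - s ^+ 2 by rewrite s2 subKr.
have [c0 [C0 [c0p C0p one]]] := part_one_up hs.
have [C2 [C2p two]] := part_two_up hs.
exists c0, (2 * (C0 + C2)); split=> //; split; first by rewrite mulr_gt0 // addr_gt0.
move=> n n0 v1 v2 v1n v2n vn; rewrite pE; clearbody s.
split=> [ne|v2le]; rewrite -mulrA; apply: up_to_geod => //.
- by rewrite mulr_ge0 ?expR_ge0 // addr_ge0 // ltW.
- have v0 : (0 < v1 + v2)%N.
    rewrite lt0n addn_eq0; apply: contra ne => /andP[/eqP-> /eqP->] //.
  move=> h; apply: le_trans (one n v1 v2 v1n h vn v0) _.
  by rewrite lee_fin ler_wpM2r ?expR_ge0 // lerDl ltW.
- have v0 : (0 < v2 + v1)%N.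
    rewrite lt0n addn_eq0 andbC; apply: contra ne => /andP[/eqP-> /eqP->] //.
  move=> h; have vn' : (v2 + v1 <= n)%N by rewrite addnC.
  apply: le_trans (one n v2 v1 v2n h vn' v0) _.
  by rewrite lee_fin distrC addnC ler_wpM2r ?expR_ge0 // lerDl ltW.
- by rewrite mulr_ge0 ?powR_ge0 // addr_ge0 // ltW.
- move=> h; apply: le_trans (two n v1 v2 v1n h vn v2le) _.
  by rewrite lee_fin ler_wpM2r ?powR_ge0 // lerDr ltW.
- move=> h; rewrite addnC in vn v2le *.
  apply: le_trans (two n v2 v1 v2n h vn v2le) _.
  by rewrite lee_fin ler_wpM2r ?powR_ge0 // lerDr ltW.
Qed.
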